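(* Let $X$ be a positive random variable whose distribution admits a density $f$ that is twice continuously differentiable on $(0,\infty)$, and let $X_1,\ldots,X_n$ be i.i.d. copies of $X$. Suppose there exist $\alpha,\beta\in(0,+\infty]$ with $2\alpha+\beta>5/2$ such that $\mathbb{E}(X^{-\alpha})<\infty$ and $\mathbb{E}(X^{\beta})<\infty$. Let $\xi>0$ and $\theta\in[0,\pi/2]$ satisfy $\frac{\xi}{\cos^2\theta}>\frac14-\frac{\beta}{2}$ and $\frac{\xi}{\sin^2\theta}>1-\alpha$. Let $\eta=\eta_n>0$ satisfy $\eta\to0$ and $n\eta\to\infty$ as $n\to\infty$. Let $\hat f$ be the Mellin-Meijer kernel density estimator with parameters $(\xi,\theta)$ and smoothing parameter $\eta$ (see context). Then, for any $x\in(0,\infty)$, as $n\to\infty$, $$\mathbb{E}\left(\hat f(x)\right)-f(x)=\frac12\eta^2xf''(x)+o(\eta^2)$$ and $$\mathrm{Var}\left(\hat f(x)\right)=\frac{f(x)}{2\sqrt{\pi}\,n\eta\sqrt{x}}+o((n\eta)^{-1}).$$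
   Context: Mellin transform: for a function $g$ on $(0,\infty)$, $\mathcal{M}(g;z)=\int_0^\infty x^{z-1}g(x)\,dx$ for complex $z$ where the integral converges absolutely. Meijer densities: for $\nu,\gamma,\xi>0$ and $\theta\in(0,\pi/2)$, $L_{\nu,\gamma,\xi,\theta}$ is the probability density on $(0,\infty)$ with Mellin transform $$\mathcal{M}(L_{\nu,\gamma,\xi,\theta};z)=\nu^{z-1}\left(\frac{1}{\tan^2\theta}\right)^{\xi(z-1)}\frac{\Gamma\left(\frac{\xi^2}{\gamma^2\cos^2\theta}+\xi(z-1)\right)\Gamma\left(\frac{\xi^2}{\gamma^2\sin^2\theta}+\xi(1-z)\right)}{\Gamma\left(\frac{\xi^2}{\gamma^2\cos^2\theta}\right)\Gamma\left(\frac{\xi^2}{\gamma^2\sin^2\theta}\right)}$$ for $1-\frac{\xi}{\gamma^2\cos^2\theta}<\Re(z)<1+\frac{\xi}{\gamma^2\sin^2\theta}$; equivalently, it is the density of $\nu W^\xi$ where $W$ has the Fisher-Snedecor $F$-distribution with $\frac{2\xi^2}{\gamma^2\cos^2\theta}$ and $\frac{2\xi^2}{\gamma^2\sin^2\theta}$ degrees of freedom. For $\theta=0$ (resp. $\theta=\pi/2$), $L_{\nu,\gamma,\xi,\theta}$ is the density of $\nu W^\xi$ with $W\sim\mathrm{Gamma}(\xi^2/\gamma^2,\xi^2/\gamma^2)$ (resp. $W\sim\mathrm{InverseGamma}(\xi^2/\gamma^2,\xi^2/\gamma^2)$). Here $\mathrm{Gamma}(a,b)$ has density $\frac{b^a}{\Gamma(a)}x^{a-1}e^{-bx}$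 and $\mathrm{InverseGamma}(a,b)$ is the law of $1/W$ with $W\sim\mathrm{Gamma}(a,b)$. Meijer kernels: given $\xi>0$, $\theta\in[0,\pi/2]$ (the same for all $k$) and $\eta>0$, set for each $k$ $$\gamma_\eta^{(k)}=\frac{\eta}{\sqrt{\eta^2+X_k}},\qquad \nu_\eta^{(k)}=1+\frac12\left(\gamma_\eta^{(k)}\right)^2\left(1+\frac{\cos2\theta}{\xi}\right),\qquad L_\eta^{(k)}=L_{\nu_\eta^{(k)},\gamma_\eta^{(k)},\xi,\theta}.$$ Mellin-Meijer kernel density estimator: $\displaystyle \hat f(x)=\frac1n\sum_{k=1}^n\frac{1}{X_k}L_\eta^{(k)}\left(\frac{x}{X_k}\right)$, $x>0$. Conventions: $\xi/0=+\infty$; $\alpha=+\infty$ (resp. $\beta=+\infty$) means that all negative (resp. positive) power moments of $X$ are finite. *)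

(* Defs.v *)
From HB Require Import structures.
From mathcomp Require Export all_boot all_order all_algebra finmap.
From mathcomp Require Export all_classical all_reals all_analysis.

Set Implicit Arguments.
Unset Strict Implicit.
Unset Printing Implicit Defensive.

Import Order.TTheory GRing.Theory Num.Theory.
Import numFieldNormedType.Exports.

Local Open Scope classical_set_scope.
Local Open Scope ring_scope.

Section densities.
Context {R : realType}.
Implicit Types (a b xi nu gamma theta y : R) (g : R -> R).

Definition Gamma_fun a : R :=
  \int[lebesgue_measure]_(t in `]0, +oo[%classic) (t `^ (a - 1) * expR (- t)).

(* The following formulas are only meaningful at y > 0. *)

Definition gamma_pdf a b y : R :=
  b `^ a / Gamma_fun a * y `^ (a - 1) * expR (- (b * y)).

(* Density of 1/W when W has density gamma_pdf a b. *)
Definition inverse_gamma_pdf a b y : R := gamma_pdf a b y^-1 / y ^+ 2.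

(* Fisher-Snedecor F-distribution with (possibly non-integral) d1 and d2
   degrees of freedom. *)
Definition fisher_pdf (d1 d2 : R) y : R :=
  Gamma_fun ((d1 + d2) / 2) / (Gamma_fun (d1 / 2) * Gamma_fun (d2 / 2))
  * (d1 / d2) `^ (d1 / 2) * y `^ (d1 / 2 - 1)
  * (1 + d1 / d2 * y) `^ (- ((d1 + d2) / 2)).

(* Density at y of nu * W `^ xi when the positive random variable W has
   density g: the change of variables w = (y / nu) `^ xi^-1.  When nu <= 0,
   nu * W `^ xi does not charge (0, +oo), whence the value 0. *)
Definition scaled_power_pdf nu xi g y : R :=
  if (0 < nu) && (0 < y) then
    g ((y / nu) `^ xi^-1) * ((y / nu) `^ (xi^-1 - 1) / (nu * xi))
  else 0.

(* L_{nu,gamma,xi,theta} for theta in [0, pi/2], as the density of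
   nu * W `^ xi.  It is this continuous version that matters, since the kernels
   below are evaluated at data-dependent parameters. *)
Definition meijer_pdf nu gamma xi theta : R -> R :=
  let c := xi ^+ 2 / gamma ^+ 2 in
  scaled_power_pdf nu xi
    (if theta == 0 then gamma_pdf c c
     else if theta == pi / 2 then inverse_gamma_pdf c c
     else fisher_pdf (2 * xi ^+ 2 / (gamma ^+ 2 * cos theta ^+ 2))
                     (2 * xi ^+ 2 / (gamma ^+ 2 * sin theta ^+ 2))).

Definition kernel_gamma (eta u : R) : R := eta / Num.sqrt (eta ^+ 2 + u).

Definition kernel_nu xi theta (eta u : R) : R :=
  1 + 2^-1 * kernel_gamma eta u ^+ 2 * (1 + cos (2 * theta) / xi).

(* The kernel L_eta^(k) attached to an observation X_k = u. *)
Definition meijer_kernel xi theta (eta u : R) : R -> R :=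
  meijer_pdf (kernel_nu xi theta eta u) (kernel_gamma eta u) xi theta.

Definition mellin_meijer_estimator xi theta (T : Type) (X : nat -> T -> R)
    (eta : R) (n : nat) (x : R) (w : T) : R :=
  n%:R^-1 * \sum_(k < n)
    (X k w)^-1 * meijer_kernel xi theta eta (X k w) (x / X k w).

Definition C2_on_pos (f : R -> R) : Prop :=
  forall x, 0 < x ->
    [/\ derivable f x 1, derivable f^`()%classic x 1 & {for x, continuous f^`(2)%classic}].

End densities.

Section random_variables.
Context {d : measure_display} {T : measurableType d} {R : realType}.
Variable P : probability T R.
Local Open Scope ereal_scope.

Definition has_density_on_pos (X : {RV P >-> R}) (f : R -> R) : Prop :=
  [/\ measurable_fun (`]0%R, +oo[%classic : set R) f,
      forall x, (0 < x)%R -> (0 <= f x)%R &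
      forall A : set R, measurable A ->
        distribution P X A =
        \int[lebesgue_measure]_(x in A `&` `]0%R, +oo[) (f x)%:E].

Definition identically_distributed (X Y : {RV P >-> R}) : Prop :=
  forall A : set R, measurable A -> distribution P X A = distribution P Y A.

Definition mutually_independent (X : nat -> {RV P >-> R}) : Prop :=
  forall (J : {fset nat}) (A : nat -> set R),
    (forall i, measurable (A i)) ->
    P (\bigcap_(i in [set` J]) (X i @^-1` A i)) =
    \prod_(i <- J) P (X i @^-1` A i).

Definition iid_copies (X : {RV P >-> R}) (Xs : nat -> {RV P >-> R}) : Prop :=
  mutually_independent Xs /\ forall k, identically_distributed (Xs k) X.

Definition finite_power_moment (X : {RV P >-> R}) (p : R) : Prop :=
  'E_P[fun w => (X w `^ p)%R] < +oo.

(* An infinite order means that the moments of all positive orders are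
   finite. *)
Definition finite_pos_moment (X : {RV P >-> R}) (b : \bar R) : Prop :=
  match b with
  | p%:E => finite_power_moment X p
  | +oo => forall p : R, (0 < p)%R -> finite_power_moment X p
  | -oo => False
  end.

Definition finite_neg_moment (X : {RV P >-> R}) (a : \bar R) : Prop :=
  match a with
  | p%:E => finite_power_moment X (- p)
  | +oo => forall p : R, (0 < p)%R -> finite_power_moment X (- p)
  | -oo => False
  end.

End random_variables.

(* Main.v *)
(* Write [q = sin theta ^+ 2] and [h = eta ^+ 2].  A single observation [u]
   contributes [kern q xi x h u] to the estimator at [x].  Up to a factor this is
   [sqrt N * expR (- (N * phase q s))] with [N = xi ^+ 2 * (h + u) / h] and [s] the
   logarithm of [x / (u * nu)] divided by [xi], where [phase q] is nonnegative and
   vanishes to second order at 0 only.  The mean of the kernel is therefore a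
   Laplace integral concentrated at [u = x]: putting [u = x * (1 + eta * t)] and
   expanding the exponent, the normalising factor (by Stirling's formula) and [f]
   to second order in [eta], one is left with moments of a Gaussian law, where
   everything cancels except [f x + eta ^+ 2 * x * f'' x / 2].  The square of the
   kernel is treated in the same way.  Away from [u = x] the kernel is
   exponentially small in [1 / h], except near [u = 0], where it is
   [O(h `^ r * u `^ (- alpha))] for some [r > 1] because
   [1 - alpha < xi / sin theta ^+ 2]; the moment of order [- alpha] makes this
   part [o(h)].  Finally the variance of a mean of [n] independent copies is the
   variance of one copy divided by [n]. *)

Require Import Defs.
From mathcomp Require Import measurable_realfun ring lra.
Import Order.TTheory GRing.Theory Num.Theory.
Import numFieldNormedType.Exports.
Set Implicit Arguments.
Unset Strict Implicit.
Unset Printing Implicit Defensive.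
Local Open Scope classical_set_scope.
Local Open Scope ring_scope.

(** * Derivatives, limits and measurability by syntactic rules *)

(** The rescaled variable [t] runs over the whole line, so no expansion in [eta] is uniform in [t],
    and since [f] is only twice continuously differentiable the remainders have no rate. Hence the
    notion of jet: a second-order expansion valid while [e * t] is small, whose remainder tends to 0
    for each [t] and is dominated by a polynomial in [t]. Jets are stable under sums, products and
    substitution into Taylor-Young expansions, and dominated convergence integrates them.

    The kernel is a density in [x], not in the observation [u]: its integral against [du] need not
    be 1, and the coefficient of [f x] at order [eta ^+ 2] has to be seen to vanish. This needs the
    correction 1/12 in Stirling's formula, which comes from the same Laplace theorem applied to
    Euler's integral. The coefficient of [f' x] vanishes because of the value of [kernel_nu]. The
    gamma, inverse gamma and Fisher cases are treated together through the parameter [q]: the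
    derivative of the phase has one formula for all three. *)

Section derivation_rules.
Context {R : realType}.
Implicit Types (f g : R -> R) (x a b : R).
Local Notation der := (fun (x : R) (f : R -> R) (a : R) => is_derive x (1 : R) f a).

Lemma der_cst c x : der x (fun=> c) 0.
Proof. exact: is_derive_cst. Qed.

Lemma der_id x : der x (fun s => s) 1.
Proof. exact: is_derive_id. Qed.

Lemma der_add f g x a b : der x f a -> der x g b -> der x (fun s => f s + g s) (a + b).
Proof. exact: is_deriveD. Qed.

Lemma der_opp f x a : der x f a -> der x (fun s => - f s) (- a).
Proof. exact: is_deriveN. Qed.

Lemma der_mul f g x a b : der x f a -> der x g b ->
  der x (fun s => f s * g s) (f x * b + g x * a).
Proof. exact: is_deriveM. Qed.

Lemma der_exp f n x a : der x f a -> der x (fun s => f s ^+ n) (n%:R * f x ^+ n.-1 * a).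
Proof.
move=> fa; have -> : (fun s => f s ^+ n) = f ^+ n.
  by apply/funext => s; rewrite fctE.
exact: is_deriveX.
Qed.

Lemma der_inv f x a : f x != 0 -> der x f a -> der x (fun s => (f s)^-1) (- (f x ^+ 2)^-1 * a).
Proof. by move=> f0 fa; apply: is_derive_eq; [exact: (is_deriveV f0 fa)|]. Qed.

Lemma der_expR f x a : der x f a -> der x (fun s => expR (f s)) (expR (f x) * a).
Proof. by move=> fa; exact: (@is_derive1_comp _ expR f x). Qed.

Lemma der_ln f x a : 0 < f x -> der x f a -> der x (fun s => ln (f s)) ((f x)^-1 * a).
Proof.
by move=> f0 fa; have := is_derive1_ln f0 => ?; exact: (@is_derive1_comp _ (@ln R) f x).
Qed.

Lemma der_eq f x a b : der x f a -> a = b -> der x f b.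
Proof. by move=> ? <-. Qed.

End derivation_rules.

Ltac der :=
  lazymatch goal with
  | |- is_derive _ _ (fun _ => ?c) _ => exact: der_cst
  | |- is_derive _ _ (fun s => s) _ => exact: der_id
  | |- is_derive _ _ (fun s => @?f s + @?g s) _ =>
      refine (@der_add _ f g _ _ _ _ _); der
  | |- is_derive _ _ (fun s => - @?f s) _ => refine (@der_opp _ f _ _ _); der
  | |- is_derive _ _ (fun s => @?f s * @?g s) _ =>
      refine (@der_mul _ f g _ _ _ _ _); der
  | |- is_derive _ _ (fun s => @?f s ^+ ?n) _ => refine (@der_exp _ f n _ _ _); der
  | |- is_derive _ _ (fun s => (@?f s)^-1) _ => refine (@der_inv _ f _ _ _ _); [|der]
  | |- is_derive _ _ (fun s => expR (@?f s)) _ => refine (@der_expR _ f _ _ _); der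
  | |- is_derive _ _ (fun s => ln (@?f s)) _ => refine (@der_ln _ f _ _ _ _); [|der]
  | _ => eassumption
  end.

Section limit_rules.
Context {R : realType} {T : Type} {F : set_system T} {FF : Filter F}.
Implicit Types (f g : T -> R) (a b : R).

Lemma cvg_add f g a b : f s @[s --> F] --> a -> g s @[s --> F] --> b ->
  f s + g s @[s --> F] --> a + b.
Proof. exact: cvgD. Qed.

Lemma cvg_opp f a : f s @[s --> F] --> a -> - f s @[s --> F] --> - a.
Proof. exact: cvgN. Qed.

Lemma cvg_mul f g a b : f s @[s --> F] --> a -> g s @[s --> F] --> b ->
  f s * g s @[s --> F] --> a * b.
Proof. exact: cvgM. Qed.

Lemma cvg_exp n f a : f s @[s --> F] --> a -> f s ^+ n @[s --> F] --> a ^+ n.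
Proof. by move=> fa; exact: (continuous_cvg _ (@exprn_continuous _ n a) fa). Qed.

Lemma cvg_inv f a : a != 0 -> f s @[s --> F] --> a -> (f s)^-1 @[s --> F] --> a^-1.
Proof. by move=> a0; exact: cvgV. Qed.

Lemma cvg_expR f a : f s @[s --> F] --> a -> expR (f s) @[s --> F] --> expR a.
Proof. by move=> fa; exact: (continuous_cvg _ (@continuous_expR _ a) fa). Qed.

Lemma cvg_sqrt f a : f s @[s --> F] --> a -> Num.sqrt (f s) @[s --> F] --> Num.sqrt a.
Proof. by move=> fa; exact: (continuous_cvg _ (@sqrt_continuous _ a) fa). Qed.

Lemma cvg_ln f a : 0 < a -> f s @[s --> F] --> a -> ln (f s) @[s --> F] --> ln a.
Proof. by move=> a0 fa; exact: (continuous_cvg _ (continuous_ln a0) fa). Qed.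

End limit_rules.

Ltac cvg_tac :=
  assumption || lazymatch goal with
  | |- context [fmap (fun _ => ?c) _] => exact: cvg_cst
  | |- context [fmap (fun s => @?f s + @?g s) _] => refine (@cvg_add _ _ _ _ f g _ _ _ _); cvg_tac
  | |- context [fmap (fun s => - @?f s) _] => refine (@cvg_opp _ _ _ _ f _ _); cvg_tac
  | |- context [fmap (fun s => @?f s * @?g s) _] => refine (@cvg_mul _ _ _ _ f g _ _ _ _); cvg_tac
  | |- context [fmap (fun s => @?f s ^+ ?n) _] => refine (@cvg_exp _ _ _ _ n f _ _); cvg_tac
  | |- context [fmap (fun s => (@?f s)^-1) _] => refine (@cvg_inv _ _ _ _ f _ _ _); [|cvg_tac]
  | |- context [fmap (fun s => expR (@?f s)) _] => refine (@cvg_expR _ _ _ _ f _ _); cvg_tac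
  | |- context [fmap (fun s => ln (@?f s)) _] => refine (@cvg_ln _ _ _ _ f _ _ _); [|cvg_tac]
  | |- context [fmap (fun s => Num.sqrt (@?f s)) _] => refine (@cvg_sqrt _ _ _ _ f _ _); cvg_tac
  | _ => assumption || (match goal with H : forall t, _ |- _ => exact: H end)
  end.

Section measurability_rules.
Context {R : realType} {d : measure_display} {T : measurableType d}.
Implicit Types (f g : T -> R) (b : T -> bool).
Local Notation meas f := (measurable_fun setT f).

Lemma meas_add f g : meas f -> meas g -> meas (fun x => f x + g x).
Proof. exact: measurable_funD. Qed.

Lemma meas_mul f g : meas f -> meas g -> meas (fun x => f x * g x).
Proof. exact: measurable_funM. Qed.

Lemma meas_opp f : meas f -> meas (fun x => - f x).
Proof. by move=> mf; exact: measurableT_comp. Qed.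

Lemma meas_exp f n : meas f -> meas (fun x => f x ^+ n).
Proof. exact: measurable_funX. Qed.

Lemma meas_expR f : meas f -> meas (fun x => expR (f x)).
Proof. by move=> mf; exact: measurableT_comp. Qed.

Lemma meas_ln f : meas f -> meas (fun x => ln (f x)).
Proof. by move=> mf; exact: measurableT_comp. Qed.

Lemma meas_norm f : meas f -> meas (fun x => `|f x|).
Proof. by move=> mf; exact: measurableT_comp. Qed.

Lemma meas_max f g : meas f -> meas g -> meas (fun x => Num.max (f x) (g x)).
Proof. exact: measurable_maxr. Qed.

Lemma meas_sqrt f : meas f -> meas (fun x => Num.sqrt (f x)).
Proof.
move=> mf; apply: measurableT_comp => //.
by apply: continuous_measurable_fun; exact: sqrt_continuous.
Qed.

Lemma meas_lt f g : meas f -> meas g -> meas (fun x => f x < g x).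
Proof. exact: measurable_fun_ltr. Qed.

Lemma meas_le f g : meas f -> meas g -> meas (fun x => f x <= g x).
Proof. exact: measurable_fun_ler. Qed.

Lemma meas_and b b' : meas b -> meas b' -> meas (fun x => b x && b' x).
Proof. exact: measurable_and. Qed.

Lemma meas_if b f g : meas b -> meas f -> meas g -> meas (fun x => if b x then f x else g x).
Proof. exact: measurable_fun_ifT. Qed.

Lemma meas_inv f : meas f -> meas (fun x => (f x)^-1).
Proof.
move=> mf.
have -> : (fun x => (f x)^-1) = (fun x => if 0 < f x then expR (- ln (f x)) else
    if f x < 0 then - expR (- ln (- f x)) else 0).
  apply/funext => x; case: ltgtP => fx.
  - by rewrite expRN lnK.
  - by rewrite expRN lnK ?posrE ?oppr_gt0// invrN opprK.
  - by rewrite -fx invr0.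
have mfN := meas_opp mf.
have m0 : measurable_fun [set: T] (fun=> 0 : R) by [].
apply: meas_if; [exact: meas_lt|exact/meas_expR/meas_opp/meas_ln|].
by apply: meas_if; [exact: meas_lt|exact/meas_opp/meas_expR/meas_opp/meas_ln|].
Qed.

End measurability_rules.

Ltac eta_expand :=
  match goal with |- measurable_fun ?D ?F => change (measurable_fun D (fun x => F x)); cbv beta end.

Ltac meas :=
  lazymatch goal with
  | |- measurable_fun _ (fun _ => ?c) => done
  | |- measurable_fun _ (fun x => x) => exact: measurable_id
  | |- measurable_fun _ (fun x => @?f x + @?g x) => refine (@meas_add _ _ _ f g _ _); meas
  | |- measurable_fun _ (fun x => @?f x * @?g x) => refine (@meas_mul _ _ _ f g _ _); meas
  | |- measurable_fun _ (fun x => - @?f x) => refine (@meas_opp _ _ _ f _); meas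
  | |- measurable_fun _ (fun x => @?f x ^+ ?n) => refine (@meas_exp _ _ _ f n _); meas
  | |- measurable_fun _ (fun x => expR (@?f x)) => refine (@meas_expR _ _ _ f _); meas
  | |- measurable_fun _ (fun x => ln (@?f x)) => refine (@meas_ln _ _ _ f _); meas
  | |- measurable_fun _ (fun x => Num.norm (@?f x)) => refine (@meas_norm _ _ _ f _); meas
  | |- measurable_fun _ (fun x => Num.sqrt (@?f x)) => refine (@meas_sqrt _ _ _ f _); meas
  | |- measurable_fun _ (fun x => Num.max (@?f x) (@?g x)) => refine (@meas_max _ _ _ f g _ _); meas
  | |- measurable_fun _ (fun x => (@?f x)^-1) => refine (@meas_inv _ _ _ f _); meas
  | |- measurable_fun _ (fun x => andb (@?f x) (@?g x)) => refine (@meas_and _ _ f g _ _); meas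
  | |- measurable_fun _ (fun x => (@?f x < @?g x)%R) => refine (@meas_lt _ _ _ f g _ _); meas
  | |- measurable_fun _ (fun x => (@?f x <= @?g x)%R) => refine (@meas_le _ _ _ f g _ _); meas
  | _ => assumption || (apply: meas_if; eta_expand; meas)
  end.

(** * Expansions in a small parameter with polynomially bounded coefficients *)

Section jet_domain.
Context {R : realType}.
Implicit Types (F G S : R -> R -> R) (c : R -> R) (e t : R).

(* The filter along which [e -> 0^+] and [e * t -> 0], [t] being unbounded. *)
Definition jdom : set_system (R * R) :=
  filter_from [set d : R | 0 < d]
    (fun d => [set p : R * R | 0 < p.1 < d /\ `|p.1 * p.2| < d]).

Global Instance jdom_filter : Filter jdom.
Proof.
apply: filter_from_filter; first by exists 1 => /=.
move=> a b /= a0 b0; exists (Num.min a b); first by rewrite /= lt_min a0 b0.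
move=> [e t] /= [/andP[e0]]; rewrite !lt_min => /andP[ea eb] /andP[eta etb].
by rewrite !e0 ea eb eta etb.
Qed.

(** For a fixed [t] the constraint on [e * t] holds as soon as [e < d / (1 + |t|)]; this is how
    joint statements yield pointwise limits. *)
Lemma jdom_at_right (Q : R * R -> Prop) :
  (\forall p \near jdom, Q p) -> forall t, \forall e \near 0^'+, Q (e, t).
Proof.
move=> [d /= d0 dQ] t.
have t1 : 0 < 1 + `|t| by rewrite ltr_pwDl.
near=> e; apply: dQ => /=.
have e0 : 0 < e by near: e; exact: nbhs_right_gt.
rewrite e0 normrM gtr0_norm//; split.
  by near: e; apply: nbhs_right_lt.
have : e < d / (1 + `|t|).
  by near: e; apply: nbhs_right_lt; rewrite divr_gt0.
rewrite ltr_pdivlMr//; apply: le_lt_trans.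
by rewrite ler_pM2l// lerDr.
Unshelve. all: by end_near. Qed.

Lemma jdom_gt0 : \forall p \near jdom, 0 < p.1.
Proof. by exists 1 => //= p [/andP[]]. Qed.

Lemma jdom_le1 : \forall p \near jdom, p.1 <= 1.
Proof. by exists 1 => //= p [/andP[_ /ltW]]. Qed.

Lemma cvg_jdom1 : p.1 @[p --> jdom] --> (0 : R).
Proof.
apply/cvgrPdist_lt => d d0; exists d => //= p [/andP[p0 pd] _].
by rewrite sub0r normrN gtr0_norm.
Qed.

Lemma cvg_jdomM : p.1 * p.2 @[p --> jdom] --> (0 : R).
Proof.
apply/cvgrPdist_lt => d d0; exists d => //= p [_ pd].
by rewrite sub0r normrN.
Qed.

(** The degree is existential, so the property is closed under products; whatever the degree, a
    Gaussian weight makes the bound integrable. *)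
Definition pbd F := exists C m, 0 <= C /\
  \forall p \near jdom, `|F p.1 p.2| <= C * (1 + `|p.2|) ^+ m.

Lemma pbd_near F G : (\forall p \near jdom, F p.1 p.2 = G p.1 p.2) ->
  pbd F -> pbd G.
Proof.
move=> FG [C [m [C0 FC]]]; exists C, m; split=> //; near=> p.
have <- : F p.1 p.2 = G p.1 p.2 by near: p.
by near: p.
Unshelve. all: by end_near. Qed.

Lemma pbd_le F G : (\forall p \near jdom, `|G p.1 p.2| <= `|F p.1 p.2|) ->
  pbd F -> pbd G.
Proof.
move=> FG [C [m [C0 FC]]]; exists C, m; split=> //; near=> p.
by apply: (@le_trans _ _ `|F p.1 p.2|); near: p.
Unshelve. all: by end_near. Qed.

Lemma pbd_cst (k : R) : pbd (fun _ _ => k).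
Proof.
exists `|k|, 0%N; split => //; near=> p.
by rewrite expr0 mulr1.
Unshelve. all: by end_near. Qed.

Lemma pbd_eps : pbd (fun e _ => e).
Proof.
exists 1, 0%N; split => //; near=> p.
rewrite expr0 mulr1 ger0_norm//; first by near: p; exact: jdom_le1.
by apply: ltW; near: p; exact: jdom_gt0.
Unshelve. all: by end_near. Qed.

Lemma pbd_id : pbd (fun _ t => t).
Proof.
exists 1, 1%N; split => //; near=> p.
by rewrite expr1 mul1r lerDr.
Unshelve. all: by end_near. Qed.

Lemma pbd_add F G : pbd F -> pbd G -> pbd (fun e t => F e t + G e t).
Proof.
move=> [C [m [C0 FC]]] [D [n [D0 GD]]]; exists (C + D), (m + n)%N.
split; first exact: addr_ge0.
near=> p.
have h1 : 1 <= 1 + `|p.2| by rewrite lerDl.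
have FC' : `|F p.1 p.2| <= C * (1 + `|p.2|) ^+ m by near: p.
have GD' : `|G p.1 p.2| <= D * (1 + `|p.2|) ^+ n by near: p.
apply: (le_trans (ler_normD _ _)); rewrite mulrDl lerD//.
  by apply: (le_trans FC'); rewrite ler_wpM2l// ler_weXn2l// leq_addr.
by apply: (le_trans GD'); rewrite ler_wpM2l// ler_weXn2l// leq_addl.
Unshelve. all: by end_near. Qed.

Lemma pbd_mul F G : pbd F -> pbd G -> pbd (fun e t => F e t * G e t).
Proof.
move=> [C [m [C0 FC]]] [D [n [D0 GD]]]; exists (C * D), (m + n)%N.
split; first exact: mulr_ge0.
near=> p.
rewrite normrM exprD mulrACA ler_pM//; by near: p.
Unshelve. all: by end_near. Qed.

End jet_domain.

Ltac pbd_tac := assumption || (apply: pbd_add; pbd_tac) || (apply: pbd_mul; pbd_tac).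

Section jets.
Context {R : realType}.
Implicit Types (F G S : R -> R -> R) (c : R -> R) (e t : R).

(* The remainder tends to 0 pointwise and is dominated by a polynomial in [t]:
   against a Gaussian weight in [t], dominated convergence applies. *)
Definition jet F c0 c1 c2 := [/\ pbd (fun _ => c0), pbd (fun _ => c1),
  pbd (fun _ => c2) & exists r : R -> R -> R, [/\ pbd r,
   forall t, r e t @[e --> 0^'+] --> 0 & \forall p \near jdom,
   F p.1 p.2 = c0 p.2 + p.1 * c1 p.2 + p.1 ^+ 2 * c2 p.2 + p.1 ^+ 2 * r p.1 p.2]].

Lemma jet_pbd F c0 c1 c2 : jet F c0 c1 c2 -> pbd F.
Proof.
move=> [b0 b1 b2 [r [br _ Fr]]].
apply: pbd_near; last first.
  have be := @pbd_eps R.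
  have be2 := pbd_mul be be.
  exact: (pbd_add (pbd_add (pbd_add b0 (pbd_mul be b1)) (pbd_mul be2 b2)) (pbd_mul be2 br)).
near=> p; rewrite -!expr2; apply/esym.
by near: p.
Unshelve. all: by end_near. Qed.

Lemma jet_near F G c0 c1 c2 : (\forall p \near jdom, F p.1 p.2 = G p.1 p.2) ->
  jet F c0 c1 c2 -> jet G c0 c1 c2.
Proof.
move=> FG [b0 b1 b2 [r [br r0 Fr]]]; split => //; exists r; split=> //.
near=> p.
have <- : F p.1 p.2 = G p.1 p.2 by near: p.
by near: p.
Unshelve. all: by end_near. Qed.

Lemma jet_coef F c0 c1 c2 d0 d1 d2 :
  (forall t, c0 t = d0 t) -> (forall t, c1 t = d1 t) -> (forall t, c2 t = d2 t) ->
  jet F c0 c1 c2 -> jet F d0 d1 d2.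
Proof. by move=> /funext-> /funext-> /funext->. Qed.

Lemma jet_cst (k : R) : jet (fun _ _ => k) (fun=> k) (fun=> 0) (fun=> 0).
Proof.
split; try exact: pbd_cst.
exists (fun _ _ => 0); split; [exact: pbd_cst|by move=> t; exact: cvg_cst|].
by near=> p; rewrite !mulr0 !addr0.
Unshelve. all: by end_near. Qed.

Lemma jet_id : jet (fun _ t => t) id (fun=> 0) (fun=> 0).
Proof.
split; try exact: pbd_cst; first exact: pbd_id.
exists (fun _ _ => 0); split; [exact: pbd_cst|by move=> t; exact: cvg_cst|].
by near=> p; rewrite !mulr0 !addr0.
Unshelve. all: by end_near. Qed.

Lemma jet_eps : jet (fun e _ => e) (fun=> 0) (fun=> 1) (fun=> 0).
Proof.
split; try exact: pbd_cst.
exists (fun _ _ => 0); split; [exact: pbd_cst|by move=> t; exact: cvg_cst|].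
by near=> p; rewrite !mulr0 !addr0 mulr1 add0r.
Unshelve. all: by end_near. Qed.

Lemma jet_add F G c0 c1 c2 d0 d1 d2 : jet F c0 c1 c2 -> jet G d0 d1 d2 ->
  jet (fun e t => F e t + G e t) (fun t => c0 t + d0 t) (fun t => c1 t + d1 t)
    (fun t => c2 t + d2 t).
Proof.
move=> [b0 b1 b2 [r [br r0 Fr]]] [h0 h1 h2 [s [bs s0 Gs]]].
split; try exact: pbd_add.
exists (fun e t => r e t + s e t); split; first exact: pbd_add.
  by move=> t; rewrite -[X in _ --> X]addr0; apply: cvgD.
near=> p.
have -> : F p.1 p.2 = c0 p.2 + p.1 * c1 p.2 + p.1 ^+ 2 * c2 p.2 + p.1 ^+ 2 * r p.1 p.2 by near: p.
have -> : G p.1 p.2 = d0 p.2 + p.1 * d1 p.2 + p.1 ^+ 2 * d2 p.2 + p.1 ^+ 2 * s p.1 p.2 by near: p.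
ring.
Unshelve. all: by end_near. Qed.

Lemma cvg_pt_eps : e @[e --> (0:R)^'+] --> (0 : R).
Proof. exact: cvg_within. Qed.

Lemma jet_cvg F c0 c1 c2 : jet F c0 c1 c2 -> forall t, F e t @[e --> 0^'+] --> c0 t.
Proof.
move=> [_ _ _ [r [_ r0 Fr]]] t.
have h : c0 t + e * c1 t + e ^+ 2 * c2 t + e ^+ 2 * r e t @[e --> 0^'+] --> c0 t + 0 * c1 t + 0 * 0 * c2 t + 0 * 0 * 0.
  have he := cvg_pt_eps.
  rewrite /GRing.exp/=.
  by apply: cvgD; [apply: cvgD; [apply: cvgD; [exact: cvg_cst|apply: cvgM => //; exact: cvg_cst]|apply: cvgM; [exact: cvgM|exact: cvg_cst]]|apply: cvgM; [exact: cvgM|exact: r0]].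
move: h; rewrite !mul0r !addr0; apply: cvg_trans; apply: near_eq_cvg.
by apply: filterS (jdom_at_right Fr t) => e /= ->.
Qed.

Arguments jet_cvg {F c0 c1 c2} _ t.

Lemma jet_mul F G c0 c1 c2 d0 d1 d2 : jet F c0 c1 c2 -> jet G d0 d1 d2 ->
  jet (fun e t => F e t * G e t) (fun t => c0 t * d0 t)
    (fun t => c0 t * d1 t + c1 t * d0 t)
    (fun t => c0 t * d2 t + c1 t * d1 t + c2 t * d0 t).
Proof.
move=> jF jG; have bF := jet_pbd jF; have bG := jet_pbd jG.
have cG := jet_cvg jG.
move: jF jG => [b0 b1 b2 [r [br r0 Fr]]] [h0 h1 h2 [s [bs s0 Gs]]].
have be := @pbd_eps R.
split; try by pbd_tac.
(* With [F = c + e ^+ 2 * r], [G = d + e ^+ 2 * s] and polynomial parts [c], [d], one has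
   [F * G = c * d + e ^+ 2 * (r * G + c * s)]; the last summand collects the terms of [c * d] of
   order 3 and 4. *)
exists (fun e t => r e t * G e t + (c0 t + e * (c1 t + e * c2 t)) * s e t +
  e * (c1 t * d2 t + c2 t * d1 t + e * (c2 t * d2 t))); split.
- pbd_tac.
- move=> t; have he := cvg_pt_eps.
  rewrite [X in _ --> X](_ : 0 = 0 * d0 t + (c0 t + 0 * (c1 t + 0 * c2 t)) * 0 +
    0 * (c1 t * d2 t + c2 t * d1 t + 0 * (c2 t * d2 t))); last by ring.
  cvg_tac.
- near=> p.
  have EG : G p.1 p.2 = d0 p.2 + p.1 * d1 p.2 + p.1 ^+ 2 * d2 p.2 + p.1 ^+ 2 * s p.1 p.2 by near: p.
  have -> : F p.1 p.2 = c0 p.2 + p.1 * c1 p.2 + p.1 ^+ 2 * c2 p.2 + p.1 ^+ 2 * r p.1 p.2 by near: p.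
  rewrite EG; ring.
Unshelve. all: by end_near. Qed.

(** The power [s ^+ k] is factored out because three coefficients are needed beyond it: the phase
    vanishes to order 2 and is divided by [e ^+ 2] later on. *)
Definition peano (k : nat) (g : R -> R) (g0 g1 g2 : R) :=
  exists r : R -> R, r s @[s --> 0] --> 0 /\
   \forall s \near 0, g s = s ^+ k * (g0 + g1 * s + g2 * s ^+ 2 + s ^+ 2 * r s).

Definition small S := p.1 * S p.1 p.2 @[p --> jdom] --> 0.

Lemma small_pt S : small S -> forall t, e * S e t @[e --> 0^'+] --> 0.
Proof.
move=> /cvgrPdist_lt sS t; apply/cvgrPdist_lt => d /sS h.
exact: (jdom_at_right h t).
Qed.

Arguments small_pt {S} _ t.

(** The factor [(e * S) ^+ k] stays outside [H], since [S] may vanish and cannot be divided out; [H]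
    is the bracket in [peano] evaluated at [e * S]. *)
Lemma jet_comp k g g0 g1 g2 S c0 c1 c2 :
  peano k g g0 g1 g2 -> small S -> jet S c0 c1 c2 ->
  exists H, jet H (fun=> g0) (fun t => g1 * c0 t)
    (fun t => g1 * c1 t + g2 * c0 t ^+ 2) /\
   (\forall p \near jdom, g (p.1 * S p.1 p.2) = (p.1 * S p.1 p.2) ^+ k * H p.1 p.2).
Proof.
move=> [r [r0 gr]] sS jS; have bS := jet_pbd jS.
exists (fun e t => g0 + g1 * (e * S e t) + g2 * (e * S e t) ^+ 2 + (e * S e t) ^+ 2 * r (e * S e t)).
split; last first.
  have sgr : \forall p \near jdom, _ := sS _ gr.
  by near=> p; near: p.
have jA : jet (fun e t => g0 + e * (g1 * S e t) + e * e * (g2 * (S e t * S e t)))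
   (fun=> g0) (fun t => g1 * c0 t) (fun t => g1 * c1 t + g2 * c0 t ^+ 2).
  by apply: (jet_coef _ _ _ (jet_add (jet_add (jet_cst g0)
    (jet_mul jet_eps (jet_mul (jet_cst g1) jS)))
      (jet_mul (jet_mul jet_eps jet_eps) (jet_mul (jet_cst g2) (jet_mul jS jS))))) => t /=; ring.
(* The Peano remainder is [e ^+ 2] times [S ^+ 2 * r (e * S)]; as [r] tends to 0, [small S] bounds
   [r (e * S)] near [jdom]. *)
have jB : jet (fun e t => e ^+ 2 * (S e t * S e t * r (e * S e t))) (fun=> 0) (fun=> 0) (fun=> 0).
  split; try exact: pbd_cst.
  exists (fun e t => S e t * S e t * r (e * S e t)); split.
  - apply: pbd_mul; first exact: pbd_mul.
    exists 1, 0%N; split => //.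
    have r1 : \forall s \near 0, `|r s| <= 1 * 1.
      rewrite mulr1; move/cvgrPdist_le : r0 => /(_ 1 ltr01).
      by apply: filterS => s; rewrite sub0r normrN.
    have : \forall p \near jdom, `|r (p.1 * S p.1 p.2)| <= 1 * 1 := sS _ r1.
    by apply: filterS => p; rewrite expr0.
  - move=> t; have cS := jet_cvg jS t.
    rewrite [X in _ --> X](_ : 0 = c0 t * c0 t * 0); last by rewrite mulr0.
    apply: cvgM; first exact: cvgM.
    exact: cvg_comp (small_pt sS t) r0.
  - by near=> p; rewrite !mulr0 !addr0 add0r.
apply: jet_near (jet_coef _ _ _ (jet_add jA jB)).
- by near=> p; rewrite /=; ring.
- by move=> t; rewrite addr0.
- by move=> t; rewrite addr0.
- by move=> t; rewrite addr0.
Unshelve. all: by end_near. Qed.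

End jets.

(** * Taylor-Young expansions at 0 *)

Section peano.
Context {R : realType}.
Implicit Types (f g D r : R -> R) (s : R).

(** The mean value theorem gives [D s = c ^+ m * r c * s] with [|c| <= |s|]; integrating the
    derivative instead would require regularity of [r]. *)
Lemma derive_little_o (m : nat) D r : D 0 = 0 -> r s @[s --> (0 : R)] --> 0 ->
  (\forall s \near (0 : R), is_derive (s : R) (1 : R) D (s ^+ m * r s)) ->
  D s / s ^+ m.+1 @[s --> (0 : R)] --> 0.
Proof.
move=> D0 r0 dD; apply/cvgrPdist_le => e e0.
have re : \forall s \near (0 : R), `|r s| <= e.
  move/cvgrPdist_le : r0 => /(_ e e0); apply: filterS => s.
  by rewrite sub0r normrN.
have /nbhs_ballP[d /= d0 dP] : \forall s \near (0 : R), is_derive (s : R) (1 : R) D (s ^+ m * r s) /\ `|r s| <= e.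
  by near=> s; split; near: s.
have db s : `|s| < d -> is_derive (s : R) (1 : R) D (s ^+ m * r s) /\ `|r s| <= e.
  by move=> sd; apply: dP; rewrite /ball/= sub0r normrN.
have main s : `|s| < d -> exists2 c, `|c| <= `|s| & D s = c ^+ m * r c * s.
  move=> sd; have [s0|s0|->] := ltgtP s 0; last first.
  - by exists 0 => //; rewrite D0 mulr0.
  - have [||c cs] := @MVT_segment _ D (fun c => c ^+ m * r c) 0 s (ltW s0).
    + move=> c; rewrite in_itv/= => /andP[c0 cs]; apply: (db _ _).1.
      by rewrite gtr0_norm// (lt_trans cs)// (le_lt_trans _ sd)// ler_norm.
    + apply: derivable_within_continuous => c; rewrite in_itv/= => /andP[c0 cs].
      apply: @ex_derive; apply: (db _ _).1.
      by rewrite ger0_norm// (le_lt_trans cs)// (le_lt_trans _ sd)// ler_norm.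
    + rewrite D0 !subr0 => ->; exists c => //.
      by move: cs; rewrite in_itv/= => /andP[c0 cs]; rewrite !ger0_norm// ltW.
  - have [||c cs] := @MVT_segment _ D (fun c => c ^+ m * r c) s 0 (ltW s0).
    + move=> c; rewrite in_itv/= => /andP[c0 cs]; apply: (db _ _).1.
      by rewrite ltr0_norm// ltrNl (le_lt_trans _ c0)// lerNl -ltr0_norm// ltW.
    + apply: derivable_within_continuous => c; rewrite in_itv/= => /andP[c0 cs].
      apply: @ex_derive; apply: (db _ _).1.
      by rewrite ler0_norm// (le_lt_trans _ sd)// ltr0_norm// lerN2.
    + rewrite D0 !sub0r => /eqP; rewrite mulrN eqr_opp => /eqP ->; exists c => //.
      by move: cs; rewrite in_itv/= => /andP[c0 cs]; rewrite !ler0_norm// ?lerN2// ltW.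
near=> s.
have [c cs ->] : exists2 c, `|c| <= `|s| & D s = c ^+ m * r c * s.
  apply: main; near: s; apply/nbhs_ballP; exists d => //= s.
  by rewrite /ball/= sub0r normrN.
have cd : `|c| < d.
  apply: (le_lt_trans cs); near: s; apply/nbhs_ballP; exists d => //= s.
  by rewrite /ball/= sub0r normrN.
rewrite sub0r normrN; have [->|s0] := eqVneq s 0.
  by rewrite mulr0 mul0r normr0 ltW.
rewrite exprS invfM mulrA mulfK// normrM normfV ler_pdivrMr ?normr_gt0 ?expf_neq0//.
rewrite normrM mulrC !normrX ler_pM// ?exprn_ge0//.
  exact: (db c cd).2.
by rewrite lerXn2r// ?nnegrE.
Unshelve. all: by end_near. Qed.

Lemma peano_near k f g (g0 g1 g2 : R) : (\forall s \near (0 : R), f s = g s) ->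
  peano k f g0 g1 g2 -> peano k g g0 g1 g2.
Proof.
move=> fg [r [r0 fr]]; exists r; split=> //; near=> s.
have <- : f s = g s by near: s.
by near: s.
Unshelve. all: by end_near. Qed.

Lemma peano_coef k f (g0 g1 g2 h0 h1 h2 : R) : g0 = h0 -> g1 = h1 -> g2 = h2 ->
  peano k f g0 g1 g2 -> peano k f h0 h1 h2.
Proof. by move=> -> -> ->. Qed.

(** Term-by-term integration: [f - Q] has derivative [s ^+ k.+2 * r s], so [derive_little_o]
    applies. The logarithmic expansions and that of the phase are obtained this way from their
    derivatives. *)
Lemma peano_derive k f g (g0 g1 g2 : R) : f 0 = 0 ->
  (\forall s \near (0 : R), is_derive (s : R) (1 : R) f (g s)) -> peano k g g0 g1 g2 ->
  peano k.+1 f (g0 / k.+1%:R) (g1 / k.+2%:R) (g2 / k.+3%:R).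
Proof.
move=> f0 df [r [r0 gr]].
pose Q s := g0 / k.+1%:R * s ^+ k.+1 + g1 / k.+2%:R * s ^+ k.+2 + g2 / k.+3%:R * s ^+ k.+3.
have : (f s - Q s) / s ^+ k.+3 @[s --> (0 : R)] --> 0.
  apply: (@derive_little_o k.+2 _ r) => //.
    by rewrite f0 /Q !exprS !mul0r !mulr0 !addr0 subr0.
  near=> s.
  have dfs : is_derive (s : R) (1 : R) f (g s) by near: s.
  rewrite /Q; apply: der_eq; first by der.
  have -> : g s = s ^+ k * (g0 + g1 * s + g2 * s ^+ 2 + s ^+ 2 * r s) by near: s.
  rewrite /= !exprS.
  field.
  by rewrite -!natr1 !gt_eqF// ?ltr_wpDl.
exists (fun s => (f s - Q s) / s ^+ k.+3); split=> //.
near=> s; have [->|s0] := eqVneq s 0; first by rewrite f0 exprS !mul0r.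
rewrite /Q !exprS; field.
rewrite s0 expf_neq0//= -!natr1 !gt_eqF//; lra.
Unshelve. all: by end_near. Qed.


Lemma cvg_id0 : s @[s --> (0 : R)] --> (0 : R).
Proof. exact: cvg_id. Qed.

Lemma peano_mul k l f g (f0 f1 f2 g0 g1 g2 : R) : peano k f f0 f1 f2 ->
  peano l g g0 g1 g2 ->
  peano (k + l) (fun s => f s * g s) (f0 * g0) (f0 * g1 + f1 * g0)
    (f0 * g2 + f1 * g1 + f2 * g0).
Proof.
move=> [r [r0 fr]] [u [u0 gu]].
exists (fun s => r s * (g0 + g1 * s + g2 * (s * s) + s * s * u s) +
  (f0 + f1 * s + f2 * (s * s)) * u s + s * (f1 * g2 + f2 * g1 + s * (f2 * g2))).
split.
  have h := cvg_id0.
  rewrite [X in _ --> X](_ : 0 = 0 * (g0 + g1 * 0 + g2 * (0 * 0) + 0 * 0 * 0) +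
    (f0 + f1 * 0 + f2 * (0 * 0)) * 0 + 0 * (f1 * g2 + f2 * g1 + 0 * (f2 * g2))); last by ring.
  cvg_tac.
near=> s.
have -> : f s = s ^+ k * (f0 + f1 * s + f2 * s ^+ 2 + s ^+ 2 * r s) by near: s.
have -> : g s = s ^+ l * (g0 + g1 * s + g2 * s ^+ 2 + s ^+ 2 * u s) by near: s.
rewrite exprD; ring.
Unshelve. all: by end_near. Qed.

Lemma peano_scale k c f (f0 f1 f2 : R) : peano k f f0 f1 f2 ->
  peano k (fun s => c * f s) (c * f0) (c * f1) (c * f2).
Proof.
move=> [r [r0 fr]]; exists (fun s => c * r s); split.
  by rewrite -[X in _ --> X](mulr0 c); cvg_tac.
near=> s.
have -> : f s = s ^+ k * (f0 + f1 * s + f2 * s ^+ 2 + s ^+ 2 * r s) by near: s.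
ring.
Unshelve. all: by end_near. Qed.

Lemma peano_cvg f (f0 f1 f2 : R) k : peano k.+1 f f0 f1 f2 -> f s @[s --> (0 : R)] --> (0 : R).
Proof.
move=> [r [r0 fr]].
have h := cvg_id0.
have : s * (s ^+ k * (f0 + f1 * s + f2 * (s * s) + s * s * r s)) @[s --> (0 : R)] -->
  0 * (0 ^+ k * (f0 + f1 * 0 + f2 * (0 * 0) + 0 * 0 * 0)).
  have hk : s ^+ k @[s --> (0 : R)] --> (0 : R) ^+ k by exact: exprn_continuous.
  cvg_tac.
rewrite mul0r; apply: cvg_trans; apply: near_eq_cvg; apply: filterS fr => s ->.
by rewrite exprS; ring.
Qed.

Lemma peano_comp f g (f0 f1 f2 g0 g1 g2 : R) : peano 0 f f0 f1 f2 -> peano 1 g g0 g1 g2 ->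
  peano 0 (fun s => f (g s)) f0 (f1 * g0) (f1 * g1 + f2 * g0 ^+ 2).
Proof.
move=> [r [r0 fr]] pg; have cg := peano_cvg pg.
move: pg => [u [u0 gu]].
pose h s := g0 + g1 * s + g2 * (s * s) + s * s * u s.
(* Here [g s = s * h s], and the second summand is [f2 * (h s ^+ 2 - g0 ^+ 2)] without its factored
   power, by [h s - g0 = s * (g1 + g2 * s + s * u s)]. *)
exists (fun s => f1 * (g2 * s + s * u s) +
  f2 * ((h s + g0) * (g1 + g2 * s + s * u s)) * s + h s * h s * r (g s)).
split.
  have i := cvg_id0.
  have hh : h s @[s --> (0 : R)] --> g0 + g1 * 0 + g2 * (0 * 0) + 0 * 0 * 0 by rewrite /h; cvg_tac.
  have rg : r (g s) @[s --> (0 : R)] --> (0 : R) by exact: cvg_comp cg r0.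
  rewrite [X in _ --> X](_ : 0 = f1 * (g2 * 0 + 0 * 0) + f2 *
    ((g0 + g1 * 0 + g2 * (0 * 0) + 0 * 0 * 0 + g0) * (g1 + g2 * 0 + 0 * 0)) * 0 +
    (g0 + g1 * 0 + g2 * (0 * 0) + 0 * 0 * 0) * (g0 + g1 * 0 + g2 * (0 * 0) + 0 * 0 * 0) * 0); last by ring.
  cvg_tac.
have frg : \forall s \near (0 : R), f (g s) = (g s) ^+ 0 * (f0 + f1 * g s + f2 * g s ^+ 2 + g s ^+ 2 * r (g s)).
  exact: cg _ fr.
near=> s.
have -> : f (g s) = (g s) ^+ 0 * (f0 + f1 * g s + f2 * g s ^+ 2 + g s ^+ 2 * r (g s)) by near: s.
set rgs := r (g s).
have -> : g s = s ^+ 1 * (g0 + g1 * s + g2 * s ^+ 2 + s ^+ 2 * u s) by near: s.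
rewrite /h; ring.
Unshelve. all: by end_near. Qed.

(** Taylor-Young with a bare [o(s ^+ 2)], by two uses of [derive_little_o]: on the remainder [D'] of
    the derivative, then on [D]. *)
Lemma peano_C2 f f' f'' : (\forall s \near (0 : R), is_derive (s : R) (1 : R) f (f' s)) ->
  (\forall s \near (0 : R), is_derive (s : R) (1 : R) f' (f'' s)) ->
  f'' s @[s --> (0 : R)] --> f'' 0 -> peano 0 f (f 0) (f' 0) (f'' 0 / 2).
Proof.
move=> df df' cf''.
pose D s := f s - f 0 - f' 0 * s - f'' 0 / 2 * s ^+ 2.
pose D' s := f' s - f' 0 - f'' 0 * s.
have D'o : D' s / s ^+ 1 @[s --> (0 : R)] --> (0 : R).
  apply: (@derive_little_o 0 _ (fun s => f'' s - f'' 0)).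
  - by rewrite /D' mulr0 !subrr.
  - by rewrite -[X in _ --> X](subrr (f'' 0)); cvg_tac.
  - near=> s; have df's : is_derive (s : R) (1 : R) f' (f'' s) by near: s.
    by rewrite /D'; apply: der_eq; [der|rewrite /=; ring].
have Do : D s / s ^+ 2 @[s --> (0 : R)] --> (0 : R).
  apply: (@derive_little_o 1 _ (fun s => D' s / s ^+ 1)) => //.
  - by rewrite /D mulr0 expr0n/= mulr0 !subrr.
  - near=> s; have dfs : is_derive (s : R) (1 : R) f (f' s) by near: s.
    rewrite /D; apply: der_eq; first by der.
    have [->|s0] := eqVneq s 0; first by rewrite expr1 !mul0r; ring.
    by rewrite /D'; field.
exists (fun s => D s / s ^+ 2); split => //.
near=> s; have [->|s0] := eqVneq s 0; first by rewrite expr0n/=; ring.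
by rewrite /D; field.
Unshelve. all: by end_near. Qed.

Lemma near0_lt d : 0 < d -> \forall s \near (0 : R), `|s| < d.
Proof. by move=> d0; apply/nbhs_ballP; exists d => //= s; rewrite /ball/= sub0r normrN. Qed.

Lemma near0_gtN1 : \forall s \near (0 : R), 0 < 1 + s.
Proof.
apply: filterS (near0_lt ltr01) => s; rewrite ltr_norml => /andP[? _]; lra.
Qed.

Lemma peano_inv1D : peano 0 (fun s => (1 + s)^-1) 1 (-1) 1.
Proof.
exists (fun s => - s / (1 + s)); split.
  rewrite [X in _ --> X](_ : 0 = - 0 / (1 + 0)); last by rewrite oppr0 mul0r.
  have i := cvg_id0.
  apply: cvgM; first exact: cvgN.
  by apply: cvgV; [rewrite addr0 oner_neq0|apply: cvgD => //; exact: cvg_cst].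
near=> s.
have s1 : 0 < 1 + s by near: s; exact: near0_gtN1.
by field; rewrite gt_eqF.
Unshelve. all: by end_near. Qed.

Lemma peano_ln1D : peano 1 (fun s => ln (1 + s)) 1 (- (1 / 2)) (1 / 3).
Proof.
apply: (peano_coef _ _ _ (peano_derive _ _ peano_inv1D)); [by field..|by rewrite addr0 ln1|].
near=> s.
have s1 : 0 < 1 + s by near: s; exact: near0_gtN1.
by apply: der_eq; [der|rewrite add0r mulr1].
Unshelve. all: by end_near. Qed.

(** This is the exponent of the rescaled Euler integral at its critical point; its derivative is
    [s / (1 + s)]. *)
Lemma peano_subr_ln1D : peano 2 (fun s => s - ln (1 + s)) (1 / 2) (- (1 / 3)) (1 / 4).
Proof.
have p : peano 1 (fun s => s * (1 + s)^-1) 1 (- 1) 1.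
  have pid : peano 1 (fun s => s) 1 0 0.
    exists (fun=> 0); split; first exact: cvg_cst.
    by near=> s; ring.
  by apply: (peano_coef _ _ _ (peano_mul pid peano_inv1D)); ring.
apply: (peano_coef _ _ _ (peano_derive _ _ p)); [by field..|by rewrite addr0 ln1 subr0|].
near=> s.
have s1 : 0 < 1 + s by near: s; exact: near0_gtN1.
by apply: der_eq; [der|rewrite /=; field; rewrite gt_eqF].
Unshelve. all: by end_near. Qed.

Lemma peano_expR : peano 0 (@expR R) 1 1 (1 / 2).
Proof.
rewrite -{1 2 3}(@expR0 R); apply: (@peano_C2 _ expR expR).
- by near=> s; exact: is_derive_expR.
- by near=> s; exact: is_derive_expR.
- exact: continuous_expR.
Unshelve. all: by end_near. Qed.

Lemma peano_expRB1 : peano 1 (fun s => expR s - 1) 1 (1 / 2) (1 / 6).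
Proof.
apply: (peano_coef _ _ _ (peano_derive _ _ peano_expR)); [by field..|by rewrite expR0 subrr|].
by near=> s; apply: der_eq; [der|ring].
Unshelve. all: by end_near. Qed.

Lemma peano_sqrt1D : peano 0 (fun s => Num.sqrt (1 + s)) 1 (1 / 2) (- (1 / 8)).
Proof.
apply: (@peano_near 0 (fun s => expR (1 / 2 * ln (1 + s)))); last first.
  by apply: (peano_coef _ _ _ (peano_comp peano_expR (peano_scale (1 / 2) peano_ln1D))); field.
near=> s.
have s1 : 0 < 1 + s by near: s; exact: near0_gtN1.
by rewrite -powR12_sqrt ?ltW// /powR gt_eqF// div1r.
Unshelve. all: by end_near. Qed.

End peano.

(** * Laplace's method *)

Section real_integrals.
Context {R : realType}.
Notation mu := (@lebesgue_measure R).
Implicit Types (f g F : R -> R).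

(** Domination is asked from some rank [N] on; the sequence is shifted by [N] before passing to the
    limit. *)
Lemma Rdominated_convergence d (T : measurableType d) (m : {measure set T -> \bar R})
    (h_ : nat -> T -> R) (h k : T -> R) :
  (\forall n \near \oo, measurable_fun setT (h_ n) /\ forall x, `|h_ n x| <= k x) ->
  measurable_fun setT h -> (forall x, h_ n x @[n --> \oo] --> h x) ->
  m.-integrable setT (EFin \o k) ->
  [/\ \forall n \near \oo, m.-integrable setT (EFin \o h_ n),
    m.-integrable setT (EFin \o h) &
    \int[m]_x h_ n x @[n --> \oo] --> \int[m]_x h x].
Proof.
move=> hb mh hh ik.
have [N _ Nb] := hb.
have ih n : (N <= n)%N -> m.-integrable setT (EFin \o h_ n).
  move=> Nn; have [mn bn] := Nb _ Nn.
  apply: le_integrable ik => //=; first exact/measurable_EFinP.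
  by move=> x _; rewrite lee_fin (le_trans (bn x))// ler_norm.
have [| |||| ihh _ cvh] := @dominated_convergence _ T R m setT measurableT
  (fun n x => (h_ (n + N)%N x)%:E) (EFin \o h) (EFin \o k).
- by move=> n; apply/measurable_EFinP; exact: (Nb _ (leq_addl _ _)).1.
- exact/measurable_EFinP.
- apply: aeW => x _; apply/fine_cvgP; split; first by near=> n.
  by have := hh x; rewrite -(cvg_shiftn N).
- exact: ik.
- by apply: aeW => x n _ /=; rewrite lee_fin; exact: (Nb _ (leq_addl _ _)).2.
split => //; first by exists N.
rewrite -(cvg_shiftn N) /=.
by apply: fine_cvg; rewrite fineK//; exact: integrable_fin_num.
Unshelve. all: by end_near. Qed.
End real_integrals.

(** * Gaussian integrals and moments *)

Section gaussian.
Context {R : realType}.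
Notation mu := (@lebesgue_measure R).
Implicit Types (f g F : R -> R).

(** Fundamental theorem of calculus on [[-n, n]]: the boundary values go to 0 and dominated
    convergence removes the truncation. This is the integration by parts behind the recurrence of
    the Gaussian moments. *)
Lemma integral_derivative_eq0 F f : (forall x, is_derive (x : R) (1 : R) F (f x)) ->
  continuous f -> mu.-integrable setT (EFin \o f) ->
  F n%:R @[n --> \oo] --> (0 : R) -> F (- n%:R) @[n --> \oo] --> (0 : R) ->
  \int[mu]_x f x = 0.
Proof.
move=> dF cf intf Fy FNy.
pose f_ n x := if `|x| <= n%:R then f x else 0.
have f_E n : f_ n = f \_ `[(- n%:R), n%:R].
  apply/funext => x; rewrite /f_ patchE; case: ifPn.
    by rewrite ler_norml => h; rewrite mem_set//= in_itv.
  by rewrite ler_norml => /negP h; rewrite memNset//= in_itv.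
have mf : measurable_fun setT f by exact: continuous_measurable_fun.
have [] := @Rdominated_convergence R _ _ mu f_ f (fun x => `|f x|).
- near=> n; split => [|x].
    rewrite f_E; apply/(measurable_restrictT _ _).1 => //.
    exact: measurable_funTS.
  by rewrite /f_; case: ifPn => //; rewrite normr0.
- exact: mf.
- move=> x; apply: cvg_near_cst; near=> n; rewrite /f_ ifT//.
  near: n; exact: nbhs_infty_ger.
- exact: integrable_norm.
move=> _ _ cv.
have cv0 : \int[mu]_x f_ n x @[n --> \oo] --> 0.
  have : F n%:R - F (- n%:R) @[n --> \oo] --> 0 - 0 by cvg_tac.
  rewrite subr0; apply: cvg_trans; apply: near_eq_cvg; near=> n.
  rewrite f_E -Rintegral_mkcond /Rintegral.
  have n0 : (- n%:R < n%:R :> R).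
    have : (0 < n)%N by near: n; exact: nbhs_infty_gt.
    by rewrite -(ltr_nat R) => ?; rewrite gtrN.
  have cF x : {for x, continuous F}.
    by apply/differentiable_continuous/derivable1_diffP; apply: @ex_derive; exact: dF.
  rewrite (@continuous_FTC2 _ f F)//=.
  - exact: continuous_subspaceT.
  - split; first by move=> x _; apply: @ex_derive; exact: dF.
    + exact/cvg_at_right_filter/cF.
    + exact/cvg_at_left_filter/cF.
  - by move=> x _; rewrite derive1E; apply: derive_val.
exact: (cvg_unique _ cv cv0).
Unshelve. all: by end_near. Qed.

(** Half of a Gaussian exponent absorbs any polynomial: use [1 + |t| <= expR |t|], then complete the
    square. *)
Lemma expR_quadratic_ge (M : nat) (c t : R) : 0 < c ->
  (1 + `|t|) ^+ M <= expR (M%:R ^+ 2 / (2 * c)) * expR (c * t ^+ 2 / 2).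
Proof.
move=> c0.
have h : (1 + `|t|) ^+ M <= expR (M%:R * `|t|).
  rewrite mulrC expRM_natr lerXn2r ?nnegrE ?expR_ge0 ?addr_ge0//.
  exact: expR_ge1Dx.
apply: (le_trans h); rewrite -expRD ler_expR -subr_ge0.
rewrite -(real_normK (num_real t)).
have -> : M%:R ^+ 2 / (2 * c) + c * `|t| ^+ 2 / 2 - M%:R * `|t| = (M%:R - c * `|t|) ^+ 2 / (2 * c).
  by field; rewrite gt_eqF.
by rewrite divr_ge0 ?sqr_ge0// mulr_ge0// ltW.
Qed.

Definition gauss (c t : R) := expR (- (c * t ^+ 2)).

Lemma continuous_gauss c : continuous (gauss c).
Proof.
move=> t; apply: continuous_comp; last exact: continuous_expR.
by apply: continuousN; apply: continuousM; [exact: cvg_cst|exact: exprn_continuous].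
Qed.

Lemma measurable_gauss c : measurable_fun setT (gauss c).
Proof. by apply: continuous_measurable_fun; exact: continuous_gauss. Qed.

Lemma integral_gauss c : 0 < c ->
  mu.-integrable setT (EFin \o gauss c) /\ \int[mu]_t gauss c t = Num.sqrt (pi / c).
Proof.
(* [gauss c] is a multiple of the centred normal density of variance [(2 * c)^-1]. *)
move=> c0; pose s := (Num.sqrt (2 * c))^-1.
have c2 : 0 < 2 * c by rewrite mulr_gt0.
have s0 : s != 0 by rewrite invr_neq0// gt_eqF// sqrtr_gt0.
have s2 : s ^+ 2 = (2 * c)^-1 by rewrite exprVn sqr_sqrtr// ltW.
have pc : 0 < pi / c by rewrite divr_gt0// pi_gt0.
have gE : gauss c = (fun t => Num.sqrt (pi / c) * normal_pdf 0 s t).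
  apply/funext => t; rewrite normal_pdfE// /normal_fun subr0 s2 /normal_peak s2.
  have -> : ((2 * c)^-1 * pi *+ 2) = pi / c.
    by rewrite -mulr_natr; field; rewrite gt_eqF.
  rewrite mulrA divff ?mul1r ?gt_eqF ?sqrtr_gt0// /gauss; congr expR.
  by rewrite -mulr_natr; field; rewrite gt_eqF.
have iN := @integrable_normal_pdf R 0 s.
rewrite gE; split.
  have -> : EFin \o (fun t => Num.sqrt (pi / c) * normal_pdf 0 s t) =
     (fun t => (Num.sqrt (pi / c))%:E * (normal_pdf 0 s t)%:E)%E.
    by apply/funext => t /=; rewrite EFinM.
  exact: integrableZl.
by rewrite RintegralZl// /Rintegral integral_normal_pdf//= mulr1.
Qed.

Lemma gauss_pow_integrable M c : 0 < c ->
  mu.-integrable setT (EFin \o (fun t => (1 + `|t|) ^+ M * gauss c t)).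
Proof.
move=> c0; have c20 : 0 < c / 2 by rewrite divr_gt0.
have [ig _] := integral_gauss c20.
have mm : measurable_fun setT (fun t : R => (1 + `|t|) ^+ M * gauss c t).
  apply: measurable_funM; last exact: measurable_gauss.
  by apply: measurable_funX; exact: measurable_funD.
have := @integrableZl _ _ _ mu _ measurableT (expR (M%:R ^+ 2 / (2 * c))) _ ig.
apply: le_integrable => //=; first exact/measurable_EFinP.
move=> t _; rewrite lee_fin ger0_norm; last first.
  by rewrite mulr_ge0 ?expR_ge0// exprn_ge0// addr_ge0.
apply: le_trans (ler_norm _).
have -> : gauss (c / 2) t = expR (c * t ^+ 2 / 2) * gauss c t.
  by rewrite /gauss -expRD; congr expR; field.
by rewrite mulrA ler_wpM2r ?expR_ge0// expR_quadratic_ge.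
Qed.

Lemma integrable_gauss_bound (f : R -> R) C M c : 0 < c -> measurable_fun setT f ->
  (forall t, `|f t| <= C * (1 + `|t|) ^+ M) ->
  mu.-integrable setT (EFin \o (fun t => f t * gauss c t)).
Proof.
move=> c0 mf fb.
have := @integrableZl _ _ _ mu _ measurableT C _ (gauss_pow_integrable M c0).
apply: le_integrable => //=.
  by apply/measurable_EFinP/measurable_funM => //; exact: measurable_gauss.
move=> t _; rewrite lee_fin normrM [in X in _ * X]ger0_norm ?expR_ge0//.
apply: le_trans (ler_norm _); rewrite [leRHS]mulrA ler_wpM2r ?expR_ge0//.
Qed.

End gaussian.

Section gaussian_moments.
Context {R : realType}.
Notation mu := (@lebesgue_measure R).
Implicit Types (c t : R).

Lemma gauss_pow_le M c t : 0 < c ->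
  (1 + `|t|) ^+ M * gauss c t <= expR (M%:R ^+ 2 / (2 * c)).
Proof.
move=> c0; apply: (@le_trans _ _ (expR (M%:R ^+ 2 / (2 * c)) * expR (c * t ^+ 2 / 2) * gauss c t)).
  by rewrite ler_wpM2r ?expR_ge0// expR_quadratic_ge.
rewrite -mulrA -expRD ler_piMr ?expR_ge0// expR_le1.
have : 0 <= c * t ^+ 2 by rewrite mulr_ge0 ?sqr_ge0// ltW.
lra.
Qed.

(** One more power in [gauss_pow_le] leaves a factor [1 / (n + 1)]. The form [|u n| = n] serves both
    ends [n] and [- n] of the integrals. *)
Lemma cvg_pow_gauss M c (u : nat -> R) : 0 < c -> (forall n, `|u n| = n%:R) ->
  u n ^+ M * gauss c (u n) @[n --> \oo] --> (0 : R).
Proof.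
move=> c0 un; pose K := expR (M.+1%:R ^+ 2 / (2 * c)).
have h : K * harmonic n @[n --> \oo] --> (0 : R).
  by rewrite -[X in _ --> X](mulr0 K); apply: cvg_mul; [exact: cvg_cst|exact: cvg_harmonic].
apply/norm_cvg0P; apply: (squeeze_cvgr _ (cvg_cst _) h).
near=> n; rewrite normr_ge0/= /harmonic/= ler_pdivlMr ?ltr0n//.
apply: le_trans (gauss_pow_le M.+1 (u n) c0).
rewrite un normrM [in X in _ * X * _]ger0_norm ?expR_ge0//.
rewrite mulrAC normrX un ler_wpM2r ?expR_ge0// exprS mulrC.
rewrite -natr1 [n%:R + 1]addrC ler_wpM2l ?addr_ge0// lerXn2r ?nnegrE ?addr_ge0// lerDr//.
Unshelve. all: by end_near. Qed.

Definition gmom k c : R := \int[mu]_t (t ^+ k * gauss c t).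

Lemma gmom_integrable k c : 0 < c -> mu.-integrable setT (EFin \o (fun t => t ^+ k * gauss c t)).
Proof.
move=> c0; apply: (@integrable_gauss_bound _ (fun t => t ^+ k) 1 k) => //.
by move=> t; rewrite mul1r normrX lerXn2r ?nnegrE ?addr_ge0// lerDr.
Qed.

Lemma gmom0 c : 0 < c -> gmom 0 c = Num.sqrt (pi / c).
Proof.
move=> /integral_gauss[_ <-]; rewrite /gmom; congr Rintegral.
by apply/funext => t; rewrite expr0 mul1r.
Qed.

Lemma gmom1 c : 0 < c -> gmom 1 c = 0.
Proof.
move=> c0.
have c2 : - (2 * c) != 0 by rewrite oppr_eq0 gt_eqF// mulr_gt0.
apply/eqP; rewrite -(mulrI_eq0 _ (lregP c2)) /gmom -RintegralZl//; last exact: gmom_integrable.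
apply/eqP; apply: (@integral_derivative_eq0 _ (gauss c)).
- by move=> x; rewrite /gauss; apply: der_eq; [der|rewrite /=; ring].
- move=> x; apply: cvg_mul; first exact: cvg_cst.
  by apply: cvg_mul; [exact: exprn_continuous|exact: continuous_gauss].
- exact: (integrableZl measurableT _ (gmom_integrable 1 c0)).
- apply: cvg_trans (@cvg_pow_gauss 0 c (fun n => n%:R) c0 _); last by move=> n; rewrite normr_nat.
  by apply: near_eq_cvg; near=> n; rewrite expr0 mul1r.
- apply: cvg_trans (@cvg_pow_gauss 0 c (fun n => - n%:R) c0 _); last by move=> n; rewrite normrN normr_nat.
  by apply: near_eq_cvg; near=> n; rewrite expr0 mul1r.
Unshelve. all: by end_near. Qed.

(** Integration by parts: the derivative of [t ^+ k.+1 * gauss c t] integrates to 0. *)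
Lemma gmomSS k c : 0 < c -> gmom k.+2 c = k.+1%:R / (2 * c) * gmom k c.
Proof.
move=> c0.
have c2 : 2 * c != 0 by rewrite gt_eqF// mulr_gt0.
have i0 := integrableZl measurableT k.+1%:R (gmom_integrable k c0).
have i2 := integrableZl measurableT (2 * c) (gmom_integrable k.+2 c0).
have : \int[mu]_t (k.+1%:R * (t ^+ k * gauss c t) - 2 * c * (t ^+ k.+2 * gauss c t)) = 0.
  apply: (@integral_derivative_eq0 _ (fun t => t ^+ k.+1 * gauss c t)).
  - by move=> x; rewrite /gauss; apply: der_eq; [der|rewrite /= !exprS; ring].
  - move=> x; apply: cvg_add.
      apply: cvg_mul; first exact: cvg_cst.
      by apply: cvg_mul; [exact: exprn_continuous|exact: continuous_gauss].
    apply: cvg_opp; apply: cvg_mul; first exact: cvg_cst.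
    by apply: cvg_mul; [exact: exprn_continuous|exact: continuous_gauss].
  - exact: (integrableB measurableT i0 i2).
  - by apply: cvg_pow_gauss => // n; rewrite normr_nat.
  - by apply: cvg_pow_gauss => // n; rewrite normrN normr_nat.
rewrite RintegralB// !RintegralZl ?gmom_integrable//.
rewrite -/(gmom k c) -/(gmom k.+2 c) => /eqP; rewrite subr_eq0 => /eqP h.
by apply: (mulfI c2); rewrite -h; field; rewrite gt_eqF.
Qed.

End gaussian_moments.

Section laplace.
Context {R : realType}.
Notation mu := (@lebesgue_measure R).
Implicit Types (E G : R -> R -> R) (x c e t : R).

(** The factor is [1 + expR x] and not [expR |x|] so that, with [x = e * S], multiplication by
    [gauss c0] gives [gauss c0 + expR (- E)], both dominated by a Gaussian even where [e * S] is
    large. *)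
Lemma expR_sub1D_le x : `|expR x - 1 - x| <= x ^+ 2 * (1 + expR x).
Proof.
have h1 : 1 + x <= expR x by exact: expR_ge1Dx.
have h2 : expR x - 1 <= x * expR x.
  have := expR_ge1Dx (- x); rewrite expRN => h.
  have e0 := expR_gt0 x.
  have : (1 - x) * expR x <= 1 by rewrite -ler_pdivlMr// div1r.
  rewrite mulrBl; lra.
rewrite ger0_norm; last by lra.
have e0 := expR_gt0 x.
have [x0|x0] := leP 0 x.
  have : x * (expR x - 1) <= x * (x * expR x) by rewrite ler_wpM2l.
  by move=> h3; have x2 := sqr_ge0 x; nra.
have : (- x) * (1 - expR x) <= (- x) * (- x) by rewrite ler_wpM2l; lra.
have h4 : 0 <= x ^+ 2 * expR x by rewrite mulr_ge0 ?sqr_ge0// ltW.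
by move=> h3; nra.
Qed.

Lemma cvg_at_right0 (u : nat -> R) : (forall n, 0 < u n) ->
  u n @[n --> \oo] --> (0 : R) -> u n @[n --> \oo] --> (0 : R)^'+.
Proof.
move=> u0 cu A hA.
have h : \forall x \near (0 : R), 0 < x -> A x := hA.
have : \forall n \near \oo, 0 < u n -> A (u n) := cu _ h.
by apply: filterS => n; apply; exact: u0.
Qed.

(* Laplace's method with two terms, after the rescaling which makes the main
   part of the exponent independent of [e]. *)
Lemma laplace E G (e1 e2 g0 g1 g2 : R -> R) (c0 c C : R) :
  0 < c0 -> 0 < c -> jet E (fun t => c0 * t ^+ 2) e1 e2 -> jet G g0 g1 g2 ->
  (\forall p \near jdom, c * p.2 ^+ 2 - C <= E p.1 p.2) ->
  measurable_fun setT e1 -> measurable_fun setT e2 -> measurable_fun setT g0 ->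
  measurable_fun setT g1 -> measurable_fun setT g2 ->
  exists2 d0, 0 < d0 & forall d, 0 < d <= d0 -> forall eps : nat -> R,
   (forall n, 0 < eps n) -> eps n @[n --> \oo] --> (0 : R) ->
   let F n t := if `|eps n * t| < d then expR (- E (eps n) t) * G (eps n) t else 0 in
   (\forall n \near \oo, measurable_fun setT (F n)) ->
   (\forall n \near \oo, mu.-integrable setT (EFin \o F n)) /\
   (\int[mu]_t F n t - \int[mu]_t (g0 t * gauss c0 t)
     - eps n * \int[mu]_t ((g1 t - e1 t * g0 t) * gauss c0 t)) / eps n ^+ 2
    @[n --> \oo] -->
    \int[mu]_t ((g2 t - e1 t * g1 t + (e1 t ^+ 2 / 2 - e2 t) * g0 t) * gauss c0 t).
Proof.
move=> c00 c_0 jE jG Elow me1 me2 mg0 mg1 mg2.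
have [_ be1 be2 [rE [brE rE0 EE]]] := jE.
have [bg0 bg1 bg2 _] := jG.
(* [E = c0 * t ^+ 2 + D] and [e * S = - D], so [expR (- E) = gauss c0 * expR (e * S)]. The linear
   part [1 + e * S = 1 - D] is multiplied by [G] as a jet; the quadratic part contributes
   [e1 ^+ 2 / 2 * g0], the difference between [p2] and [q2]. *)
pose D e t := e * (e1 t + e * (e2 t + rE e t)).
pose S e t := - (e1 t + e * (e2 t + rE e t)).
pose p1 t := g1 t - e1 t * g0 t.
pose q2 t := g2 t - e1 t * g1 t - e2 t * g0 t.
pose p2 t := g2 t - e1 t * g1 t + (e1 t ^+ 2 / 2 - e2 t) * g0 t.
have jD : jet (fun e t => 1 - D e t) (fun=> 1) (fun t => - e1 t) (fun t => - e2 t).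
  split; [exact: pbd_cst| | |].
  - by apply: pbd_le be1; near=> p; rewrite normrN.
  - by apply: pbd_le be2; near=> p; rewrite normrN.
  - exists (fun e t => - rE e t); split.
    + by apply: pbd_le brE; near=> p; rewrite normrN.
    + by move=> t; rewrite -[X in _ --> X]oppr0; apply: cvg_opp; exact: rE0.
    + by near=> p; rewrite /D; ring.
have jQ : jet (fun e t => (1 - D e t) * G e t) g0 p1 q2.
  by apply: (jet_coef _ _ _ (jet_mul jD jG)) => t; rewrite /p1 /q2; ring.
have [_ bp1 bq2 [rQ [brQ rQ0 QE]]] := jQ.
have bS : pbd S.
  apply: (pbd_le (F := fun e t => e1 t + e * (e2 t + rE e t))).
    by near=> p; rewrite normrN.
  by have be := @pbd_eps R; pbd_tac.
have bG := jet_pbd jG.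
have [KS [mS [KS0 hS]]] : pbd (fun e t => S e t * S e t * G e t) by pbd_tac.
have [KQ [mQ [KQ0 hQ]]] : pbd (fun e t => q2 t + rQ e t) by pbd_tac.
(* Outside the cutoff [1 <= e ^+ 2 * t ^+ 2 / d ^+ 2]; the extra [t * t] prepares the factor
   [e ^+ 2] gained there. *)
have [Kg [mg [Kg0 hg]]] : pbd (fun _ t => (`|g0 t| + `|p1 t|) * (t * t)).
  have b0 : pbd (fun _ t => `|g0 t|) by apply: pbd_le bg0; near=> p; rewrite normr_id.
  have b1 : pbd (fun _ t => `|p1 t|) by apply: pbd_le bp1; near=> p; rewrite normr_id.
  exact: pbd_mul (pbd_add b0 b1) (pbd_mul (@pbd_id R) (@pbd_id R)).
have hgt t : (`|g0 t| + `|p1 t|) * t ^+ 2 <= Kg * (1 + `|t|) ^+ mg.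
  have he := jdom_at_right hg t.
  have [e he2] := @filter_ex _ _ (at_right_proper_filter (0 : R)) _ he; move: he2 => /=.
  by apply: le_trans; rewrite -expr2 ler_norm.
have : \forall p \near jdom, [/\ c * p.2 ^+ 2 - C <= E p.1 p.2,
   E p.1 p.2 = c0 * p.2 ^+ 2 + D p.1 p.2,
   (1 - D p.1 p.2) * G p.1 p.2 = g0 p.2 + p.1 * p1 p.2 + p.1 ^+ 2 * (q2 p.2 + rQ p.1 p.2),
   `|S p.1 p.2 * S p.1 p.2 * G p.1 p.2| <= KS * (1 + `|p.2|) ^+ mS &
   `|q2 p.2 + rQ p.1 p.2| <= KQ * (1 + `|p.2|) ^+ mQ].
  near=> p.
  have E1 : c * p.2 ^+ 2 - C <= E p.1 p.2 by near: p.
  have E2 : E p.1 p.2 = c0 * p.2 ^+ 2 + p.1 * e1 p.2 + p.1 ^+ 2 * e2 p.2 + p.1 ^+ 2 * rE p.1 p.2 by near: p.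
  have E3 : (1 - D p.1 p.2) * G p.1 p.2 = g0 p.2 + p.1 * p1 p.2 + p.1 ^+ 2 * q2 p.2 + p.1 ^+ 2 * rQ p.1 p.2 by near: p.
  have E4 : `|S p.1 p.2 * S p.1 p.2 * G p.1 p.2| <= KS * (1 + `|p.2|) ^+ mS by near: p.
  have E5 : `|q2 p.2 + rQ p.1 p.2| <= KQ * (1 + `|p.2|) ^+ mQ by near: p.
  by split=> //; [rewrite E2 /D|rewrite E3]; ring.
move=> [d0 d00 hd0]; exists d0; first exact: d00.
move=> d /andP[d_gt0 dd0] eps eps0 ceps F mF.
have {}hd0 e t : 0 < e -> e < d -> `|e * t| < d -> [/\ c * t ^+ 2 - C <= E e t,
   E e t = c0 * t ^+ 2 + D e t,
   (1 - D e t) * G e t = g0 t + e * p1 t + e ^+ 2 * (q2 t + rQ e t),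
   `|S e t * S e t * G e t| <= KS * (1 + `|t|) ^+ mS &
   `|q2 t + rQ e t| <= KQ * (1 + `|t|) ^+ mQ].
  move=> e0 ed etd; apply: (hd0 (e, t)); split => /=.
    by rewrite e0 (lt_le_trans ed).
  exact: lt_le_trans dd0.
have ceps0 := cvg_at_right0 eps0 ceps.
(* A single Gaussian dominates both [gauss c0] and [expR (- E)], the latter being at most
   [expR C * gauss c] inside the cutoff. *)
pose c' := Num.min c c0.
have c'0 : 0 < c' by rewrite lt_min c_0.
have gc t : gauss c t <= gauss c' t.
  by rewrite ler_expR lerN2 ler_wpM2r ?sqr_ge0// ge_min lexx.
have gc0 t : gauss c0 t <= gauss c' t.
  by rewrite ler_expR lerN2 ler_wpM2r ?sqr_ge0// ge_min lexx orbT.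
pose M := (mS + mQ + mg)%N.
have pM t m : (m <= M)%N -> (1 + `|t|) ^+ m <= (1 + `|t|) ^+ M.
  by move=> mM; rewrite ler_weXn2l// lerDl.
(* [KQ] bounds the linearised part, [KS] the quadratic error of the exponential, [Kg / d ^+ 2] the
   part outside the cutoff. The theorem is then dominated convergence for [phi]. *)
pose K := KQ + KS * (1 + expR C) + Kg / d ^+ 2.
pose phi n t := (F n t - (g0 t + eps n * p1 t) * gauss c0 t) / eps n ^+ 2.
have epsd : \forall n \near \oo, eps n < d /\ eps n < 1.
  have cl r : 0 < r -> \forall n \near \oo, eps n < r.
    move=> r0; move/cvgrPdist_lt : ceps => /(_ r r0).
    by apply: filterS => n; rewrite sub0r normrN gtr0_norm.
  by near=> n; split; near: n; exact: cl.
have expE e t : 0 < e -> E e t = c0 * t ^+ 2 + D e t ->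
  expR (- E e t) = gauss c0 t * expR (e * S e t).
  by move=> e0 ->; rewrite opprD expRD /S /D mulrN.
have phibound n t : eps n < d /\ eps n < 1 -> `|phi n t| <= K * ((1 + `|t|) ^+ M * gauss c' t).
  move=> [end_ en1]; have en0 := eps0 n; set e := eps n in end_ en0 en1 *.
  have e20 : 0 < e ^+ 2 by rewrite exprn_gt0.
  have gp : 0 <= (1 + `|t|) ^+ M * gauss c' t by rewrite mulr_ge0 ?expR_ge0// exprn_ge0// addr_ge0.
  have C0 := expR_gt0 C.
  have KS1 : 0 <= KS * (1 + expR C) by rewrite mulr_ge0// addr_ge0// ltW.
  have Kd : 0 <= Kg / d ^+ 2 by rewrite divr_ge0// sqr_ge0.
  rewrite normrM normfV (gtr0_norm e20) ler_pdivrMr//.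
  rewrite /F; case: ifPn => [etd|].
    have [hE ED HQ bSt bQt] := hd0 _ _ en0 end_ etd.
    have EQ : expR (- E e t) * G e t - (g0 t + e * p1 t) * gauss c0 t =
      gauss c0 t * (e ^+ 2 * (q2 t + rQ e t)) +
      gauss c0 t * (expR (e * S e t) - 1 - e * S e t) * G e t.
      rewrite expE//; have : 1 - D e t = 1 + e * S e t by rewrite /D /S; ring.
      move: HQ => /[swap] -> HQ.
      transitivity (gauss c0 t * ((1 + e * S e t) * G e t) - (g0 t + e * p1 t) * gauss c0 t +
         gauss c0 t * (expR (e * S e t) - 1 - e * S e t) * G e t); first by ring.
      by rewrite HQ; ring.
    rewrite EQ; apply: (le_trans (ler_normD _ _)).
    rewrite /K mulrDl mulrDl -!(mulrA _ _ (e ^+ 2)).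
    have A1 : `|gauss c0 t * (e ^+ 2 * (q2 t + rQ e t))| <= KQ * ((1 + `|t|) ^+ M * gauss c' t * e ^+ 2).
      rewrite (normrM (gauss c0 t)) (normrM (e ^+ 2)) (gtr0_norm e20) (gtr0_norm (expR_gt0 _)).
      rewrite [leRHS](_ : _ = gauss c' t * (e ^+ 2 * (KQ * (1 + `|t|) ^+ M))); last by ring.
      apply: ler_pM; [exact: expR_ge0|by apply: mulr_ge0 => //; exact: ltW|exact: gc0|].
      rewrite ler_pM2l// (le_trans bQt)// ler_wpM2l// pM// /M.
      by rewrite -addnA addnCA leq_addr.
    have A2 : `|gauss c0 t * (expR (e * S e t) - 1 - e * S e t) * G e t| <=
       KS * (1 + expR C) * ((1 + `|t|) ^+ M * gauss c' t * e ^+ 2).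
      rewrite (normrM _ (G e t)) (normrM (gauss c0 t)) (gtr0_norm (expR_gt0 _)).
      apply: (@le_trans _ _ (gauss c0 t * ((e * S e t) ^+ 2 * (1 + expR (e * S e t))) * `|G e t|)).
        by rewrite ler_wpM2r// ler_wpM2l ?expR_ge0// expR_sub1D_le.
      have -> : gauss c0 t * ((e * S e t) ^+ 2 * (1 + expR (e * S e t))) * `|G e t| =
        (gauss c0 t + gauss c0 t * expR (e * S e t)) * (e ^+ 2 * `|S e t * S e t * G e t|).
        rewrite (normrM _ (G e t)) (normrM (S e t)) -expr2 real_normK ?num_real//; ring.
      rewrite -(expE _ _ en0 ED).
      rewrite [leRHS](_ : _ = ((1 + expR C) * gauss c' t) * (e ^+ 2 * (KS * (1 + `|t|) ^+ M))); last by ring.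
      apply: ler_pM; [by apply: addr_ge0; exact: expR_ge0|by apply: mulr_ge0 => //; exact: ltW| |].
        rewrite mulrDl mul1r lerD//.
        apply: (le_trans _ (ler_wpM2l (ltW C0) (gc t))).
        by rewrite -expRD ler_expR; lra.
      rewrite ler_pM2l// (le_trans bSt)// ler_wpM2l// pM// /M.
      by rewrite -addnA leq_addr.
    have A3 : 0 <= Kg / d ^+ 2 * ((1 + `|t|) ^+ M * gauss c' t * e ^+ 2).
      by rewrite mulr_ge0// mulr_ge0// ltW.
    apply: (le_trans (lerD A1 A2)).
    by rewrite [leRHS](_ : _ = KQ * ((1 + `|t|) ^+ M * gauss c' t * e ^+ 2) +
       KS * (1 + expR C) * ((1 + `|t|) ^+ M * gauss c' t * e ^+ 2) +
       Kg / d ^+ 2 * ((1 + `|t|) ^+ M * gauss c' t * e ^+ 2)) ?lerDl//; ring.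
  rewrite -leNgt normrM (gtr0_norm en0) => det.
  have d2 : 1 <= e ^+ 2 * t ^+ 2 / d ^+ 2.
    rewrite ler_pdivlMr ?exprn_gt0// mul1r -(real_normK (num_real t)) -exprMn.
    by rewrite lerXn2r// ?nnegrE ?mulr_ge0// ltW.
  rewrite sub0r normrN normrM (gtr0_norm (expR_gt0 _)).
  have e1d : `|g0 t + e * p1 t| <= `|g0 t| + `|p1 t|.
    apply: (le_trans (ler_normD _ _)); rewrite normrM (gtr0_norm en0).
    by rewrite lerD2l ler_piMl// ltW.
  have Kbig : Kg / d ^+ 2 <= K by rewrite /K lerDr addr_ge0.
  apply: (@le_trans _ _ (Kg / d ^+ 2 * ((1 + `|t|) ^+ M * gauss c' t) * e ^+ 2)); last first.
    by rewrite ler_wpM2r ?(ltW e20)// ler_wpM2r.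
  rewrite [leRHS](_ : _ = (Kg * (1 + `|t|) ^+ M * e ^+ 2 / d ^+ 2) * gauss c' t); last by ring.
  apply: ler_pM; [by []|exact: expR_ge0| |exact: gc0].
  have h0 : 0 <= `|g0 t| + `|p1 t| by rewrite addr_ge0.
  apply: (le_trans e1d).
  apply: (@le_trans _ _ ((`|g0 t| + `|p1 t|) * (e ^+ 2 * t ^+ 2 / d ^+ 2))).
    by rewrite ler_peMr.
  rewrite [leLHS](_ : _ = (`|g0 t| + `|p1 t|) * t ^+ 2 * (e ^+ 2 / d ^+ 2)); last by ring.
  rewrite [leRHS](_ : _ = Kg * (1 + `|t|) ^+ M * (e ^+ 2 / d ^+ 2)); last by ring.
  rewrite ler_wpM2r//; first by rewrite divr_ge0 ?sqr_ge0.
  apply: (le_trans (hgt t)); rewrite ler_wpM2l// pM// /M leq_addl//.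
have int_g (f : R -> R) m Cf : measurable_fun setT f -> (forall t : R, `|f t| <= Cf * (1 + `|t|) ^+ m) ->
   mu.-integrable setT (EFin \o (fun t => f t * gauss c0 t)).
  by move=> mf bf; exact: (@integrable_gauss_bound _ f Cf m c0 c00 mf bf).
have pbdT (f : R -> R) : pbd (fun _ => f) -> exists Cf m, forall t : R, `|f t| <= Cf * (1 + `|t|) ^+ m.
  move=> [Cf [m [_ hf]]]; exists Cf, m => t.
  have he := jdom_at_right hf t.
  by have [e he2] := @filter_ex _ _ (at_right_proper_filter (0 : R)) _ he; exact: he2.
have mp1 : measurable_fun setT p1 by apply: measurable_funB => //; exact: measurable_funM.
have [C0' [m0' b0']] := pbdT _ bg0.
have [C1' [m1' b1']] := pbdT _ bp1.
have i0 := int_g _ _ _ mg0 b0'.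
have i1 := int_g _ _ _ mp1 b1'.
have mp2 : measurable_fun setT p2.
  apply: measurable_funD; first by apply: measurable_funB => //; exact: measurable_funM.
  apply: measurable_funM => //; apply: measurable_funB => //.
  by apply: measurable_funM => //; exact: measurable_funX.
have mgc := measurable_gauss c0.
have [||||iphi _ cphi] := @Rdominated_convergence R _ _ mu phi (fun t => p2 t * gauss c0 t)
    (fun t => K * ((1 + `|t|) ^+ M * gauss c' t)).
- near=> n; split.
    have mFn : measurable_fun setT (F n) by near: n.
    apply: measurable_funM => //; apply: measurable_funB => //.
    by apply: measurable_funM => //; apply: measurable_funD => //; exact: measurable_funM.
  by move=> t; apply: phibound; near: n.
- exact: measurable_funM.
- move=> t.
  have cD : \forall n \near \oo, eps n < d /\ `|eps n * t| < d.
    have : eps n * t @[n --> \oo] --> 0 * t by cvg_tac.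
    rewrite mul0r => /cvgrPdist_lt /(_ d d_gt0) h.
    near=> n; split; first by near: n; apply: filterS epsd => n [].
    by rewrite -normrN -[X in `|X|]sub0r; near: n.
  have [r [r0 expr]] := @peano_expR R.
  have crQ : rQ (eps n) t @[n --> \oo] --> (0 : R) by exact: (@cvg_comp _ _ _ eps (rQ^~ t) _ _ _ ceps0 (rQ0 t)).
  have crE : rE (eps n) t @[n --> \oo] --> (0 : R) by exact: (@cvg_comp _ _ _ eps (rE^~ t) _ _ _ ceps0 (rE0 t)).
  have cG : G (eps n) t @[n --> \oo] --> g0 t by exact: (@cvg_comp _ _ _ eps (G^~ t) _ _ _ ceps0 (@jet_cvg _ _ _ _ _ jG t)).
  have cS : S (eps n) t @[n --> \oo] --> - (e1 t + 0 * (e2 t + 0)) by rewrite /S; cvg_tac.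
  have ceS : eps n * S (eps n) t @[n --> \oo] --> (0 : R).
    by rewrite -[X in _ --> X](mul0r (- (e1 t + 0 * (e2 t + 0)))); cvg_tac.
  have cr : r (eps n * S (eps n) t) @[n --> \oo] --> (0 : R) by exact: (@cvg_comp _ _ _ (fun n => eps n * S (eps n) t) r _ _ _ ceS r0).
  have nexp : \forall n \near \oo, expR (eps n * S (eps n) t) = _ := ceS _ expr.
  have lim : gauss c0 t * (q2 t + rQ (eps n) t + S (eps n) t * S (eps n) t *
      (1 / 2 + r (eps n * S (eps n) t)) * G (eps n) t) @[n --> \oo] -->
     gauss c0 t * (q2 t + 0 + (- (e1 t + 0 * (e2 t + 0))) * (- (e1 t + 0 * (e2 t + 0))) * (1 / 2 + 0) * g0 t) by cvg_tac.
  rewrite [X in _ --> X](_ : _ = gauss c0 t * (q2 t + 0 + (- (e1 t + 0 * (e2 t + 0))) *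
    (- (e1 t + 0 * (e2 t + 0))) * (1 / 2 + 0) * g0 t)); last by rewrite /p2 /q2; field.
  apply: cvg_trans lim; apply: near_eq_cvg; near=> n.
  have [nd netd] : eps n < d /\ `|eps n * t| < d by near: n.
  have [hE ED HQ _ _] := hd0 _ _ (eps0 n) nd netd.
  have ex : expR (eps n * S (eps n) t) = (eps n * S (eps n) t) ^+ 0 * (1 + 1 * (eps n * S (eps n) t) +
     1 / 2 * (eps n * S (eps n) t) ^+ 2 + (eps n * S (eps n) t) ^+ 2 * r (eps n * S (eps n) t)) by near: n.
  rewrite /phi /F netd expE// ex.
  have h1 : 1 - D (eps n) t = 1 + eps n * S (eps n) t by rewrite /D /S; ring.
  move: HQ; rewrite h1 => HQ.
  set rr := r _.
  transitivity ((gauss c0 t * ((1 + eps n * S (eps n) t) * G (eps n) t) +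
    gauss c0 t * (1 / 2 * (eps n * S (eps n) t) ^+ 2 + (eps n * S (eps n) t) ^+ 2 * rr) * G (eps n) t
     - (g0 t + eps n * p1 t) * gauss c0 t) / eps n ^+ 2); last by congr (_ / _); ring.
  by rewrite HQ; field; rewrite gt_eqF.
- exact: (integrableZl measurableT _ (gauss_pow_integrable M c'0)).
have phiF n : F n = (fun t => eps n ^+ 2 * phi n t + (g0 t * gauss c0 t + eps n * (p1 t * gauss c0 t))).
  by apply/funext => t; rewrite /phi; field; rewrite gt_eqF.
have iF : \forall n \near \oo, mu.-integrable setT (EFin \o F n).
  near=> n; rewrite phiF.
  have ip : mu.-integrable setT (EFin \o phi n) by near: n.
  have a1 := integrableZl measurableT (eps n ^+ 2) ip.
  have a2 := integrableZl measurableT (eps n) i1.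
  exact: (integrableD measurableT a1 (integrableD measurableT i0 a2)).
split => //; apply: cvg_trans cphi; apply: near_eq_cvg; near=> n.
have ip : mu.-integrable setT (EFin \o phi n) by near: n.
have a1 := integrableZl measurableT (eps n ^+ 2) ip.
have a2 := integrableZl measurableT (eps n) i1.
have -> : \int[mu]_t F n t = eps n ^+ 2 * \int[mu]_t phi n t +
    (\int[mu]_t (g0 t * gauss c0 t) + eps n * \int[mu]_t (p1 t * gauss c0 t)).
  rewrite phiF RintegralD//; last exact: (integrableD measurableT i0 a2).
  by rewrite RintegralD// !RintegralZl.
by rewrite /p1; field; rewrite gt_eqF.
Unshelve. all: by end_near. Qed.
End laplace.

(** * The Gamma function *)

Section affine_substitution.
Context {R : realType}.
Notation mu := (@lebesgue_measure R).
Implicit Types (f g : R -> R).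

Definition affine (b c t : R) : measurableTypeR R := b + c * t.

Lemma measurable_affine b c : measurable_fun setT (affine b c).
Proof.
by apply: continuous_measurable_fun => t; apply: cvg_add; [exact: cvg_cst|];
  apply: cvg_mul; [exact: cvg_cst|exact: cvg_id].
Qed.

Definition affine_image (b c : R) : {measure set (measurableTypeR R) -> \bar R} :=
  measure_function_pushforward__canonical__measure_function_Measure mu (measurable_affine b c).

(** Both measures give [y - x] to an interval []x, y]] with [x < y], and this characterises Lebesgue
    measure. In this form the change of variables is integration against a pushforward. *)
Lemma lebesgue_measure_affine (b c : R) (c0 : 0 < c) (A : set R) : measurable A ->
  mscale (NngNum (ltW c0)) (affine_image b c) A = mu A.
Proof.
move=> mA; apply/esym.
apply: (@lebesgue_measure_unique R (mscale (NngNum (ltW c0)) (affine_image b c))) => //=.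
move=> _ [[x y]] _ <-; rewrite /mscale/= /pushforward/=.
have -> : affine b c @^-1` `]x, y] = `](x - b) / c, (y - b) / c]%classic.
  apply/seteqP; split => t /=; rewrite !in_itv/= ltr_pdivrMr// ler_pdivlMr// /affine;
    move=> /andP[? ?]; apply/andP; split; lra.
rewrite !lebesgue_measure_itv/= !lte_fin ltr_pM2r ?invr_gt0// ltrD2r.
case: ifPn => xy; last by rewrite mule0.
rewrite -!EFinB -EFinM; congr EFin.
by field; rewrite gt_eqF.
Qed.

Lemma ge0_integral_affine (b c : R) (g : R -> \bar R) : 0 < c ->
  measurable_fun setT g -> (forall x, 0 <= g x)%E ->
  (\int[mu]_x g x = c%:E * \int[mu]_t g (b + c * t)%R)%E.
Proof.
move=> c0 mg g0.
rewrite -[RHS](_ : \int[mscale (NngNum (ltW c0)) (affine_image b c)]_x g x = _)%E.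
  by apply: eq_measure_integral => A mA _; exact/esym/lebesgue_measure_affine.
rewrite ge0_integral_mscale//=.
by rewrite ge0_integral_pushforward//; exact: measurable_affine.
Qed.

Lemma ge0_integrable_affine (b c : R) (g : R -> R) : 0 < c ->
  (forall x, 0 <= g x) -> measurable_fun setT g ->
  mu.-integrable setT (EFin \o g) ->
  mu.-integrable setT (EFin \o (fun t => g (b + c * t))).
Proof.
move=> c0 g0 mg /integrableP[_ ig]; apply/integrableP; split.
  apply/measurable_EFinP; apply: (measurableT_comp mg); exact: measurable_affine.
move: ig; rewrite (@ge0_integral_affine b c)//=; last 1 first.
  by apply/measurable_EFinP; exact: measurableT_comp.
have c0e : (0 < c%:E)%E by rewrite lte_fin.
by rewrite -[X in (_ < X)%E -> _](gt0_muley c0e) lte_pmul2l.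
Qed.

Lemma Rintegral_affine (b c : R) (g : R -> R) : 0 < c ->
  (forall x, 0 <= g x) -> measurable_fun setT g ->
  \int[mu]_x g x = c * \int[mu]_t g (b + c * t).
Proof.
move=> c0 g0 mg; rewrite /Rintegral (@ge0_integral_affine b c)//; last exact/measurable_EFinP.
have c0e : (0 < c%:E)%E by rewrite lte_fin.
(* [fine] is 0 at both infinities, so the identity holds there too. *)
have key (I : \bar R) : fine (c%:E * I)%E = c * fine I.
  by case: I => [r| |]; rewrite ?gt0_muley ?gt0_muleNy//= ?mulr0.
exact: key.
Qed.

End affine_substitution.

(** * Convergence of Euler's integral *)

Section gamma_integral.
Context {R : realType}.
Notation mu := (@lebesgue_measure R).
Implicit Types (a r t : R).

Lemma ln_le_subr1 r : 0 < r -> ln r <= r - 1.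
Proof. by move=> r0; have := expR_ge1Dx (ln r); rewrite lnK ?posrE//; lra. Qed.

(* With [t = a r], Euler's integrand [t^(a-1) e^-t dt] becomes
   [a^a e^-a] times [gamma_integrand a r dr]. *)
Definition gamma_integrand a r : R :=
  if 0 < r then expR (- ln r - a * (r - 1 - ln r)) else 0.

Definition gamma_laplace a : R := \int[mu]_r gamma_integrand a r.

Lemma gamma_integrand_ge0 a r : 0 <= gamma_integrand a r.
Proof. by rewrite /gamma_integrand; case: ifPn => // _; exact: expR_ge0. Qed.

Lemma measurable_gamma_integrand a : measurable_fun setT (gamma_integrand a).
Proof.
by rewrite /gamma_integrand; meas.
Qed.

Lemma gamma_integrand_le a b r : a <= b -> gamma_integrand b r <= gamma_integrand a r.
Proof.
move=> ab; rewrite /gamma_integrand; case: ifPn => // r0.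
rewrite ler_expR lerD2l lerN2 ler_wpM2r//.
by have := ln_le_subr1 r0; lra.
Qed.

(** Comparison with the derivative [g] of [G r = (r / (1 + r)) ^ a], whose integral is at most 1
    because [G] takes values between 0 and 1. Near 0 both functions behave like [r ^ (a - 1)], so
    one comparison covers every [a > 0]. *)
Lemma gamma_integrable a : 0 < a -> mu.-integrable setT (EFin \o gamma_integrand a).
Proof.
move=> a0.
pose G r := expR (a * (ln r - ln (1 + r))).
pose g r := if 0 < r then expR (a * (ln r - ln (1 + r))) * (a * (r^-1 * 1 - (1 + r)^-1 * 1)) else 0.
have dG r : 0 < r -> is_derive (r : R) (1 : R) G (g r).
  move=> r0; have r10 : 0 < 1 + r by lra.
  by rewrite /G /g r0; apply: der_eq; [der|rewrite /=; field; rewrite !gt_eqF].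
have g0 r : 0 <= g r.
  rewrite /g; case: ifPn => // r0; rewrite mulr_ge0 ?expR_ge0// mulr_ge0 ?(ltW a0)// !mulr1.
  by rewrite subr_ge0 lef_pV2 ?posrE ?addr_gt0// lerDr.
have gE r : g r = if 0 < r then a * expR ((a - 1) * ln r - (a + 1) * ln (1 + r)) else 0.
  rewrite /g; case: ifPn => // r0; have r10 : 0 < 1 + r by lra.
  have -> : (a - 1) * ln r - (a + 1) * ln (1 + r) = a * (ln r - ln (1 + r)) - ln r - ln (1 + r) by ring.
  by rewrite !expRB !lnK ?posrE//; field; rewrite !gt_eqF.
have mg : measurable_fun setT g.
  by rewrite (funext gE); meas.
have cg r : 0 < r -> {for r, continuous g}.
  move=> r0; have r10 : 0 < 1 + r by lra.
  have i : s @[s --> r] --> r by exact: cvg_id.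
  have lim : expR (a * (ln s - ln (1 + s))) * (a * (s^-1 * 1 - (1 + s)^-1 * 1)) @[s --> r] -->
      expR (a * (ln r - ln (1 + r))) * (a * (r^-1 * 1 - (1 + r)^-1 * 1)).
    by cvg_tac; rewrite ?gt_eqF.
  rewrite /prop_for /continuous_at [in X in _ --> X]/g r0.
  apply: cvg_trans lim; apply: near_eq_cvg; near=> s; rewrite /g ifT//.
  by near: s; exact: lt_nbhsr.
pose g_ n r := if (n.+1%:R^-1 <= r) && (r <= n.+1%:R) then g r else 0.
have g_E n : g_ n = g \_ `[n.+1%:R^-1, n.+1%:R].
  apply/funext => x; rewrite /g_ patchE; case: ifPn => h.
    by rewrite mem_set//= in_itv.
  by rewrite memNset//= in_itv/=; exact/negP.
have mg_ n : measurable_fun setT (EFin \o g_ n).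
  apply/measurable_EFinP; rewrite g_E; apply/(measurable_restrictT _ _).1 => //.
  exact: measurable_funTS.
have ig_ n : (0 < n)%N -> (\int[mu]_r (g_ n r)%:E <= 1)%E.
  move=> n0; rewrite g_E -[X in integral _ _ X]/(EFin \o (g \_ _)) -restrict_EFin -integral_mkcond.
  have n10 : (0 : R) < n.+1%:R by rewrite ltr0n.
  have ni0 : (0 : R) < n.+1%:R^-1 by rewrite invr_gt0.
  have nn : n.+1%:R^-1 < n.+1%:R :> R.
    by rewrite (@lt_trans _ _ 1)// ?invf_lt1// ltr1n ltnS.
  have cG r : 0 < r -> {for r, continuous G}.
    by move=> r0; apply/differentiable_continuous/derivable1_diffP; apply: @ex_derive; exact: dG.
  rewrite (@continuous_FTC2 _ g G)//=.
  - rewrite -EFinB lee_fin lerBlDr (@le_trans _ _ 1)//; last by rewrite lerDl expR_ge0.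
    rewrite /G expR_le1 mulr_ge0_le0 ?(ltW a0)// subr_le0 ler_ln ?posrE ?addr_gt0//.
    by rewrite lerDr.
  - apply: continuous_in_subspaceT => r; rewrite inE/= in_itv/= => /andP[r0 _].
    exact/cg/(lt_le_trans ni0).
  - split.
    + move=> x; rewrite in_itv/= => /andP[x0 _]; apply: @ex_derive; apply: dG; exact: lt_trans x0.
    + exact/cvg_at_right_filter/cG.
    + exact/cvg_at_left_filter/cG.
  - move=> x; rewrite in_itv/= => /andP[x0 _]; rewrite derive1E; apply: derive_val.
    by apply: dG; exact: lt_trans x0.
have g_cvg x : (g_ n x)%:E @[n --> \oo] --> (g x)%:E.
  apply: cvg_near_cst; near=> n; rewrite /g_.
  have [x0|x0] := ltP 0 x; last by rewrite /g ltNge x0/=; case: ifPn.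
  rewrite ifT//; apply/andP; split; last first.
    by apply: (@le_trans _ _ n%:R); [near: n; exact: nbhs_infty_ger|rewrite ler_nat leqnSn].
  rewrite invf_ple ?posrE ?ltr0n//.
  by apply: (@le_trans _ _ n%:R); [near: n; exact: nbhs_infty_ger|rewrite ler_nat leqnSn].
have intg : mu.-integrable setT (EFin \o g).
  apply/integrableP; split; first exact/measurable_EFinP.
  under eq_integral => x _ do rewrite /= ger0_norm//.
  have g_0 n x : setT x -> (0 <= (EFin \o g_ n) x)%E.
    by move=> _; rewrite lee_fin /g_; case: ifPn.
  have nd x : setT x -> nondecreasing_seq (fun n => (EFin \o g_ n) x).
    move=> _ m n mn; rewrite /= lee_fin /g_; case: ifPn => [/andP[h1 h2]|_].
      rewrite ifT//; apply/andP; split.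
        by apply: le_trans h1; rewrite lef_pV2 ?posrE// ler_nat ltnS.
      by apply: (le_trans h2); rewrite ler_nat ltnS.
    by case: ifPn.
  have cv := @cvg_monotone_convergence _ _ _ mu setT measurableT (fun n => EFin \o g_ n) mg_ g_0 nd.
  have -> : (\int[mu]_x (g x)%:E = \int[mu]_x limn (fun n => (EFin \o g_ n) x))%E.
    by apply: eq_integral => x _; apply/esym/cvg_lim => //; exact: g_cvg.
  apply: (@le_lt_trans _ _ 1%E); last by rewrite ltry.
  by apply: (cvge_to_le cv); near=> n; apply: ig_; near: n; exact: nbhs_infty_gt.
(* The maximum over [r] of [a - a * r + (a + 1) * ln (1 + r)], found from [ln s <= s - 1] at
   [s = a / (a + 1) * (1 + r)]. *)
pose K := a + (a + 1) * ((a / (a + 1)) - 1 - ln (a / (a + 1))).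
have := @integrableZl _ _ _ mu _ measurableT (expR K / a) _ intg.
apply: le_integrable => //=; first by apply/measurable_EFinP; exact: measurable_gamma_integrand.
move=> r _; rewrite lee_fin (ger0_norm (gamma_integrand_ge0 _ _)).
apply: le_trans (ler_norm _).
rewrite /gamma_integrand gE; case: ifPn => r0; last by rewrite mulr0.
have -> : expR K / a * (a * expR ((a - 1) * ln r - (a + 1) * ln (1 + r))) =
   expR (K + ((a - 1) * ln r - (a + 1) * ln (1 + r))).
  by rewrite expRD; field; rewrite gt_eqF.
rewrite ler_expR /K.
have r10 : 0 < 1 + r by lra.
have a10 : 0 < a + 1 by lra.
have k0 : 0 < a / (a + 1) by rewrite divr_gt0.
have : (a + 1) * ln (a / (a + 1) * (1 + r)) <= (a + 1) * (a / (a + 1) * (1 + r) - 1).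
  by rewrite ler_pM2l// ln_le_subr1// mulr_gt0.
rewrite lnM ?posrE//.
have -> : (a + 1) * (a / (a + 1) * (1 + r) - 1) = a * (1 + r) - (a + 1) by field; rewrite gt_eqF.
have -> : (a + 1) * (a / (a + 1) - 1 - ln (a / (a + 1))) = - 1 - (a + 1) * ln (a / (a + 1)).
  by field; rewrite gt_eqF.
rewrite mulrDr; nra.
Unshelve. all: by end_near. Qed.

End gamma_integral.

Section gamma_asymptotics.
Context {R : realType}.
Notation mu := (@lebesgue_measure R).
Implicit Types (a r t : R).

Lemma peano_ge k (g : R -> R) (g0 g1 g2 c : R) : peano k g g0 g1 g2 -> c < g0 ->
  \forall s \near (0 : R), exists2 h, c <= h & g s = s ^+ k * h.
Proof.
move=> [r [r0 gr]] cg.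
have i : s @[s --> (0 : R)] --> (0 : R) by exact: cvg_id.
have lim : g0 + g1 * s + g2 * s ^+ 2 + s ^+ 2 * r s @[s --> (0 : R)] -->
   g0 + g1 * 0 + g2 * 0 ^+ 2 + 0 ^+ 2 * 0 by cvg_tac.
rewrite !expr0n/= !mulr0 !addr0 in lim.
near=> s; exists (g0 + g1 * s + g2 * s ^+ 2 + s ^+ 2 * r s); last by near: s.
by apply: ltW; near: s; exact: (@cvgr_gt _ _ _ _ _ _ lim _ cg).
Unshelve. all: by end_near. Qed.

Lemma ln_lt_subr1 r : 0 < r -> r != 1 -> ln r < r - 1.
Proof.
move=> r0 r1; have := @expR_gt1Dx _ (ln r); rewrite lnK ?posrE// ln_eq0// => /(_ r1); lra.
Qed.

(** The tangent inequality of the convex function [r - 1 - ln r]; it reduces to [ln z <= z - 1] at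
    [z = r / s]. *)
Lemma ln_tangent r s : 0 < r -> 0 < s -> s - 1 - ln s + (1 - s^-1) * (r - s) <= r - 1 - ln r.
Proof.
move=> r0 s0; have rs0 : 0 < r / s by rewrite divr_gt0.
have := ln_le_subr1 rs0; rewrite ln_div ?posrE//.
have -> : (1 - s^-1) * (r - s) = r - s - r / s + 1 by field; rewrite gt_eqF.
lra.
Qed.

(** By convexity the minimum outside the window is reached at [1 + d] or [1 - d]: the tangents at
    these points rise away from 1. *)
Lemma subr1_ln_ge d : 0 < d < 1 -> exists2 c, 0 < c &
  forall r, 0 < r -> d <= `|r - 1| -> c <= r - 1 - ln r.
Proof.
move=> /andP[d0 d1].
have p0 : 0 < 1 + d by lra.
have m0 : 0 < 1 - d by lra.
have hp : ln (1 + d) < 1 + d - 1 by apply: ln_lt_subr1 => //; lra.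
have hm : ln (1 - d) < 1 - d - 1 by apply: ln_lt_subr1 => //; lra.
exists (Num.min (1 + d - 1 - ln (1 + d)) (1 - d - 1 - ln (1 - d))).
  by rewrite lt_min !subr_gt0 hp hm.
move=> r r0; rewrite ge_min; case: (leP 0 (r - 1)) => r1 dr; apply/orP; [left|right].
  rewrite ger0_norm// in dr; apply: le_trans (ln_tangent r0 p0); rewrite lerDl mulr_ge0//; last by lra.
  by rewrite subr_ge0 invf_le1//; lra.
rewrite ltr0_norm// in dr; apply: le_trans (ln_tangent r0 m0); rewrite lerDl mulr_le0//; last by lra.
by rewrite subr_le0 invf_ge1//; lra.
Qed.

Lemma expRN_le_inv2 (x : R) : 0 < x -> expR (- x) <= 2 / x ^+ 2.
Proof.
move=> x0; have := @expR_ge1Dxn _ x 1 (ltW x0); rewrite expRN => h.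
have x2 : 0 < x ^+ 2 by rewrite exprn_gt0.
have ex : x ^+ 2 / 2 <= expR x by apply: le_trans h; rewrite lerDr.
rewrite -[leRHS]invrK lef_pV2 ?posrE ?expR_gt0 ?invr_gt0 ?divr_gt0//.
by rewrite invf_div.
Qed.

(** The exponent [a * (r - 1 - ln r)] of [gamma_integrand] at [a = (e ^+ 2)^-1] and
    [r = 1 + e * t]. *)
Definition gamma_E (e t : R) := (e ^+ 2)^-1 * (e * t - ln (1 + e * t)).

Lemma jet_gamma_E : jet gamma_E (fun t => 1 / 2 * t ^+ 2) (fun t => - (1 / 3) * t ^+ 3)
  (fun t => 1 / 4 * t ^+ 4).
Proof.
have sm : small (fun _ t : R => t) by exact: cvg_jdomM.
have [H [jH HE]] := jet_comp (@peano_subr_ln1D R) sm (@jet_id R).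
apply: jet_near (jet_coef _ _ _ (jet_mul (jet_mul (@jet_id R) (@jet_id R)) jH)).
- near=> p; rewrite /gamma_E.
  have -> : p.1 * p.2 - ln (1 + p.1 * p.2) = (p.1 * p.2) ^+ 2 * H p.1 p.2 by near: p.
  have p0 : 0 < p.1 by near: p; exact: jdom_gt0.
  by field; rewrite gt_eqF.
- by move=> t /=; ring.
- by move=> t /=; ring.
- by move=> t /=; ring.
Unshelve. all: by end_near. Qed.

(** Any constant below the leading coefficient 1/2 would do in place of 1/4; the [- 0] fits the
    shape required by [laplace]. *)
Lemma gamma_E_ge : \forall p \near @jdom R, 1 / 4 * p.2 ^+ 2 - 0 <= gamma_E p.1 p.2.
Proof.
have c : (1 / 4 : R) < 1 / 2 by lra.
have h : \forall p \near @jdom R, exists2 h, 1 / 4 <= h &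
   p.1 * p.2 - ln (1 + p.1 * p.2) = (p.1 * p.2) ^+ 2 * h := cvg_jdomM (peano_ge (@peano_subr_ln1D R) c).
near=> p.
have [k kc kE] : exists2 h, 1 / 4 <= h & p.1 * p.2 - ln (1 + p.1 * p.2) = (p.1 * p.2) ^+ 2 * h by near: p.
have p0 : 0 < p.1 by near: p; exact: jdom_gt0.
rewrite /gamma_E kE subr0.
have -> : (p.1 ^+ 2)^-1 * ((p.1 * p.2) ^+ 2 * k) = k * p.2 ^+ 2 by field; rewrite gt_eqF.
by rewrite ler_wpM2r ?sqr_ge0.
Unshelve. all: by end_near. Qed.

Definition gamma_G (e t : R) := (1 + e * t)^-1.

Lemma jet_gamma_G : jet gamma_G (fun=> 1) (fun t => - t) (fun t => t ^+ 2).
Proof.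
have sm : small (fun _ t : R => t) by exact: cvg_jdomM.
have [H [jH HE]] := jet_comp (@peano_inv1D R) sm (@jet_id R).
apply: jet_near (jet_coef _ _ _ jH).
- near=> p; rewrite /gamma_G.
  have -> : (1 + p.1 * p.2)^-1 = (p.1 * p.2) ^+ 0 * H p.1 p.2 by near: p.
  by rewrite expr0 mul1r.
- by [].
- by move=> t /=; ring.
- by move=> t /=; ring.
Unshelve. all: by end_near. Qed.

Lemma gmomE (c : R) : 0 < c -> [/\ gmom 1 c = 0, gmom 3 c = 0 & gmom 5 c = 0] /\
  [/\ gmom 2 c = gmom 0 c / (2 * c), gmom 4 c = 3 * gmom 0 c / (4 * c ^+ 2) &
    gmom 6 c = 15 * gmom 0 c / (8 * c ^+ 3)].
Proof.
move=> c0; have m1 := gmom1 c0.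
by split; split; rewrite // !gmomSS// ?m1; field; rewrite gt_eqF.
Qed.

(* The moments are extracted as a linear form so that Gaussian integrals of
   explicit polynomials reduce to [ring] identities. *)
Lemma integral_poly_gauss (c : R) (p : nat -> R) (q : R -> R) : 0 < c ->
  (forall t, q t = p 0%N + p 1%N * t + p 2%N * t ^+ 2 + p 3%N * t ^+ 3 +
     p 4%N * t ^+ 4 + p 5%N * t ^+ 5 + p 6%N * t ^+ 6) ->
  \int[mu]_t (q t * gauss c t) =
    gmom 0 c * (p 0%N + p 2%N / (2 * c) + p 4%N * 3 / (4 * c ^+ 2) + p 6%N * 15 / (8 * c ^+ 3)).
Proof.
move=> c0 qE.
pose m k t := p k * (t ^+ k * gauss c t).
have im k : mu.-integrable setT (EFin \o m k).
  exact: (integrableZl measurableT (p k) (gmom_integrable k c0)).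
have Im k : \int[mu]_t m k t = p k * gmom k c.
  by rewrite /m RintegralZl// gmom_integrable.
have iD f g : mu.-integrable setT (EFin \o f) -> mu.-integrable setT (EFin \o g) ->
   mu.-integrable setT (EFin \o (fun t : R => f t + g t : R)).
  by move=> i1 i2; exact: (integrableD measurableT i1 i2).
have -> : (fun t => q t * gauss c t) =
   (fun t => m 0%N t + (m 1%N t + (m 2%N t + (m 3%N t + (m 4%N t + (m 5%N t + m 6%N t)))))).
  by apply/funext => t; rewrite qE /m; ring.
have I5 := iD _ _ (im 5%N) (im 6%N); have I4 := iD _ _ (im 4%N) I5.
have I3 := iD _ _ (im 3%N) I4; have I2 := iD _ _ (im 2%N) I3; have I1 := iD _ _ (im 1%N) I2.
rewrite (RintegralD measurableT (im 0%N) I1) (RintegralD measurableT (im 1%N) I2).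
rewrite (RintegralD measurableT (im 2%N) I3) (RintegralD measurableT (im 3%N) I4).
rewrite (RintegralD measurableT (im 4%N) I5) (RintegralD measurableT (im 5%N) (im 6%N)) !Im.
have [[-> -> ->] [-> -> ->]] := gmomE c0.
by field; rewrite gt_eqF.
Qed.

End gamma_asymptotics.

Section gamma_laplace_expansion.
Context {R : realType}.
Notation mu := (@lebesgue_measure R).
Implicit Types (a r t : R).

Lemma gamma_laplace_ge0 a : 0 <= gamma_laplace a.
Proof. by apply: Rintegral_ge0 => r _; exact: gamma_integrand_ge0. Qed.

(** One copy of the exponent is kept to ensure integrability; the remaining [a - 1] copies are
    bounded through [c]. *)
Lemma gamma_laplace_tail a d c : 1 <= a ->
  (forall r, 0 < r -> d <= `|r - 1| -> c <= r - 1 - ln r) ->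
  \int[mu]_r (if `|r - 1| < d then 0 else gamma_integrand a r) <=
  expR (- ((a - 1) * c)) * gamma_laplace 1.
Proof.
move=> a1 hc; have a0 : 0 < a by lra.
have i1 := gamma_integrable (@ltr01 R).
have m1 : measurable_fun setT (fun r : R => `|r - 1| < d) by meas.
have mg := measurable_gamma_integrand a.
have bd r : (if `|r - 1| < d then 0 else gamma_integrand a r) <= expR (- ((a - 1) * c)) * gamma_integrand 1 r.
  case: ifPn => [_|]; first by rewrite mulr_ge0 ?expR_ge0 ?gamma_integrand_ge0.
  rewrite -leNgt /gamma_integrand => dr; case: ifPn => r0; last by rewrite mulr0.
  rewrite -expRD ler_expR.
  have := hc r r0 dr; rewrite -subr_ge0 => h.
  have : 0 <= (a - 1) * (r - 1 - ln r - c) by rewrite mulr_ge0// subr_ge0.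
  lra.
rewrite /gamma_laplace -RintegralZl//.
apply: le_Rintegral => //; last exact: (integrableZl measurableT _ i1).
apply: le_integrable (integrableZl measurableT (expR (- ((a - 1) * c))) i1) => //=.
  by apply/measurable_EFinP; apply: meas_if => //; exact: measurable_cst.
move=> r _; rewrite lee_fin ger0_norm; last by case: ifPn => // _; exact: gamma_integrand_ge0.
by apply: le_trans (ler_norm _); exact: bd.
Qed.

(** Stirling's formula with the correction 1/12, at [a = (eps n ^+ 2)^-1]. The substitution
    [r = 1 + eps n * t] centres the exponent at its minimum [r = 1]; [laplace] handles
    [|eps n * t| < d] and the rest is negligible. *)
Lemma gamma_laplace_seq (eps : nat -> R) : (forall n, 0 < eps n) ->
  eps n @[n --> \oo] --> (0 : R) ->
  ((eps n)^-1 * gamma_laplace (eps n ^+ 2)^-1 - Num.sqrt (2 * pi)) / eps n ^+ 2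
    @[n --> \oo] --> Num.sqrt (2 * pi) / 12.
Proof.
move=> eps0 ceps.
have c120 : 0 < 1 / 2 :> R by lra.
have c140 : 0 < 1 / 4 :> R by lra.
have [||||| d0 d00 lap] := @laplace R _ _ _ _ _ _ _ _ _ _ c120 c140 jet_gamma_E jet_gamma_G gamma_E_ge; try by meas.
(* [d < 1] keeps [r = 1 + eps n * t] positive inside the cutoff. *)
pose d := Num.min d0 (1 / 2).
have d_0 : 0 < d by rewrite lt_min d00.
have dd0 : 0 < d <= d0 by rewrite d_0 ge_min lexx.
have d1 : 0 < d < 1 by rewrite d_0 gt_min; apply/orP; right; lra.
have [c c0 hc] := subr1_ln_ge d1.
have {lap} := lap d dd0 eps eps0 ceps; set F := fun n t => _.
have mF n : measurable_fun setT (F n) by rewrite /F /gamma_E /gamma_G; meas.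
move=> /= [|iF cF]; first by near=> n; exact: mF.
have m0 : gmom 0 (1 / 2) = Num.sqrt (2 * pi) :> R by rewrite gmom0//; congr Num.sqrt; field.
have M0 : \int[mu]_t ((fun=> 1) t * gauss (1 / 2) t) = Num.sqrt (2 * pi) :> R.
  rewrite (@integral_poly_gauss _ _ (nth 0 [:: 1])) => //; last by move=> t /=; ring.
  by rewrite m0 /=; field.
have M1 : \int[mu]_t ((- t - - (1 / 3) * t ^+ 3 * (fun=> 1) t) * gauss (1 / 2) t) = 0 :> R.
  rewrite (@integral_poly_gauss _ _ (nth 0 [:: 0; -1; 0; 1 / 3])) => //; last by move=> t /=; ring.
  by rewrite m0 /=; field.
have M2 : \int[mu]_t ((t ^+ 2 - - (1 / 3) * t ^+ 3 * - t + ((- (1 / 3) * t ^+ 3) ^+ 2 / 2 -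
    1 / 4 * t ^+ 4) * (fun=> 1) t) * gauss (1 / 2) t) = Num.sqrt (2 * pi) / 12 :> R.
  rewrite (@integral_poly_gauss _ _ (nth 0 [:: 0; 0; 1; 0; - (1 / 3) - 1 / 4; 0; 1 / 18])) => //.
    by rewrite m0 /=; field.
  by move=> t /=; field.
rewrite M0 M1 M2 in cF.
pose a n := (eps n ^+ 2)^-1.
pose T n t := if `|eps n * t| < d then 0 else gamma_integrand (a n) (1 + eps n * t).
have a0 n : 0 < a n by rewrite invr_gt0 exprn_gt0.
have FT n t : gamma_integrand (a n) (1 + eps n * t) = F n t + T n t.
  rewrite /F /T; case: ifPn => h; last by rewrite add0r.
  have r0 : 0 < 1 + eps n * t.
    by move: h d1; rewrite ltr_norml => /andP[h1 h2] /andP[_ d1]; lra.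
  rewrite addr0 /gamma_integrand r0 expRD expRN lnK ?posrE// mulrC /gamma_E /gamma_G.
  by congr (expR (- (_ * _)) * _); ring.
have mgi n : measurable_fun setT (fun t => gamma_integrand (a n) (1 + eps n * t)).
  apply: (measurableT_comp (measurable_gamma_integrand (a n))); exact: (measurable_affine 1 (eps n)).
have mT n : measurable_fun setT (T n).
  have := mgi n; set gi := (fun t => _) => mgi'; by apply: meas_if => //; eta_expand; meas.
have iG n : mu.-integrable setT (EFin \o (fun t => gamma_integrand (a n) (1 + eps n * t))).
  apply: ge0_integrable_affine => //; [exact: gamma_integrand_ge0|exact: measurable_gamma_integrand|exact: gamma_integrable].
have T0 n t : 0 <= T n t by rewrite /T; case: ifPn => // _; exact: gamma_integrand_ge0.
have iT n : mu.-integrable setT (EFin \o T n).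
  apply: le_integrable (iG n) => //=; first by apply/measurable_EFinP; exact: mT.
  move=> t _; rewrite lee_fin (ger0_norm (T0 n t)); apply: le_trans (ler_norm _).
  by rewrite /T; case: ifPn => // _; exact: gamma_integrand_ge0.
have ZE : \forall n \near \oo, (eps n)^-1 * gamma_laplace (a n) = \int[mu]_t F n t + \int[mu]_t T n t.
  near=> n; have iFn : mu.-integrable setT (EFin \o F n) by near: n.
  rewrite -(RintegralD measurableT iFn (iT n)) /gamma_laplace.
  rewrite (@Rintegral_affine _ 1 (eps n) _ (eps0 n) (gamma_integrand_ge0 _) (measurable_gamma_integrand _)).
  rewrite mulKf ?gt_eqF//; congr Rintegral; apply/funext => t; exact: FT.
have e1 : \forall n \near \oo, eps n < 1.
  by move/cvgrPdist_lt : ceps => /(_ 1 ltr01); apply: filterS => n; rewrite sub0r normrN gtr0_norm.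
have cT : (\int[mu]_t T n t) / eps n ^+ 2 @[n --> \oo] --> (0 : R).
  (* By [expRN_le_inv2] at [a n * c] the tail is [O(eps ^+ 4)]; the Jacobian [eps^-1] and the
     division by [eps ^+ 2] leave one factor [eps]. *)
  pose B := gamma_laplace 1 * expR c * (2 / c ^+ 2).
  have cB : eps n * B @[n --> \oo] --> (0 * B : R) by cvg_tac.
  rewrite mul0r in cB.
  apply: (squeeze_cvgr _ (cvg_cst (0 : R)) cB); near=> n.
  have en1 : eps n < 1 by near: n.
  have en0 := eps0 n.
  have a1 : 1 <= a n by rewrite /a invf_ge1 ?exprn_gt0// expr_le1// ltW.
  rewrite divr_ge0 ?sqr_ge0 ?Rintegral_ge0//=.
  pose h r := if `|r - 1| < d then 0 else gamma_integrand (a n) r.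
  have mh : measurable_fun setT h.
    have mg := measurable_gamma_integrand (a n).
    by rewrite /h; apply: meas_if => //; eta_expand; meas.
  have h0 r : 0 <= h r by rewrite /h; case: ifPn => // _; exact: gamma_integrand_ge0.
  have ThE : T n = (fun t => h (1 + eps n * t)).
    by apply/funext => t; rewrite /T /h [1 + _]addrC addrK.
  have : \int[mu]_t T n t = (eps n)^-1 * \int[mu]_r h r.
    by rewrite (@Rintegral_affine _ 1 (eps n) h (eps0 n) h0 mh) mulKf ?gt_eqF// ThE.
  move=> ->; rewrite ler_pdivrMr ?exprn_gt0//.
  have := gamma_laplace_tail a1 hc; rewrite -/(h) => ht.
  have := @expRN_le_inv2 _ (a n * c) (mulr_gt0 (a0 n) c0) => hx.
  rewrite ler_pdivrMl//; apply: (le_trans ht).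
  have -> : - ((a n - 1) * c) = c + - (a n * c) by ring.
  rewrite expRD.
  have -> : eps n * (eps n * B * eps n ^+ 2) = expR c * (2 / (a n * c) ^+ 2) * gamma_laplace 1.
    by rewrite /B /a; field; rewrite !gt_eqF.
  by rewrite ler_wpM2r ?gamma_laplace_ge0// ler_wpM2l ?expR_ge0.
have lim : (\int[mu]_t F n t - Num.sqrt (2 * pi) - eps n * 0) / eps n ^+ 2 +
    (\int[mu]_t T n t) / eps n ^+ 2 @[n --> \oo] --> Num.sqrt (2 * pi) / 12 + 0 by exact: cvg_add.
rewrite addr0 in lim; apply: cvg_trans lim; apply: near_eq_cvg; near=> n.
have -> : (eps n)^-1 * gamma_laplace (eps n ^+ 2)^-1 = \int[mu]_t F n t + \int[mu]_t T n t by near: n.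
by field; rewrite gt_eqF.
Unshelve. all: by end_near. Qed.

End gamma_laplace_expansion.

(** * Stirling's formula to first order *)

Section stirling.
Context {R : realType}.
Notation mu := (@lebesgue_measure R).
Implicit Types (a : R) (h : R -> R) (k : R).

(** That is, [h a = 1 + k / a + o(1 / a)]. *)
Definition first_order h k := a * (h a - 1) @[a --> +oo] --> k.

Lemma cvg_inv_pinfty : a^-1 @[a --> +oo] --> (0 : R).
Proof.
apply/cvgrPdist_lt => e e0; near=> a.
have ea : e^-1 < a by near: a; by apply: nbhs_pinfty_gt; exact: num_real.
have a0 : 0 < a by apply: lt_trans ea; rewrite invr_gt0.
by rewrite sub0r normrN gtr0_norm ?invr_gt0// invf_plt ?posrE.
Unshelve. all: by end_near. Qed.

Lemma first_order_cvg h k : first_order h k -> h a @[a --> +oo] --> (1 : R).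
Proof.
move=> hk; have i := cvg_inv_pinfty.
have lim : a * (h a - 1) * a^-1 + 1 @[a --> +oo] --> k * 0 + 1 by cvg_tac.
rewrite mulr0 add0r in lim; apply: cvg_trans lim; apply: near_eq_cvg; near=> a.
have a0 : 0 < a by near: a; by apply: nbhs_pinfty_gt; exact: num_real.
by field; rewrite gt_eqF.
Unshelve. all: by end_near. Qed.

Lemma first_order_mul h1 h2 k1 k2 : first_order h1 k1 -> first_order h2 k2 ->
  first_order (fun a => h1 a * h2 a) (k1 + k2).
Proof.
move=> hk1 hk2; have c2 := first_order_cvg hk2.
have lim : a * (h1 a - 1) * h2 a + a * (h2 a - 1) @[a --> +oo] --> k1 * 1 + k2 by cvg_tac.
rewrite mulr1 in lim; apply: cvg_trans lim; apply: near_eq_cvg; near=> a; ring.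
Unshelve. all: by end_near. Qed.

Lemma first_order_inv h k : first_order h k -> first_order (fun a => (h a)^-1) (- k).
Proof.
move=> hk; have c := first_order_cvg hk.
have lim : - (a * (h a - 1)) * (h a)^-1 @[a --> +oo] --> - k * 1^-1.
  by cvg_tac; exact: oner_neq0.
rewrite invr1 mulr1 in lim; apply: cvg_trans lim; apply: near_eq_cvg; near=> a.
have h0 : 0 < h a by near: a; apply: (@cvgr_gt _ _ _ _ _ _ c _ ltr01).
by field; rewrite gt_eqF.
Unshelve. all: by end_near. Qed.

Lemma first_order_scale h k s : 0 < s -> first_order h k ->
  first_order (fun a => h (a / s)) (s * k).
Proof.
move=> s0 hk.
have cs : a / s @[a --> +oo] --> +oo.
  apply/cvgryPgt => A; near=> a.
  by rewrite ltr_pdivlMr//; near: a; by apply: nbhs_pinfty_gt; exact: num_real.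
have hs : (a / s) * (h (a / s) - 1) @[a --> +oo] --> k.
  exact: (@cvg_comp _ _ _ (fun a => a / s) (fun a => a * (h a - 1)) _ _ _ cs hk).
have lim : s * ((a / s) * (h (a / s) - 1)) @[a --> +oo] --> s * k by cvg_tac.
apply: cvg_trans lim; apply: near_eq_cvg; near=> a.
by field; rewrite gt_eqF.
Unshelve. all: by end_near. Qed.

(** For [a > 0], the quotient of [Gamma_fun a] by Stirling's approximation
    [sqrt (2 * pi / a) * a ^ a * expR (- a)]. *)
Definition stirling_ratio a := Num.sqrt a * gamma_laplace a / Num.sqrt (2 * pi).

Lemma sqrt2pi_gt0 : 0 < Num.sqrt (2 * pi) :> R.
Proof. by rewrite sqrtr_gt0 mulr_gt0// pi_gt0. Qed.

Lemma stirling_first_order : first_order stirling_ratio (1 / 12).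
Proof.
apply/cvg_pinftyP => u uy.
(* Makes every term positive without changing the tail of the sequence, so that [eps = v ^ (- 1/2)]
   is admissible in [gamma_laplace_seq]. *)
pose v n := Num.max (u n) 1.
have v1 n : 1 <= v n by rewrite le_max lexx orbT.
have v0 n : 0 < v n by exact: lt_le_trans (v1 n).
pose eps n := (Num.sqrt (v n))^-1.
have eps0 n : 0 < eps n by rewrite invr_gt0 sqrtr_gt0.
have e2 n : eps n ^+ 2 = (v n)^-1 by rewrite exprVn sqr_sqrtr// ltW.
have ceps : eps n @[n --> \oo] --> (0 : R).
  apply/cvgrPdist_lt => e e_0; near=> n.
  rewrite sub0r normrN gtr0_norm// /eps invf_plt ?posrE ?sqrtr_gt0//.
  rewrite -(ltr_pXn2r (n := 2)) ?nnegrE ?sqrtr_ge0 ?invr_ge0 ?(ltW e_0)//.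
  rewrite sqr_sqrtr; last exact: ltW.
  rewrite lt_max; apply/orP; left.
  by near: n; move/cvgryPgt : uy; exact.
have s2 := sqrt2pi_gt0.
have lim0 := gamma_laplace_seq eps0 ceps.
have lim : (Num.sqrt (2 * pi))^-1 * (((eps n)^-1 * gamma_laplace (eps n ^+ 2)^-1 - Num.sqrt (2 * pi)) / eps n ^+ 2)
    @[n --> \oo] --> (Num.sqrt (2 * pi))^-1 * (Num.sqrt (2 * pi) / 12).
  by apply: cvg_mul => //; exact: cvg_cst.
have EL : (Num.sqrt (2 * pi))^-1 * (Num.sqrt (2 * pi) / 12) = 1 / 12 :> R.
  by field; rewrite gt_eqF.
rewrite EL in lim.
apply: cvg_trans lim; apply: near_eq_cvg; near=> n.
have vu : v n = u n.
  by rewrite /v; apply/max_idPl; near: n; move/cvgryPge : uy; exact.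
by rewrite e2 /eps !invrK vu /stirling_ratio; field; rewrite gt_eqF.
Unshelve. all: by end_near. Qed.

Lemma gamma_laplace_le a b : 0 < a -> a <= b -> gamma_laplace b <= gamma_laplace a.
Proof.
move=> a0 ab; apply: le_Rintegral => //; [|exact: gamma_integrable|].
- by apply: gamma_integrable; exact: lt_le_trans ab.
- by move=> r _; exact: gamma_integrand_le.
Qed.

(** Beyond some [A] the limit 1 gives the bounds 1/2 and 2; between [a0] and [A] the monotonicity of
    the square root and of [gamma_laplace] is enough. *)
Lemma stirling_ratio_bounds a0 : 0 < a0 -> exists l L, 0 < l /\
  forall a, a0 <= a -> l <= stirling_ratio a <= L.
Proof.
move=> a0_gt0; have c1 := first_order_cvg stirling_first_order.
have s2 := sqrt2pi_gt0.
have : \forall a \near +oo, 1 / 2 < stirling_ratio a < 2 /\ a0 <= a.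
  near=> a; split; last by near: a; by apply: nbhs_pinfty_ge; exact: num_real.
  apply/andP; split; near: a.
    by apply: (@cvgr_gt _ _ _ _ _ _ c1); lra.
  by apply: (@cvgr_lt _ _ _ _ _ _ c1); lra.
move=> [A0 [_ hA]]; pose A := A0 + 1.
have hA' a : A <= a -> 1 / 2 < stirling_ratio a < 2 /\ a0 <= a.
  by move=> Aa; apply: hA; apply: lt_le_trans Aa; rewrite ltrDl.
have [/andP[zA _] a0A] := hA' _ (lexx A).
have A_0 : 0 < A by exact: lt_le_trans a0A.
have ZA : 0 < gamma_laplace A.
  rewrite lt_neqAle gamma_laplace_ge0 andbT eq_sym; apply/eqP => Z0.
  by move: zA; rewrite /stirling_ratio Z0 mulr0 mul0r; lra.
pose l := Num.sqrt a0 * gamma_laplace A / Num.sqrt (2 * pi).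
pose L := Num.sqrt A * gamma_laplace a0 / Num.sqrt (2 * pi).
have l0 : 0 < l by rewrite divr_gt0// mulr_gt0// sqrtr_gt0.
exists (Num.min l (1 / 2)), (Num.max L 2); split; first by rewrite lt_min l0; lra.
move=> a a0a; have a_0 : 0 < a by exact: lt_le_trans a0a.
rewrite ge_min le_max; have [aA|/ltW Aa] := leP a A; last first.
  by have [/andP[/ltW -> /ltW ->] _] := hA' _ Aa; rewrite !orbT.
apply/andP; split; apply/orP; left; rewrite ler_pM2r ?invr_gt0//.
  by rewrite ler_pM ?sqrtr_ge0 ?gamma_laplace_ge0 ?ler_wsqrtr ?gamma_laplace_le.
by rewrite ler_pM ?sqrtr_ge0 ?gamma_laplace_ge0 ?ler_wsqrtr ?gamma_laplace_le.
Unshelve. all: by end_near. Qed.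

Lemma gamma_laplace_gt0 a : 0 < a -> 0 < gamma_laplace a.
Proof.
move=> a0; have [l [L [l0 /(_ a (lexx a)) /andP[la _]]]] := stirling_ratio_bounds a0.
rewrite lt_neqAle gamma_laplace_ge0 andbT eq_sym; apply/eqP => Z0.
by move: (lt_le_trans l0 la); rewrite /stirling_ratio Z0 mulr0 mul0r ltxx.
Qed.

Lemma stirling_ratio_gt0 a : 0 < a -> 0 < stirling_ratio a.
Proof.
move=> a0; apply: divr_gt0; last exact: sqrt2pi_gt0.
by apply: mulr_gt0; [rewrite sqrtr_gt0|exact: gamma_laplace_gt0].
Qed.

(** Measurable because monotone. For [a <= 0] the integral diverges and [Rintegral] returns 0, which
    would break monotonicity; hence the truncation. *)
Lemma measurable_gamma_laplace a0 : 0 < a0 ->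
  measurable_fun setT (fun a => gamma_laplace (Num.max a a0)).
Proof.
move=> a00; apply: nonincreasing_measurable => // x y xy.
apply: gamma_laplace_le; first by rewrite lt_max a00 orbT.
by rewrite ge_max !le_max xy lexx orbT.
Qed.

Lemma Gamma_funE a : 0 < a -> Gamma_fun a = expR (a * ln a - a) * gamma_laplace a.
Proof.
move=> a0; pose h t := if 0 < t then expR ((a - 1) * ln t - t) else 0.
have h0 t : 0 <= h t by rewrite /h; case: ifPn => // _; exact: expR_ge0.
have mh : measurable_fun setT h by rewrite /h; meas.
have -> : Gamma_fun a = \int[mu]_t h t.
  rewrite /Gamma_fun Rintegral_mkcond; congr Rintegral; apply/funext => t.
  rewrite patchE /h; case: (ltP 0 t) => t0.
    by rewrite mem_set/= ?in_itv/= ?t0// /powR gt_eqF// -expRD.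
  by rewrite memNset//= in_itv/= andbT ltNge t0.
rewrite (@Rintegral_affine _ 0 a h a0 h0 mh).
have -> : (fun t => h (0 + a * t)) = (fun r => expR (a * ln a - a - ln a) * gamma_integrand a r).
  apply/funext => r; rewrite /h /gamma_integrand add0r pmulr_rgt0//.
  case: ifPn => r0; last by rewrite mulr0.
  by rewrite -expRD lnM ?posrE//; congr expR; ring.
rewrite RintegralZl//; last exact: gamma_integrable.
by rewrite mulrA expRB lnK ?posrE//; congr (_ * _); field; rewrite gt_eqF.
Qed.

Lemma gamma_laplaceE a : 0 < a ->
  gamma_laplace a = Num.sqrt (2 * pi) / Num.sqrt a * stirling_ratio a.
Proof.
move=> a0; have s2 := sqrt2pi_gt0; rewrite /stirling_ratio; field.
by rewrite !gt_eqF// sqrtr_gt0.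
Qed.

End stirling.

(** * The phase and the normalising factor of the densities *)

Section phase.
Context {R : realType}.
Implicit Types (q s : R).

(* Up to the factor [N], minus the logarithm of the density of [ln W]; for
   [0 < q < 1] it is the Kullback-Leibler divergence of two Bernoulli laws
   divided by [q (1 - q)].  The cases [q = 0] and [q = 1] are its limits. *)
Definition phase q s : R :=
  if q == 0 then expR s - 1 - s
  else if q == 1 then expR (- s) - 1 + s
  else ln (1 - q + q * expR s) / (q * (1 - q)) - s / (1 - q).

(** One expression for the derivative of the phase, valid for every [q] in [[0, 1]]: monotonicity
    and expansions are derived from it without separating the degenerate cases. *)
Definition dphase q s : R := (expR s - 1) / (1 + q * (expR s - 1)).

Lemma dphase_den q s : 0 <= q <= 1 -> 0 < 1 + q * (expR s - 1).
Proof.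
move=> /andP[q0 q1]; have e0 := expR_gt0 s.
have -> : 1 + q * (expR s - 1) = (1 - q) + q * expR s by ring.
have [->|qn] := eqVneq q 0; first by rewrite mul0r subr0 addr0.
by rewrite ltr_wpDl ?subr_ge0// mulr_gt0// lt_neqAle eq_sym qn.
Qed.

Lemma phase0 q : phase q 0 = 0.
Proof.
rewrite /phase oppr0 expR0; case: ifPn => _; first by rewrite subrr addr0.
by case: ifPn => _; rewrite ?subrr ?addr0// mulr1 subrK ln1 !mul0r subrr.
Qed.

Lemma is_derive_phase q s : 0 <= q <= 1 -> is_derive s (1 : R) (phase q) (dphase q s).
Proof.
move=> q01; have d0 := dphase_den s q01; have e0 := expR_gt0 s.
rewrite /dphase; have [q0|qn0] := eqVneq q 0.
  have -> : phase q = (fun s => expR s - 1 - s).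
    by apply/funext => x; rewrite /phase q0 eqxx.
  by apply: der_eq; [der|rewrite q0 mul0r [1 + 0]addr0 divr1 /=; ring].
have [q1|qn1] := eqVneq q 1.
  have -> : phase q = (fun s => expR (- s) - 1 + s).
    by apply/funext => x; rewrite /phase q1 oner_eq0 eqxx.
  apply: der_eq; [der|rewrite q1 expRN /=; field].
  by rewrite gt_eqF//= (_ : 1 + (expR s - 1) = expR s) ?gt_eqF//; ring.
have -> : phase q = (fun s => ln (1 - q + q * expR s) * (q * (1 - q))^-1 - s * (1 - q)^-1).
  by apply/funext => x; rewrite /phase (negbTE qn0) (negbTE qn1).
have pn : 1 - q != 0 by rewrite subr_eq0 eq_sym.
have d1 : 0 < 1 - q + q * expR s by move: d0; rewrite mulrBr mulr1 addrCA addrC -addrA.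
apply: der_eq; first by der.
rewrite /=; field.
rewrite qn0 pn !gt_eqF//; by [].
Qed.

Lemma continuous_phase q : 0 <= q <= 1 -> continuous (phase q).
Proof.
move=> q01 s; apply/differentiable_continuous/derivable1_diffP.
apply: @ex_derive; exact: is_derive_phase.
Qed.

Lemma dphase_gt0 q s : 0 <= q <= 1 -> 0 < s -> 0 < dphase q s.
Proof.
by move=> q01 s0; rewrite divr_gt0 ?dphase_den// subr_gt0 expR_gt1.
Qed.

Lemma dphase_lt0 q s : 0 <= q <= 1 -> s < 0 -> dphase q s < 0.
Proof.
move=> q01 s0; rewrite /dphase pmulr_llt0 ?invr_gt0 ?dphase_den//.
by rewrite subr_lt0 expR_lt1.
Qed.

Lemma phase_MVT q a b : 0 <= q <= 1 -> a < b ->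
  exists2 c, a < c < b & phase q b - phase q a = dphase q c * (b - a).
Proof.
move=> q01 ab; have [||c] := @MVT _ (phase q) (dphase q) a b ab.
- by move=> x _; exact: is_derive_phase.
- by apply: continuous_subspaceT; exact: continuous_phase.
- by rewrite in_itv/= => cab ->; exists c.
Qed.

Lemma phase_homo q a b : 0 <= q <= 1 -> 0 <= a -> a < b -> phase q a < phase q b.
Proof.
move=> q01 a0 ab; have [c /andP[ac cb] E] := phase_MVT q01 ab.
rewrite -subr_gt0 E mulr_gt0 ?subr_gt0// dphase_gt0//; exact: le_lt_trans ac.
Qed.

Lemma phase_nhomo q a b : 0 <= q <= 1 -> b <= 0 -> a < b -> phase q b < phase q a.
Proof.
move=> q01 b0 ab; have [c /andP[ac cb] E] := phase_MVT q01 ab.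
rewrite -subr_lt0 E pmulr_llt0 ?subr_gt0// dphase_lt0//; exact: lt_le_trans cb b0.
Qed.

(** The phase decreases up to 0 and increases afterwards, so its minimum over [|s| >= d] is reached
    at [d] or [- d]. *)
Lemma phase_ge q d : 0 <= q <= 1 -> 0 < d -> exists2 c, 0 < c &
  forall s, d <= `|s| -> c <= phase q s.
Proof.
move=> q01 d0.
exists (Num.min (phase q d) (phase q (- d))).
  rewrite lt_min -(phase0 q) phase_homo//= phase0 -(phase0 q) phase_nhomo//.
  by rewrite oppr_lt0.
move=> s; have [s0|s0] := leP 0 s => ds; rewrite ge_min; apply/orP; [left|right].
  move: ds; rewrite ger0_norm// le_eqVlt => /predU1P[->//|ds].
  by apply/ltW/phase_homo => //; exact: ltW.
have : s <= - d by rewrite lerNr -ltr0_norm.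
rewrite le_eqVlt => /predU1P[->//|sd]; apply/ltW/phase_nhomo => //.
by rewrite oppr_le0 ltW.
Qed.

(** Large [s] means small observations. There the phase grows exponentially if [q = 0], and
    otherwise linearly with slope [q^-1], which is [1 / (q * (1 - q)) - 1 / (1 - q)] in the interior
    case. *)
Lemma phase_slope q M : 0 <= q <= 1 -> 0 < M -> (q != 0 -> M = q^-1) -> exists B, forall s,
  M * s - B <= phase q s.
Proof.
move=> /andP[q0 q1] M0 hM; have [qe|qn0] := eqVneq q 0.
  (* From the tangent of [expR] at [ln (M + 1)], where its slope is [M + 1]. *)
  exists ((M + 1) * ln (M + 1)) => s; rewrite /phase qe eqxx.
  have M1 : 0 < M + 1 by lra.
  have := expR_ge1Dx (s - ln (M + 1)); rewrite expRB lnK ?posrE// ler_pdivlMr//.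
  rewrite -subr_ge0 => h; nra.
have q_0 : 0 < q by rewrite lt_neqAle eq_sym qn0.
rewrite hM//; have [qe|qn1] := eqVneq q 1.
  exists 1 => s; rewrite /phase qe oner_eq0 eqxx.
  by have := expR_gt0 (- s); rewrite invr1; lra.
have p0 : 0 < 1 - q by rewrite subr_gt0 lt_neqAle qn1.
exists (- ln q / (q * (1 - q))) => s; rewrite /phase (negbTE qn0) (negbTE qn1).
have h : ln q + s <= ln (1 - q + q * expR s).
  have qe : 0 < q * expR s by rewrite mulr_gt0// expR_gt0.
  rewrite -[s in ln q + s]expRK -lnM ?posrE ?expR_gt0// ler_ln ?posrE//; last exact: addr_gt0.
  by rewrite lerDr ltW.
rewrite [leLHS](_ : _ = (ln q + s) / (q * (1 - q)) - s / (1 - q)); last first.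
  by field; rewrite !gt_eqF.
by rewrite lerD2r ler_pM2r// invr_gt0 mulr_gt0.
Qed.

Lemma peano_phase q : 0 <= q <= 1 ->
  peano 2 (phase q) (1 / 2) ((1 - 2 * q) / 6) ((1 - 6 * q * (1 - q)) / 24).
Proof.
move=> q01.
have p1 := peano_mul (@peano_expRB1 R) (peano_comp (@peano_inv1D R) (peano_scale q (@peano_expRB1 R))).
apply: (peano_coef _ _ _ (peano_derive (phase0 q) _ p1)); [by field..|].
by near=> s; exact: is_derive_phase.
Unshelve. all: by end_near. Qed.

End phase.

(** * The normalising factor and the three families of densities *)

Section normalizer.
Context {R : realType}.
Implicit Types (q N w : R).

(* The integral over R of [expR (- N * phase q s)] is the inverse of
   [normalizer q N]; in the case [0 < q < 1] it is a Beta function. *)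
Definition normalizer q N : R :=
  if (q == 0) || (q == 1) then (gamma_laplace N)^-1
  else gamma_laplace (N / (q * (1 - q))) /
    (gamma_laplace (N / (1 - q)) * gamma_laplace (N / q)).

Definition normalizer_ratio q N : R :=
  if (q == 0) || (q == 1) then (stirling_ratio N)^-1
  else stirling_ratio (N / (q * (1 - q))) *
    (stirling_ratio (N / (1 - q)) * stirling_ratio (N / q))^-1.

Lemma q_interior q : 0 <= q <= 1 -> ~~ ((q == 0) || (q == 1)) -> 0 < q /\ 0 < 1 - q.
Proof.
move=> /andP[q0 q1]; rewrite negb_or => /andP[qn0 qn1].
by rewrite subr_gt0 !lt_neqAle qn1 q1 eq_sym qn0 q0.
Qed.

(** The factors in [q] and [1 - q] cancel because [N / (1 - q)] and [N / q] have product [N] times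
    [N / (q * (1 - q))]. *)
Lemma normalizerE q N : 0 <= q <= 1 -> 0 < N ->
  normalizer q N = Num.sqrt N / Num.sqrt (2 * pi) * normalizer_ratio q N.
Proof.
move=> q01 N0; have s2 := @sqrt2pi_gt0 R; have sN : 0 < Num.sqrt N by rewrite sqrtr_gt0.
have sr := @stirling_ratio_gt0 R.
rewrite /normalizer /normalizer_ratio; case: ifPn => [_|qi].
  by rewrite gamma_laplaceE//; field; rewrite !gt_eqF// sr.
have [q_0 p_0] := q_interior q01 qi.
have pq : 0 < q * (1 - q) by rewrite mulr_gt0.
rewrite !gamma_laplaceE ?divr_gt0//.
rewrite ![Num.sqrt (N / _)]sqrtrM ?(ltW N0)// !sqrtrV ?(ltW pq) ?(ltW q_0) ?(ltW p_0)//.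
rewrite (sqrtrM (1 - q) (ltW q_0)).
have a0 := sr _ (divr_gt0 N0 q_0); have b0 := sr _ (divr_gt0 N0 p_0).
have c0 := sr _ (divr_gt0 N0 pq).
have sq : 0 < Num.sqrt q by rewrite sqrtr_gt0.
have sp : 0 < Num.sqrt (1 - q) by rewrite sqrtr_gt0.
move: (stirling_ratio (N / q)) (stirling_ratio (N / (1 - q)))
  (stirling_ratio (N / (q * (1 - q)))) a0 b0 c0 => A B C a0 b0 c0.
by field; rewrite !gt_eqF.
Qed.

(** Rescaling turns the 1/12 of [stirling_ratio (N / s)] into [s / 12], and [q * (1 - q) - (1 - q) -
    q = - (1 - q + q ^+ 2)]. At [q = 0] and [q = 1] this is -1, in agreement with the degenerate
    branch. *)
Lemma normalizer_first_order q : 0 <= q <= 1 ->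
  first_order (normalizer_ratio q) (- ((1 - q + q ^+ 2) / 12)).
Proof.
move=> q01; have S := @stirling_first_order R.
have [qe|qi] := boolP ((q == 0) || (q == 1)).
  have -> : normalizer_ratio q = (fun N => (stirling_ratio N)^-1).
    by apply/funext => N; rewrite /normalizer_ratio qe.
  have -> : (1 - q + q ^+ 2) / 12 = 1 / 12 by case/orP : qe => /eqP ->; field.
  exact: first_order_inv.
have [q_0 p_0] := q_interior q01 qi.
have pq : 0 < q * (1 - q) by rewrite mulr_gt0.
have -> : normalizer_ratio q = (fun N => stirling_ratio (N / (q * (1 - q))) *
    (stirling_ratio (N / (1 - q)) * stirling_ratio (N / q))^-1).
  by apply/funext => N; rewrite /normalizer_ratio (negbTE qi).
have -> : - ((1 - q + q ^+ 2) / 12) = q * (1 - q) * (1 / 12) - ((1 - q) * (1 / 12) + q * (1 / 12)).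
  by field.
apply: (first_order_mul (first_order_scale pq S)).
exact: (first_order_inv (first_order_mul (first_order_scale p_0 S) (first_order_scale q_0 S))).
Qed.

Lemma normalizer_ge0 q N : 0 <= normalizer q N.
Proof.
rewrite /normalizer; case: ifPn => _; first by rewrite invr_ge0 gamma_laplace_ge0.
by rewrite divr_ge0 ?mulr_ge0 ?gamma_laplace_ge0.
Qed.

Lemma normalizer_bound q N0 : 0 <= q <= 1 -> 0 < N0 -> exists2 L, 0 < L &
  forall N, N0 <= N -> normalizer q N <= L * Num.sqrt N.
Proof.
move=> q01 N00; have s2 := @sqrt2pi_gt0 R.
suff [L hL] : exists L, forall N, N0 <= N -> normalizer_ratio q N <= L.
  exists (Num.max L 1 / Num.sqrt (2 * pi)).
    by rewrite divr_gt0// lt_max ltr01 orbT.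
  move=> N NN; have N_0 := lt_le_trans N00 NN; rewrite normalizerE// [leRHS]mulrC mulrA.
  rewrite -mulrA [leRHS](_ : _ = Num.sqrt N * ((Num.sqrt (2 * pi))^-1 * Num.max L 1)); last by ring.
  rewrite ler_wpM2l ?sqrtr_ge0// ler_wpM2l ?invr_ge0 ?(ltW s2)// le_max.
  by rewrite hL.
rewrite /normalizer_ratio; have [qe|qi] := boolP ((q == 0) || (q == 1)).
  have [l [L [l0 h]]] := stirling_ratio_bounds N00.
  exists l^-1 => N NN; have /andP[h1 _] := h _ NN.
  by rewrite lef_pV2 ?posrE//; exact: lt_le_trans h1.
have [q_0 p_0] := q_interior q01 qi.
have pq : 0 < q * (1 - q) by rewrite mulr_gt0.
have [l1 [L1 [l10 h1]]] := stirling_ratio_bounds (divr_gt0 N00 pq).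
have [l2 [L2 [l20 h2]]] := stirling_ratio_bounds (divr_gt0 N00 p_0).
have [l3 [L3 [l30 h3]]] := stirling_ratio_bounds (divr_gt0 N00 q_0).
exists (L1 * (l2 * l3)^-1) => N NN.
have D (s : R) : 0 < s -> N0 / s <= N / s by move=> s0; rewrite ler_pM2r ?invr_gt0.
have /andP[a1 a2] := h1 _ (D _ pq).
have /andP[b1 _] := h2 _ (D _ p_0).
have /andP[c1 _] := h3 _ (D _ q_0).
move: (stirling_ratio (N / (q * (1 - q)))) (stirling_ratio (N / (1 - q)))
  (stirling_ratio (N / q)) a1 a2 b1 c1 => A B C a1 a2 b1 c1.
have b0 := lt_le_trans l20 b1; have c0 := lt_le_trans l30 c1.
apply: ler_pM => //; first exact: le_trans (ltW l10) a1.
  by rewrite invr_ge0 mulr_ge0// ltW.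
have h : l2 * l3 <= B * C.
  by apply: ler_pM => //; exact: ltW.
by rewrite lef_pV2 // posrE; apply: mulr_gt0.
Qed.

Lemma measurable_normalizer q N0 : 0 <= q <= 1 -> 0 < N0 ->
  measurable_fun setT (fun N => normalizer q (Num.max N N0)).
Proof.
move=> q01 N00.
have mx (a s : R) : 0 < s -> Num.max a N0 / s = Num.max (a / s) (N0 / s).
  by move=> s0; rewrite maxr_pMl// invr_ge0 ltW.
have mZ (s : R) : 0 < s -> measurable_fun setT (fun N => gamma_laplace (Num.max N N0 / s)).
  move=> s0; have -> : (fun N => gamma_laplace (Num.max N N0 / s)) =
     (fun a => gamma_laplace (Num.max a (N0 / s))) \o (fun N => N * s^-1).
    by apply/funext => N /=; rewrite mx.
  apply: measurableT_comp; last by meas.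
  by apply: measurable_gamma_laplace; rewrite divr_gt0.
have [qe|qi] := boolP ((q == 0) || (q == 1)).
  have -> : (fun N => normalizer q (Num.max N N0)) = (fun N => (gamma_laplace (Num.max N N0))^-1).
    by apply/funext => N; rewrite /normalizer qe.
  by apply: meas_inv; exact: measurable_gamma_laplace.
have [q_0 p_0] := q_interior q01 qi.
have -> : (fun N => normalizer q (Num.max N N0)) = (fun N => gamma_laplace (Num.max N N0 / (q * (1 - q))) *
    (gamma_laplace (Num.max N N0 / (1 - q)) * gamma_laplace (Num.max N N0 / q))^-1).
  by apply/funext => N; rewrite /normalizer (negbTE qi).
apply: meas_mul; first by apply: mZ; rewrite mulr_gt0.
by apply: meas_inv; apply: meas_mul; exact: mZ.
Qed.

(** [g w * w] is the density of [ln W] at [ln w], the form in which the three families become the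
    same expression in [normalizer] and [phase]. *)
Lemma gamma_pdf_phase N w : 0 < N -> 0 < w ->
  gamma_pdf N N w * w = normalizer 0 N * expR (- (N * phase 0 (ln w))).
Proof.
move=> N0 w0; rewrite /gamma_pdf /normalizer /phase !eqxx/= Gamma_funE// lnK ?posrE//.
have Z0 := gamma_laplace_gt0 N0.
rewrite /powR (gt_eqF N0) (gt_eqF w0).
have -> : expR (- (N * (w - 1 - ln w))) =
  expR (N * ln N) / expR (N * ln N - N) * expR ((N - 1) * ln w) * expR (- (N * w)) * w.
  by rewrite -[X in _ = _ * X]lnK ?posrE// -expRB -!expRD; congr expR; ring.
by field; rewrite !gt_eqF ?expR_gt0.
Qed.

Lemma inverse_gamma_pdf_phase N w : 0 < N -> 0 < w ->
  inverse_gamma_pdf N N w * w = normalizer 1 N * expR (- (N * phase 1 (ln w))).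
Proof.
move=> N0 w0; rewrite /inverse_gamma_pdf.
have wi0 : 0 < w^-1 by rewrite invr_gt0.
have -> : gamma_pdf N N w^-1 / w ^+ 2 * w = gamma_pdf N N w^-1 * w^-1.
  by field; rewrite gt_eqF.
rewrite gamma_pdf_phase// /normalizer /phase !eqxx oner_eq0/= lnV ?posrE//.
by rewrite opprK.
Qed.

Lemma fisher_pdf_phase q N w : 0 < q < 1 -> 0 < N -> 0 < w ->
  fisher_pdf (2 * (N / (1 - q))) (2 * (N / q)) w * w =
  normalizer q N * expR (- (N * phase q (ln w))).
Proof.
move=> /andP[q0 q1] N0 w0; have p0 : 0 < 1 - q by rewrite subr_gt0.
rewrite /fisher_pdf /normalizer /phase (gt_eqF q0) (lt_eqF q1)/= lnK ?posrE//.
(* Half the degrees of freedom; [a + b = N / (q * (1 - q))] and [a / b = q / (1 - q)]. *)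
set a := N / (1 - q); set b := N / q.
have a0 : 0 < a by rewrite divr_gt0.
have b0 : 0 < b by rewrite divr_gt0.
have -> : (2 * a + 2 * b) / 2 = a + b by field.
have -> : 2 * a / 2 = a by field.
have -> : 2 * b / 2 = b by field.
have abE : N / (q * (1 - q)) = a + b by rewrite /a /b; field; rewrite !gt_eqF.
have ab0 : 0 < a + b by rewrite addr_gt0.
have -> : 2 * a / (2 * b) = a / b by field; rewrite gt_eqF.
have rE : a / b = q / (1 - q) by rewrite /a /b; field; rewrite !gt_eqF.
have r0 : 0 < a / b by rewrite divr_gt0.
have rw0 : 0 < 1 + a / b * w by rewrite addr_gt0// mulr_gt0.
rewrite abE !Gamma_funE//.
have Za := gamma_laplace_gt0 a0; have Zb := gamma_laplace_gt0 b0.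
rewrite /powR (gt_eqF r0) (gt_eqF w0) (gt_eqF rw0).
have qw0 : 0 < 1 - q + q * w by rewrite addr_gt0// mulr_gt0.
have -> : expR (- (N * (ln (1 - q + q * w) / (q * (1 - q)) - ln w / (1 - q)))) =
  expR ((a + b) * ln (a + b) - (a + b)) / (expR (a * ln a - a) * expR (b * ln b - b)) *
  expR (a * ln (a / b)) * expR ((a - 1) * ln w) * expR (- (a + b) * ln (1 + a / b * w)) * w.
  rewrite -[X in _ = _ * X]lnK ?posrE// -!expRD -expRN -!expRD.
  congr expR.
  have -> : 1 + a / b * w = (1 - q + q * w) / (1 - q) by rewrite rE; field; rewrite gt_eqF.
  have -> : ln (a + b) = ln b - ln (1 - q).
    have -> : a + b = b / (1 - q) by rewrite /a /b; field; rewrite !gt_eqF.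
    by rewrite ln_div ?posrE.
  rewrite !ln_div ?posrE//.
  have -> : N * (ln (1 - q + q * w) / (q * (1 - q)) - ln w / (1 - q)) =
    (a + b) * ln (1 - q + q * w) - a * ln w by rewrite -abE /a; field; rewrite !gt_eqF.
  ring.
field.
by rewrite !gt_eqF// expR_gt0.
Qed.

End normalizer.

(** * The kernel *)

Section kernel_formula.
Context {R : realType}.
Implicit Types (q xi x h u theta eta : R).

(** With [q = sin theta ^+ 2] and [h = eta ^+ 2], [tilt] is [1 + cos (2 * theta) / xi], [shift] is
    the scale [nu], [conc] is [xi ^+ 2 / gamma ^+ 2], and [logratio] is the value of [ln W] for
    which [nu * W ^ xi = x / u]. *)
Definition tilt q xi : R := 1 + (1 - 2 * q) / xi.
Definition shift q xi h u : R := 1 + tilt q xi / 2 * (h / (h + u)).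
Definition conc xi h u : R := xi ^+ 2 * ((h + u) / h).
Definition logratio q xi x h u : R := ln (x / (u * shift q xi h u)) / xi.

(* The contribution at [x] of an observation [u], with [q = sin theta ^+ 2] and
   [h = eta ^+ 2]. *)
Definition kern q xi x h u : R :=
  if (0 < u) && (0 < shift q xi h u) then
    (xi * x)^-1 * normalizer q (conc xi h u)
    * expR (- (conc xi h u * phase q (logratio q xi x h u)))
  else 0.

(** The Jacobian of [w = (x / (u * nu)) ^ (1 / xi)] brings out [g w * w]; the powers of [u] and [nu]
    cancel, leaving [(xi * x)^-1]. *)
Lemma scaled_power_pdf_kern q xi x h u (g : R -> R) : 0 < xi -> 0 < x -> 0 < h -> 0 < u ->
  (forall w, 0 < w -> g w * w =
    normalizer q (conc xi h u) * expR (- (conc xi h u * phase q (ln w)))) ->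
  u^-1 * scaled_power_pdf (shift q xi h u) xi g (x / u) = kern q xi x h u.
Proof.
move=> xi0 x0 h0 u0 gE; rewrite /scaled_power_pdf /kern u0 divr_gt0// andbT/=.
case: ifPn => nu0; last by rewrite mulr0.
set nu := shift q xi h u in nu0 *.
have y0 : 0 < x / u / nu by rewrite !divr_gt0.
pose w := (x / u / nu) `^ xi^-1.
have w0 : 0 < w by rewrite powR_gt0.
have -> : (x / u / nu) `^ (xi^-1 - 1) = w / (x / u / nu).
  by rewrite powRB ?(gt_eqF y0) ?implybT// powRr1// ltW.
have lw : ln w = logratio q xi x h u.
  rewrite /w ln_powR /logratio -/nu mulrC; congr (ln _ / _).
  by field; rewrite !gt_eqF.
rewrite -/w; have := gE _ w0; rewrite lw => E; rewrite -(mulrA (xi * x)^-1) -E.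
by field; rewrite !gt_eqF.
Qed.

Lemma kernel_formula xi theta eta x u : 0 < xi -> 0 <= theta <= pi / 2 -> 0 < eta -> 0 < x ->
  u^-1 * meijer_kernel xi theta eta u (x / u) = kern (sin theta ^+ 2) xi x (eta ^+ 2) u.
Proof.
move=> xi0 /andP[t0 t1] eta0 x0; set q := sin theta ^+ 2; set h := eta ^+ 2.
have h0 : 0 < h by rewrite exprn_gt0.
(* For [u <= 0], with [0^-1 = 0], one has [x / u <= 0] and both sides vanish. *)
have [u0|u0] := leP u 0.
  have -> : kern q xi x h u = 0 by rewrite /kern ltNge u0.
  rewrite /meijer_kernel /meijer_pdf /scaled_power_pdf ifF ?mulr0//.
  apply/negbTE; rewrite negb_and -!leNgt; apply/orP; right.
  by rewrite mulr_ge0_le0 ?(ltW x0)// invr_le0.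
have hu0 : 0 < h + u by rewrite addr_gt0.
have g2 : kernel_gamma eta u ^+ 2 = h / (h + u).
  by rewrite /kernel_gamma exprMn exprVn sqr_sqrtr// ltW.
have cq : cos theta ^+ 2 = 1 - q by rewrite /q cos2sin2.
have nuE : kernel_nu xi theta eta u = shift q xi h u.
  rewrite /kernel_nu g2 /shift /tilt mulrC.
  have -> : cos (2 * theta) = 1 - 2 * q.
    by rewrite mulrC mulr_natr cos_mulr2n cq -mulr_natr; ring.
  by field; rewrite !gt_eqF.
have NE : xi ^+ 2 / kernel_gamma eta u ^+ 2 = conc xi h u.
  by rewrite g2 /conc; field; rewrite !gt_eqF.
have N0 : 0 < conc xi h u by rewrite /conc mulr_gt0 ?exprn_gt0// divr_gt0.
rewrite /meijer_kernel /meijer_pdf nuE NE; apply: scaled_power_pdf_kern => // w w0.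
have [tE|tn0] := eqVneq theta 0.
  by rewrite /q tE sin0 expr0n gamma_pdf_phase.
have [tE|tn1] := eqVneq theta (pi / 2).
  by rewrite /q tE sin_pihalf expr1n inverse_gamma_pdf_phase.
have tp : 0 < theta by rewrite lt_neqAle eq_sym tn0.
have tlt : theta < pi / 2 by rewrite lt_neqAle tn1.
have q0 : 0 < q.
  rewrite exprn_gt0// sin_gt0_pi// tp (lt_trans tlt)//.
  by have := @pi_gt0 R; lra.
have q1 : q < 1.
  rewrite -subr_gt0 -cq exprn_gt0// cos_gt0_pihalf// tlt andbT.
  by have := @pi_gt0 R; lra.
rewrite -fisher_pdf_phase ?q0// g2 cq -/q /conc.
have -> : 2 * xi ^+ 2 / (h / (h + u) * (1 - q)) = 2 * (xi ^+ 2 * ((h + u) / h) / (1 - q)).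
  by field; rewrite !gt_eqF// subr_gt0.
have -> // : 2 * xi ^+ 2 / (h / (h + u) * q) = 2 * (xi ^+ 2 * ((h + u) / h) / q).
by field; rewrite !gt_eqF.
Qed.

End kernel_formula.

(** * Expansion of the kernel around [u = x] *)

Section local_expansion.
Context {R : realType}.
Implicit Types (e t : R).
Variables (q xi x : R).
Hypotheses (q01 : 0 <= q <= 1) (xi0 : 0 < xi) (x0 : 0 < x).

(** [obs] is the observation at rescaled distance [t]; [Y] and [y] are such that
    [h + u = x * (1 + e * Y)] and [shift = 1 + e ^+ 2 * y] at [h = e ^+ 2], [u = obs e t]. *)
Let obs e t : R := x * (1 + e * t).
Let Y e t : R := t + e / x.
Let y e t : R := tilt q xi / (2 * x) * (1 + e * Y e t)^-1.

Lemma obsE e t : e ^+ 2 + obs e t = x * (1 + e * Y e t).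
Proof. by rewrite /obs /Y; field; rewrite gt_eqF. Qed.

Let small_id : small (fun _ t : R => t).
Proof. exact: cvg_jdomM. Qed.

Let small_Y : small Y.
Proof.
have c1 := @cvg_jdom1 R; have c2 := @cvg_jdomM R.
have lim : p.1 * p.2 + p.1 * p.1 * x^-1 @[p --> @jdom R] --> 0 + 0 * 0 * x^-1 by cvg_tac.
rewrite !mul0r addr0 in lim; apply: cvg_trans lim; apply: near_eq_cvg; near=> p.
by rewrite /Y; ring.
Unshelve. all: by end_near. Qed.

Let jet_Y : jet Y id (fun=> 1 / x) (fun=> 0).
Proof.
apply: jet_near (jet_coef _ _ _ (jet_add (@jet_id R) (jet_mul (@jet_eps R) (jet_cst x^-1)))).
- by near=> p; rewrite /Y.
- by move=> t /=; rewrite mul0r addr0.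
- by move=> t /=; ring.
- by move=> t /=; ring.
Unshelve. all: by end_near. Qed.

Let cvg_y : y p.1 p.2 @[p --> @jdom R] --> tilt q xi / (2 * x).
Proof.
have cY : p.1 * Y p.1 p.2 @[p --> @jdom R] --> 0 by exact: small_Y.
have lim : tilt q xi / (2 * x) * (1 + p.1 * Y p.1 p.2)^-1 @[p --> @jdom R] -->
  tilt q xi / (2 * x) * (1 + 0)^-1 by cvg_tac; rewrite addr0 oner_neq0.
by rewrite addr0 invr1 mulr1 in lim.
Qed.

Let jet_inv : jet (fun e t => (1 + e * Y e t)^-1) (fun=> 1) (fun t => - t) (fun t => - (1 / x) + t ^+ 2).
Proof.
have [H [jH HE]] := jet_comp (@peano_inv1D R) small_Y jet_Y.
apply: jet_near (jet_coef _ _ _ jH).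
- near=> p.
  have -> : (1 + p.1 * Y p.1 p.2)^-1 = (p.1 * Y p.1 p.2) ^+ 0 * H p.1 p.2 by near: p.
  by rewrite expr0 mul1r.
- by [].
- by move=> t /=; ring.
- by move=> t /=; ring.
Unshelve. all: by end_near. Qed.

Let jet_y : jet y (fun=> tilt q xi / (2 * x)) (fun t => - tilt q xi / (2 * x) * t)
  (fun t => tilt q xi / (2 * x) * (- (1 / x) + t ^+ 2)).
Proof.
apply: (jet_coef _ _ _ (jet_mul (jet_cst (tilt q xi / (2 * x))) jet_inv)) => t; ring.
Qed.

Let shiftE e t : 1 + e * Y e t != 0 -> shift q xi (e ^+ 2) (obs e t) = 1 + e * (e * y e t).
Proof.
move=> h; rewrite /shift obsE /y; field.
by rewrite h gt_eqF.
Qed.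

Let near_Y : \forall p \near @jdom R, 0 < 1 + p.1 * Y p.1 p.2.
Proof.
have := near0_gtN1 (R := R) => h.
have h' : \forall p \near @jdom R, 0 < 1 + p.1 * Y p.1 p.2 := small_Y h.
exact: h'.
Qed.

Let small_y : small (fun e t => e * y e t).
Proof.
have c1 := @cvg_jdom1 R; have cy := cvg_y.
have lim : p.1 * (p.1 * y p.1 p.2) @[p --> @jdom R] --> 0 * (0 * (tilt q xi / (2 * x))) by cvg_tac.
by rewrite mul0r in lim.
Qed.

Let near_y : \forall p \near @jdom R, 0 < 1 + p.1 * (p.1 * y p.1 p.2).
Proof.
have := near0_gtN1 (R := R) => h.
have h' : \forall p \near @jdom R, 0 < 1 + p.1 * (p.1 * y p.1 p.2) := small_y h.
exact: h'.
Qed.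

Let near_t : \forall p \near @jdom R, 0 < 1 + p.1 * p.2.
Proof.
have := near0_gtN1 (R := R) => h.
have h' : \forall p \near @jdom R, 0 < 1 + p.1 * p.2 := small_id h.
exact: h'.
Qed.

Lemma shift_gt0_near : \forall p \near @jdom R, 0 < shift q xi (p.1 ^+ 2) (obs p.1 p.2).
Proof.
near=> p; rewrite shiftE; first by near: p.
by rewrite gt_eqF//; near: p.
Unshelve. all: by end_near. Qed.

Let S e t : R := - (ln (1 + e * t) + ln (1 + e * (e * y e t))) / (xi * e).

Let logratioE : \forall p \near @jdom R,
  logratio q xi x (p.1 ^+ 2) (obs p.1 p.2) = p.1 * S p.1 p.2.
Proof.
near=> p.
have e0 : 0 < p.1 by near: p; exact: jdom_gt0.
have h1 : 0 < 1 + p.1 * p.2 by near: p.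
have h2 : 0 < 1 + p.1 * Y p.1 p.2 by near: p.
have h3 : 0 < 1 + p.1 * (p.1 * y p.1 p.2) by near: p.
rewrite /logratio shiftE ?(gt_eqF h2)// /obs.
have -> : x / (x * (1 + p.1 * p.2) * (1 + p.1 * (p.1 * y p.1 p.2))) =
  ((1 + p.1 * p.2) * (1 + p.1 * (p.1 * y p.1 p.2)))^-1.
  by field; rewrite !gt_eqF.
rewrite lnV ?posrE ?mulr_gt0// lnM ?posrE// /S.
by field; rewrite !gt_eqF.
Unshelve. all: by end_near. Qed.

Let small_S : small S.
Proof.
have c1 : p.1 * p.2 @[p --> @jdom R] --> 0 by exact: small_id.
have c2 : p.1 * (p.1 * y p.1 p.2) @[p --> @jdom R] --> 0 by exact: small_y.
have lim : - (ln (1 + p.1 * p.2) + ln (1 + p.1 * (p.1 * y p.1 p.2))) * xi^-1 @[p --> @jdom R] -->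
  - (ln (1 + 0) + ln (1 + 0)) * xi^-1 by cvg_tac; rewrite addr0 ltr01.
rewrite addr0 ln1 addr0 oppr0 mul0r in lim.
apply: cvg_trans lim; apply: near_eq_cvg; near=> p.
have e0 : 0 < p.1 by near: p; exact: jdom_gt0.
by rewrite /S; field; rewrite !gt_eqF.
Unshelve. all: by end_near. Qed.

Let jet_S : jet S (fun t => - t / xi) (fun t => (t ^+ 2 / 2 - tilt q xi / (2 * x)) / xi)
  (fun t => (- (t ^+ 3 / 3) + tilt q xi * t / (2 * x)) / xi).
Proof.
have [H [jH HE]] := jet_comp (@peano_ln1D R) small_id (@jet_id R).
have [H' [jH' HE']] := jet_comp (@peano_ln1D R) small_y (jet_mul (@jet_eps R) jet_y).
apply: jet_near (jet_coef _ _ _ (jet_mul (jet_cst (- xi^-1))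
  (jet_add (jet_mul (@jet_id R) jH) (jet_mul (jet_mul (@jet_eps R) jet_y) jH')))).
- near=> p.
  have e0 : 0 < p.1 by near: p; exact: jdom_gt0.
  rewrite /S.
  have -> : ln (1 + p.1 * p.2) = (p.1 * p.2) ^+ 1 * H p.1 p.2 by near: p.
  have -> : ln (1 + p.1 * (p.1 * y p.1 p.2)) = (p.1 * (p.1 * y p.1 p.2)) ^+ 1 * H' p.1 p.2 by near: p.
  by field; rewrite !gt_eqF.
- by move=> t /=; field; rewrite !gt_eqF.
- by move=> t /=; field; rewrite !gt_eqF.
- by move=> t /=; field; rewrite !gt_eqF.
Unshelve. all: by end_near. Qed.

Definition kernE e t := conc xi (e ^+ 2) (obs e t) * phase q (logratio q xi x (e ^+ 2) (obs e t)).

(** In the quadratic term, 1/2 comes from [h] in [conc]; the rest arises as [- tilt / 4 - tilt * (1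
    - 2 * q) / (4 * xi)], which is [- tilt ^+ 2 / 4] by the definition of [tilt]. *)
Definition kernE2 t := x * (- (1 / 24) + (1 - 2 * q) / (12 * xi) + (1 - 6 * q * (1 - q)) / (24 * xi ^+ 2)) * t ^+ 4
  + (1 / 2 - tilt q xi ^+ 2 / 4) * t ^+ 2 + tilt q xi ^+ 2 / (8 * x).

Lemma jet_kernE : jet kernE (fun t => x / 2 * t ^+ 2)
  (fun t => tilt q xi / 2 * t - x * (1 - 2 * q) / (6 * xi) * t ^+ 3) kernE2.
Proof.
have [H [jH HE]] := jet_comp (peano_phase q01) small_S jet_S.
apply: jet_near (jet_coef _ _ _ (jet_mul (jet_mul (jet_cst (xi ^+ 2 * x))
  (jet_add (jet_cst 1) (jet_mul (@jet_eps R) jet_Y))) (jet_mul (jet_mul jet_S jet_S) jH))).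
- near=> p.
  have e0 : 0 < p.1 by near: p; exact: jdom_gt0.
  rewrite /kernE.
  have -> : logratio q xi x (p.1 ^+ 2) (obs p.1 p.2) = p.1 * S p.1 p.2 by near: p.
  have -> : phase q (p.1 * S p.1 p.2) = (p.1 * S p.1 p.2) ^+ 2 * H p.1 p.2 by near: p.
  by rewrite /conc obsE; field; rewrite !gt_eqF.
- by move=> t /=; field; rewrite !gt_eqF.
- by move=> t /=; rewrite /tilt; field; rewrite !gt_eqF.
- by move=> t /=; rewrite /kernE2 /tilt; field; rewrite !gt_eqF.
Unshelve. all: by end_near. Qed.

Let conc_eq e t : 0 < e -> conc xi (e ^+ 2) (obs e t) = xi ^+ 2 * x * (1 + e * Y e t) / e ^+ 2.
Proof. by move=> e0; rewrite /conc obsE; field; rewrite gt_eqF. Qed.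

Let cvg_Y1 : 1 + p.1 * Y p.1 p.2 @[p --> @jdom R] --> (1 : R).
Proof.
have cY : p.1 * Y p.1 p.2 @[p --> @jdom R] --> 0 by exact: small_Y.
have lim : 1 + p.1 * Y p.1 p.2 @[p --> @jdom R] --> 1 + (0 : R) by cvg_tac.
by rewrite addr0 in lim.
Qed.

(** [ln (1 + e * t)] contributes [t * h'] with [h' >= 1/2], the shift contributes [z] with
    [|z| <= 1], and [(t * h' + z) ^+ 2 >= (t * h') ^+ 2 / 2 - z ^+ 2 >= t ^+ 2 / 8 - 1]. The other
    factor [x / 8] is [x] times 1/2 for [1 + e * Y] and 1/4 for the phase. *)
Lemma kernE_ge : \forall p \near @jdom R, x / 64 * p.2 ^+ 2 - x / 8 <= kernE p.1 p.2.
Proof.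
have P1 : \forall s \near (0 : R), exists2 h, 1 / 4 <= h & phase q s = s ^+ 2 * h.
  by apply: peano_ge (peano_phase q01) _; lra.
have P2 : \forall s \near (0 : R), exists2 h, 1 / 2 <= h & ln (1 + s) = s ^+ 1 * h.
  by apply: peano_ge (@peano_ln1D R) _; lra.
have P3 : \forall s \near (0 : R), exists2 h, 0 <= h <= 2 & ln (1 + s) = s * h.
  have P3' : \forall s \near (0 : R), exists2 h, -2 <= h & - ln (1 + s) = s ^+ 1 * h.
    apply: (@peano_ge R 1 (fun s => - ln (1 + s)) (- 1) (1 / 2) (- (1 / 3))); last by lra.
    have [r [r0 hr]] := @peano_ln1D R.
    exists (fun s => - r s); split; first by rewrite -[X in _ --> X]oppr0; exact: cvg_opp.
    near=> s; have -> : ln (1 + s) = s ^+ 1 * (1 + - (1 / 2) * s + 1 / 3 * s ^+ 2 + s ^+ 2 * r s) by near: s.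
    ring.
  near=> s.
  have [h1 h1p E1] : exists2 h, 1 / 2 <= h & ln (1 + s) = s ^+ 1 * h by near: s.
  have [h2 h2p E2] : exists2 h, -2 <= h & - ln (1 + s) = s ^+ 1 * h by near: s.
  have [s0|s0] := eqVneq s 0.
    by exists 1; [lra|rewrite s0 addr0 ln1 mul0r].
  exists h1; last by rewrite E1 expr1.
  have : s * (h1 + h2) = 0 by move: E1 E2; rewrite !expr1; lra.
  by move/eqP; rewrite mulf_eq0 (negbTE s0)/= => /eqP; lra.
have Q1 : \forall p \near @jdom R, exists2 h, 1 / 4 <= h & phase q (p.1 * S p.1 p.2) = (p.1 * S p.1 p.2) ^+ 2 * h.
  exact: (small_S P1).
have Q2 : \forall p \near @jdom R, exists2 h, 1 / 2 <= h & ln (1 + p.1 * p.2) = (p.1 * p.2) ^+ 1 * h.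
  exact: (small_id P2).
have Q3 : \forall p \near @jdom R, exists2 h, 0 <= h <= 2 & ln (1 + p.1 * (p.1 * y p.1 p.2)) = p.1 * (p.1 * y p.1 p.2) * h.
  exact: (small_y P3).
have sy : \forall p \near @jdom R, `|p.1 * y p.1 p.2| < 1 / 2.
  have c1 := @cvg_jdom1 R; have cy := cvg_y.
  have lim : p.1 * y p.1 p.2 @[p --> @jdom R] --> 0 * (tilt q xi / (2 * x)) by cvg_tac.
  rewrite mul0r in lim; have h2 : 0 < 1 / 2 :> R by lra.
  move/cvgrPdist_lt : lim => /(_ _ h2); apply: filterS => p; by rewrite sub0r normrN.
have Yh : \forall p \near @jdom R, 1 / 2 < 1 + p.1 * Y p.1 p.2.
  by apply: (@cvgr_gt _ _ _ _ _ _ cvg_Y1); lra.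
near=> p.
have e0 : 0 < p.1 by near: p; exact: jdom_gt0.
rewrite /kernE.
have -> : logratio q xi x (p.1 ^+ 2) (obs p.1 p.2) = p.1 * S p.1 p.2 by near: p.
have [h hp ->] : exists2 h, 1 / 4 <= h & phase q (p.1 * S p.1 p.2) = (p.1 * S p.1 p.2) ^+ 2 * h by near: p.
rewrite conc_eq//.
have [h' hp' E1] : exists2 h, 1 / 2 <= h & ln (1 + p.1 * p.2) = (p.1 * p.2) ^+ 1 * h by near: p.
have [h3 /andP[hp3 hp3'] E3] : exists2 h, 0 <= h <= 2 & ln (1 + p.1 * (p.1 * y p.1 p.2)) = p.1 * (p.1 * y p.1 p.2) * h by near: p.
have ys : `|p.1 * y p.1 p.2| < 1 / 2 by near: p.
have Yp : 1 / 2 < 1 + p.1 * Y p.1 p.2 by near: p.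
have SE : S p.1 p.2 = - (p.2 * h' + p.1 * y p.1 p.2 * h3) / xi.
  by rewrite /S E1 E3; field; rewrite !gt_eqF.
have -> : xi ^+ 2 * x * (1 + p.1 * Y p.1 p.2) / p.1 ^+ 2 * ((p.1 * S p.1 p.2) ^+ 2 * h) =
  x * (1 + p.1 * Y p.1 p.2) * h * (p.2 * h' + p.1 * y p.1 p.2 * h3) ^+ 2.
  by rewrite SE; field; rewrite !gt_eqF.
set z := p.1 * y p.1 p.2 * h3.
have z1 : `|z| <= 1.
  rewrite normrM (ger0_norm hp3); apply: (@le_trans _ _ (1 / 2 * 2)); last by lra.
  by rewrite ler_pM// ltW.
have z2 : z ^+ 2 <= 1 by rewrite -real_normK ?num_real// expr_le1.
have s1 : p.2 ^+ 2 / 8 - 1 <= (p.2 * h' + z) ^+ 2.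
  have : (p.2 * h') ^+ 2 / 2 - z ^+ 2 <= (p.2 * h' + z) ^+ 2.
    rewrite -subr_ge0 (_ : _ - _ = (p.2 * h' + 2 * z) ^+ 2 / 2); last by field.
    by rewrite divr_ge0// sqr_ge0.
  have : p.2 ^+ 2 / 8 <= (p.2 * h') ^+ 2 / 2.
    rewrite exprMn (_ : p.2 ^+ 2 / 8 = p.2 ^+ 2 * (1 / 2) ^+ 2 / 2); last by field.
    by rewrite ler_wpM2r// ler_wpM2l ?sqr_ge0// lerXn2r// nnegrE; lra.
  lra.
have c1 : x / 8 <= x * (1 + p.1 * Y p.1 p.2) * h.
  rewrite -mulrA ler_wpM2l ?(ltW x0)//; nra.
have sq := sqr_ge0 (p.2 * h' + z).
apply: (@le_trans _ _ (x / 8 * (p.2 * h' + z) ^+ 2)); last by rewrite ler_wpM2r.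
apply: (@le_trans _ _ (x / 8 * (p.2 ^+ 2 / 8 - 1))); first by lra.
have x8 : 0 <= x / 8 by rewrite divr_ge0// ltW.
by rewrite ler_wpM2l.
Unshelve. all: by end_near. Qed.

Let cvg_conc : conc xi (p.1 ^+ 2) (obs p.1 p.2) @[p --> @jdom R] --> +oo.
Proof.
apply/cvgryPgt => A.
have c1 := @cvg_jdom1 R; have cY := cvg_Y1.
pose B := `|A| + 1.
have B0 : 0 < B by rewrite ltr_wpDl.
have lim : p.1 ^+ 2 * B - xi ^+ 2 * x * (1 + p.1 * Y p.1 p.2) @[p --> @jdom R] --> 0 ^+ 2 * B - xi ^+ 2 * x * 1.
  by cvg_tac.
have neg : \forall p \near @jdom R, p.1 ^+ 2 * B - xi ^+ 2 * x * (1 + p.1 * Y p.1 p.2) < 0.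
  apply: (@cvgr_lt _ _ _ _ _ _ lim); rewrite expr0n mul0r mulr1 sub0r oppr_lt0 mulr_gt0//.
  by rewrite exprn_gt0.
near=> p.
have e0 : 0 < p.1 by near: p; exact: jdom_gt0.
rewrite conc_eq//; apply: (@lt_trans _ _ B); first by rewrite (le_lt_trans (ler_norm A))// ltrDl.
rewrite ltr_pdivlMr ?exprn_gt0// mulrC -subr_lt0.
by near: p.
Unshelve. all: by end_near. Qed.

(** A limit along [jdom] gives at once the bound and the pointwise convergence asked of a
    remainder. *)
Lemma jet_quad (F : R -> R -> R) (l : R) : F p.1 p.2 @[p --> @jdom R] --> l ->
  jet (fun e t => 1 + e ^+ 2 * F e t) (fun=> 1) (fun=> 0) (fun=> l).
Proof.
move=> Fl; split; try exact: pbd_cst.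
have Fl0 : F p.1 p.2 - l @[p --> @jdom R] --> 0.
  by rewrite -[X in _ --> X](subrr l); cvg_tac.
exists (fun e t => F e t - l); split.
- exists 1, 0%N; split => //.
  move/cvgrPdist_le : Fl0 => /(_ 1 ltr01); apply: filterS => p.
  by rewrite sub0r normrN expr0 mulr1.
- move=> t; apply/cvgrPdist_lt => d d0; move/cvgrPdist_lt : Fl0 => /(_ d d0) h.
  exact: (jdom_at_right h t).
- by near=> p; ring.
Unshelve. all: by end_near. Qed.

(** As [1 / conc] is equivalent to [e ^+ 2 / (xi ^+ 2 * x)], an expansion to first order in
    [1 / conc] is one to second order in [e]. *)
Let jet_ratio (h : R -> R) (k : R) : first_order h k ->
  jet (fun e t => h (conc xi (e ^+ 2) (obs e t))) (fun=> 1) (fun=> 0) (fun=> k / (xi ^+ 2 * x)).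
Proof.
move=> hk; pose N e t := conc xi (e ^+ 2) (obs e t).
have cY := cvg_Y1.
have c1 : N p.1 p.2 * (h (N p.1 p.2) - 1) @[p --> @jdom R] --> k.
  exact: (@cvg_comp _ _ _ (fun p : R * R => N p.1 p.2) (fun a => a * (h a - 1)) _ _ _ cvg_conc hk).
have lim : N p.1 p.2 * (h (N p.1 p.2) - 1) * (1 + p.1 * Y p.1 p.2)^-1 * (xi ^+ 2 * x)^-1 @[p --> @jdom R] --> k * 1^-1 * (xi ^+ 2 * x)^-1.
  by cvg_tac; exact: oner_neq0.
rewrite invr1 mulr1 in lim.
apply: (jet_near _ (@jet_quad (fun e t => N e t * (h (N e t) - 1) * (1 + e * Y e t)^-1 * (xi ^+ 2 * x)^-1) _ lim)).
near=> p.
have e0 : 0 < p.1 by near: p; exact: jdom_gt0.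
have Y0 : 0 < 1 + p.1 * Y p.1 p.2 by near: p.
have : p.1 ^+ 2 * N p.1 p.2 = xi ^+ 2 * x * (1 + p.1 * Y p.1 p.2).
  by rewrite /N conc_eq//; field; rewrite gt_eqF.
rewrite -/(N p.1 p.2) !mulrA => ->.
by field; rewrite !gt_eqF.
Unshelve. all: by end_near. Qed.

Definition kernA e t := Num.sqrt (e ^+ 2 + obs e t) * normalizer_ratio q (conc xi (e ^+ 2) (obs e t)).

Lemma jet_kernA : jet kernA (fun=> Num.sqrt x) (fun t => Num.sqrt x * t / 2)
  (fun t => Num.sqrt x * (1 / (2 * x) - t ^+ 2 / 8 - (1 - q + q ^+ 2) / 12 / (xi ^+ 2 * x))).
Proof.
have [H [jH HE]] := jet_comp (@peano_sqrt1D R) small_Y jet_Y.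
apply: jet_near (jet_coef _ _ _ (jet_mul (jet_mul (jet_cst (Num.sqrt x)) jH) (jet_ratio (normalizer_first_order q01)))).
- near=> p.
  have Y0 : 0 < 1 + p.1 * Y p.1 p.2 by near: p.
  rewrite /kernA obsE sqrtrM ?(ltW x0)//.
  have -> : Num.sqrt (1 + p.1 * Y p.1 p.2) = (p.1 * Y p.1 p.2) ^+ 0 * H p.1 p.2 by near: p.
  by rewrite expr0 mul1r.
- by move=> t /=; ring.
- by move=> t /=; field.
- by move=> t /=; field; rewrite !gt_eqF.
Unshelve. all: by end_near. Qed.

Lemma jet_density (f : R -> R) (f0 f1 f2 : R) : peano 0 (fun s => f (x * (1 + s))) f0 f1 f2 ->
  jet (fun e t => f (obs e t)) (fun=> f0) (fun t => f1 * t) (fun t => f2 * t ^+ 2).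
Proof.
move=> fp; have [H [jH HE]] := jet_comp fp small_id (@jet_id R).
apply: jet_near (jet_coef _ _ _ jH).
- near=> p; rewrite /obs.
  have -> : f (x * (1 + p.1 * p.2)) = (p.1 * p.2) ^+ 0 * H p.1 p.2 by near: p.
  by rewrite expr0 mul1r.
- by [].
- by [].
- by move=> t /=; ring.
Unshelve. all: by end_near. Qed.

(** [e * x] is the Jacobian of [u = x * (1 + e * t)]; it cancels [(xi * x)^-1] and the factor
    [xi / e] of the square root of [conc]. *)
Lemma kern_rescaled : \forall p \near @jdom R,
  p.1 * x * kern q xi x (p.1 ^+ 2) (obs p.1 p.2) =
  (Num.sqrt (2 * pi))^-1 * (expR (- kernE p.1 p.2) * kernA p.1 p.2).
Proof.
have sh := shift_gt0_near.
near=> p.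
have e0 : 0 < p.1 by near: p; exact: jdom_gt0.
have Y0 : 0 < 1 + p.1 * Y p.1 p.2 by near: p.
have t0 : 0 < 1 + p.1 * p.2 by near: p.
have s0 : 0 < shift q xi (p.1 ^+ 2) (obs p.1 p.2) by near: p.
have o0 : 0 < obs p.1 p.2 by rewrite mulr_gt0.
have s2 := @sqrt2pi_gt0 R.
have eo : 0 < p.1 ^+ 2 + obs p.1 p.2 by rewrite addr_gt0// exprn_gt0.
rewrite /kern o0 s0/= -/(kernE p.1 p.2) normalizerE//; last first.
  by rewrite /conc mulr_gt0 ?exprn_gt0// divr_gt0// exprn_gt0.
have -> : Num.sqrt (conc xi (p.1 ^+ 2) (obs p.1 p.2)) = xi / p.1 * Num.sqrt (p.1 ^+ 2 + obs p.1 p.2).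
  rewrite /conc (_ : _ * _ = (xi / p.1) ^+ 2 * (p.1 ^+ 2 + obs p.1 p.2)); last by field; rewrite gt_eqF.
  by rewrite sqrtrM ?sqr_ge0// sqrtr_sqr ger0_norm// divr_ge0 ?ltW.
rewrite /kernA; field.
by rewrite !gt_eqF.
Unshelve. all: by end_near. Qed.

End local_expansion.

Section twice_differentiable.
Context {R : realType}.

(** [f] is unconstrained outside the positive half-line, where it is replaced by 0; near [s = 0] the
    argument is positive and nothing changes. *)
Lemma peano_C2_on_pos (f : R -> R) (x : R) : C2_on_pos f -> 0 < x ->
  peano 0 (fun s => if 0 < x * (1 + s) then f (x * (1 + s)) else 0)
    (f x) (x * f^`()%classic x) (x ^+ 2 * f^`(2)%classic x / 2).
Proof.
move=> fC2 x0.
have near_pos : \forall s \near (0 : R), 0 < x * (1 + s).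
  near=> s; rewrite mulr_gt0//; near: s; exact: near0_gtN1.
apply: (@peano_near _ 0 (fun s => f (x * (1 + s)))).
  by near=> s; rewrite ifT//; near: s.
have aff s : is_derive (s : R) (1 : R) (fun s => x * (1 + s)) x.
  by apply: der_eq; [der|rewrite /=; ring].
have comp (g : R -> R) s : derivable g (x * (1 + s)) 1 ->
    is_derive (s : R) (1 : R) (fun s => g (x * (1 + s))) (x * g^`()%classic (x * (1 + s))).
  move=> dg; have dg' : is_derive (x * (1 + s)) (1 : R) g (g^`()%classic (x * (1 + s))).
    by apply: DeriveDef => //; rewrite -derive1E.
  by rewrite (mulrC x); exact: (@is_derive1_comp _ g (fun s => x * (1 + s)) s _ _ dg' (aff s)).
have := @peano_C2 _ (fun s => f (x * (1 + s))) (fun s => x * f^`()%classic (x * (1 + s)))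
  (fun s => x ^+ 2 * f^`(2)%classic (x * (1 + s))).
rewrite !addr0 !mulr1; apply.
- near=> s; have pos : 0 < x * (1 + s) by near: s.
  by apply: comp; have [] := fC2 _ pos.
- near=> s; have pos : 0 < x * (1 + s) by near: s.
  have [_ df' _] := fC2 _ pos.
  have D := comp _ _ df'.
  have -> : x ^+ 2 * f^`(2)%classic (x * (1 + s)) =
    0 * f^`()%classic (x * (1 + s)) + x * (x * (f^`()^`())%classic (x * (1 + s))).
    by rewrite mul0r add0r mulrA.
  by apply: der_eq; [refine (der_mul (der_cst x s) D)|rewrite /=; ring].
- have [_ _ cf] := fC2 _ x0.
  have c1 : x * (1 + s) @[s --> (0 : R)] --> x.
    have i : s @[s --> (0 : R)] --> (0 : R) by exact: cvg_id.
    have lim : x * (1 + s) @[s --> (0 : R)] --> x * (1 + 0) by cvg_tac.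
    by rewrite addr0 mulr1 in lim.
  have c2 := @cvg_comp _ _ _ (fun s => x * (1 + s)) f^`(2)%classic _ _ _ c1 cf.
  apply: cvg_mul; [exact: cvg_cst|exact: c2].
Unshelve. all: by end_near. Qed.

End twice_differentiable.

(** * First and second moments of the kernel near [x] *)

Section local_moments.
Context {R : realType}.
Notation mu := (@lebesgue_measure R).
Implicit Types (q xi x h u e t d : R).

Lemma kern_ge0 q xi x h u : 0 < xi -> 0 < x -> 0 <= kern q xi x h u.
Proof.
move=> xi0 x0; rewrite /kern; case: ifPn => // _.
by rewrite mulr_ge0 ?expR_ge0// mulr_ge0 ?normalizer_ge0// invr_ge0 mulr_ge0// ltW.
Qed.

Lemma conc_ge xi h u : 0 < h -> 0 < u -> xi ^+ 2 <= conc xi h u.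
Proof.
move=> h0 u0; rewrite /conc ler_peMr ?sqr_ge0// ler_pdivlMr// mul1r.
by rewrite lerDl ltW.
Qed.

Lemma measurable_kern q xi x h : 0 <= q <= 1 -> 0 < xi -> 0 < h ->
  measurable_fun setT (kern q xi x h).
Proof.
move=> q01 xi0 h0.
(* For [u > 0] one has [conc >= xi ^+ 2], so the truncation is harmless and gives access to
   [measurable_normalizer]. *)
have -> : kern q xi x h = fun u => if (0 < u) && (0 < shift q xi h u) then
    (xi * x)^-1 * normalizer q (Num.max (conc xi h u) (xi ^+ 2))
    * expR (- (conc xi h u * phase q (logratio q xi x h u))) else 0.
  apply/funext => u; rewrite /kern; have [u0|u0] := ltP 0 u; last by rewrite !andFb.
  by rewrite (max_l (conc_ge xi h0 u0)).
have mc : measurable_fun setT (conc xi h) by rewrite /conc; eta_expand; meas.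
have ms : measurable_fun setT (shift q xi h) by rewrite /shift; eta_expand; meas.
have mphi : measurable_fun setT (phase q).
  by apply: continuous_measurable_fun; exact: continuous_phase.
have ml : measurable_fun setT (logratio q xi x h) by rewrite /logratio; eta_expand; meas.
have mn : measurable_fun setT (fun u => normalizer q (Num.max (conc xi h u) (xi ^+ 2))).
  apply: (measurableT_comp (measurable_normalizer q01 (exprn_gt0 2 xi0))); exact: mc.
have mp : measurable_fun setT (fun u => phase q (logratio q xi x h u)).
  by apply: measurableT_comp.
by apply: meas_if; eta_expand; meas.
Qed.

Lemma ge0_integral_rescaled (b c : R) (g F : R -> R) : 0 < c ->
  (forall u, 0 <= g u) -> measurable_fun setT g ->
  (forall t, c * g (b + c * t) = F t) -> mu.-integrable setT (EFin \o F) ->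
  (\int[mu]_u (g u)%:E = (\int[mu]_t F t)%:E)%E.
Proof.
move=> c0 g0 mg gF iF.
rewrite (@ge0_integral_affine _ b c)//; last exact/measurable_EFinP.
have mgc : measurable_fun setT (fun t => g (b + c * t)).
  by apply: (measurableT_comp mg); exact: measurable_affine.
have c0e : (0 <= c%:E)%E by rewrite lee_fin ltW.
rewrite -(@ge0_integralZl _ _ _ mu setT measurableT (fun t => (g (b + c * t))%:E))//; try exact/measurable_EFinP; try by move=> t _; rewrite lee_fin.
rewrite /Rintegral fineK//; last exact: integrable_fin_num.
by apply: eq_integral => t _; rewrite -EFinM gF.
Qed.

Variables (q xi x : R) (f : R -> R) (f0 f1 f2 : R).
Hypotheses (q01 : 0 <= q <= 1) (xi0 : 0 < xi) (x0 : 0 < x).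
Hypotheses (mf : measurable_fun setT f) (fge0 : forall u, 0 <= f u).
Hypothesis fp : peano 0 (fun s => f (x * (1 + s))) f0 f1 f2.

Definition window d u := `|u - x| < x * d.

Let near_eps (eps : nat -> R) d : (forall n, 0 < eps n) -> eps n @[n --> \oo] --> (0 : R) ->
  0 < d -> \forall n \near \oo, eps n < d.
Proof.
move=> e0 ce d0; move/cvgrPdist_lt : ce => /(_ _ d0).
by apply: filterS => n; rewrite sub0r normrN gtr0_norm.
Qed.

Let measurable_windowed d (g : R -> R) : measurable_fun setT g ->
  measurable_fun setT (fun u => if window d u then g u else 0 : R).
Proof. by move=> mg; rewrite /window; apply: meas_if; eta_expand; meas. Qed.

Let windowE d e t : window d (x + x * e * t) = (`|e * t| < d).
Proof.
rewrite /window addrC addKr.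
by rewrite -mulrA normrM (gtr0_norm x0) ltr_pM2l.
Qed.

Let measurable_rescaled (g : R -> R) c : measurable_fun setT g -> measurable_fun setT (fun t => g (x + c * t)).
Proof. by move=> mg; apply: (measurableT_comp mg); exact: measurable_affine. Qed.

Let obs_rescaled e t : x + x * e * t = x * (1 + e * t). Proof. ring. Qed.

Lemma kernel_first_moment : exists2 d0, 0 < d0 & forall d, 0 < d <= d0 ->
  forall eps : nat -> R, (forall n, 0 < eps n) -> eps n @[n --> \oo] --> (0 : R) ->
  exists2 m : nat -> R,
   \forall n \near \oo, (\int[mu]_u (if window d u then kern q xi x (eps n ^+ 2) u * f u else 0)%:E
      = (m n)%:E)%E &
   (m n - f0) / eps n ^+ 2 @[n --> \oo] --> f2 / x.
Proof.
have s2 := @sqrt2pi_gt0 R.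
have x2 : 0 < x / 2 by rewrite divr_gt0.
have x64 : 0 < x / 64 by rewrite divr_gt0.
have [||||| d1 d10 lap] := @laplace R _ _ _ _ _ _ _ _ _ _ x2 x64 (jet_kernE q01 xi0 x0)
  (jet_mul (jet_kernA q01 xi0 x0) (jet_density fp)) (kernE_ge q01 xi0 x0).
- by eta_expand; meas.
- by rewrite /kernE2; eta_expand; meas.
- by eta_expand; meas.
- by eta_expand; meas.
- by eta_expand; meas.
have [d2 /= d20 hk] := kern_rescaled q01 xi0 x0.
exists (Num.min d1 d2); first by rewrite lt_min d10.
move=> d /andP[d0]; rewrite le_min => /andP[dd1 dd2] eps eps0 ceps.
have {lap} := lap d _ eps eps0 ceps; rewrite d0 dd1 => /(_ isT).
set F := (fun n => _) => lap.
pose g n u := if window d u then kern q xi x (eps n ^+ 2) u * f u else 0.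
have mg n : measurable_fun setT (g n).
  apply: measurable_windowed.
  have := @measurable_kern q xi x _ q01 xi0 (exprn_gt0 2 (eps0 n)) => mk.
  exact: measurable_funM.
have g0 n u : 0 <= g n u.
  by rewrite /g; case: ifPn => // _; rewrite mulr_ge0 ?kern_ge0.
have e1 : \forall n \near \oo, eps n < d by exact: near_eps.
have gF n t : eps n < d -> x * eps n * g n (x + x * eps n * t) = (Num.sqrt (2 * pi))^-1 * F n t.
  move=> nd; rewrite /g /F windowE; case: ifPn => ht; last by rewrite !mulr0.
  have /= E := hk (eps n, t) (conj _ (lt_le_trans ht dd2)).
  rewrite obs_rescaled mulrA (mulrC x) E; first by rewrite !mulrA.
  by rewrite /= (eps0 n) (lt_le_trans nd).
have mF : \forall n \near \oo, measurable_fun setT (F n).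
  near=> n; have nd : eps n < d by near: n.
  have -> : F n = fun t => Num.sqrt (2 * pi) * (x * eps n * g n (x + x * eps n * t)).
    by apply/funext => t; rewrite gF// mulVKf// gt_eqF.
  have mr : measurable_fun setT (fun t => g n (x + x * eps n * t)) by exact: measurable_rescaled.
  by meas.
have [iF lim] := lap mF.
pose m n := (Num.sqrt (2 * pi))^-1 * \int[mu]_t F n t.
exists m.
  near=> n; have nd : eps n < d by near: n.
  have iFn : mu.-integrable setT (EFin \o F n) by near: n.
  rewrite (@ge0_integral_rescaled x (x * eps n) (g n) (fun t => (Num.sqrt (2 * pi))^-1 * F n t)) ?mulr_gt0//.
  - by rewrite RintegralZl.
  - by move=> t; rewrite gF.
  - exact: (integrableZl measurableT _ iFn).
have sx : Num.sqrt (pi / (x / 2)) = Num.sqrt (2 * pi) / Num.sqrt x.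
  rewrite (_ : pi / (x / 2) = (2 * pi) / x); last by field; rewrite gt_eqF.
  by rewrite sqrtrM ?mulr_ge0 ?pi_ge0// sqrtrV// ltW.
have sx0 : 0 < Num.sqrt x by rewrite sqrtr_gt0.
move: lim.
rewrite (@integral_poly_gauss _ _ (nth 0 [:: Num.sqrt x * f0]))//; last by move=> t /=; ring.
(* An odd polynomial, hence no contribution of order [eps]. *)
rewrite (@integral_poly_gauss _ _ (nth 0 [:: 0; Num.sqrt x * (f0 / 2 + f1 - tilt q xi / 2 * f0); 0;
  x * (1 - 2 * q) / (6 * xi) * Num.sqrt x * f0]))//; last first.
  by move=> t /=; field; rewrite gt_eqF.
(* The first-order coefficient of the exponent is [a * t + b * t ^+ 3]; [c4] is the quartic
   coefficient of [kernE2] and [z] the Stirling correction in [jet_kernA]. *)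
pose a := tilt q xi / 2; pose b := - (x * (1 - 2 * q) / (6 * xi)).
pose c4 := x * (- (1 / 24) + (1 - 2 * q) / (12 * xi) + (1 - 6 * q * (1 - q)) / (24 * xi ^+ 2)).
pose z := (1 - q + q ^+ 2) / 12 / (xi ^+ 2 * x).
rewrite (@integral_poly_gauss _ _ (nth 0 [:: Num.sqrt x * f0 * (1 / (2 * x) - z - tilt q xi ^+ 2 / (8 * x)); 0;
   Num.sqrt x * (f2 + f1 / 2 - f0 / 8 - a * (f1 + f0 / 2) + (a ^+ 2 / 2 - (1 / 2 - tilt q xi ^+ 2 / 4)) * f0); 0;
   Num.sqrt x * (- b * (f1 + f0 / 2) + (a * b - c4) * f0); 0;
   Num.sqrt x * (b ^+ 2 / 2 * f0)]))//; last first.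
  by move=> t /=; rewrite /kernE2 /a /b /c4 /z; field; rewrite !gt_eqF.
rewrite gmom0// sx /= => lim.
have lim2 := cvg_mul (cvg_cst ((Num.sqrt (2 * pi))^-1)) lim.
(* With [delta = (1 - 2 * q) / xi], the coefficient of [f1] is proportional to
   [1 - tilt + delta = 0]. In that of [f0], [tilt ^+ 2 - tilt - tilt * delta = 0], and the terms in
   [1 / xi ^+ 2], including [z], cancel among themselves. *)
rewrite [X in _ --> X](_ : _ = f2 / x) in lim2; last first.
  by rewrite /a /b /c4 /z /tilt; field; rewrite !gt_eqF.
have fo : Filter \oo by exact: _.
have {}lim2 := lim2 fo fo; apply: cvg_trans lim2; apply: near_eq_cvg; near=> n; have en := eps0 n.
by rewrite /m; field; rewrite !gt_eqF.
Unshelve. all: by end_near. Qed.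

(** Squaring doubles the exponent: the limiting weight is [gauss x] instead of [gauss (x / 2)], with
    prefactor [1 / (2 * pi * x * eps)]. The limit is [sqrt (pi / x) * x * f0 / (2 * pi * x)]; only
    the leading term of [laplace] matters. *)
Lemma kernel_second_moment : exists2 d0, 0 < d0 & forall d, 0 < d <= d0 ->
  forall eps : nat -> R, (forall n, 0 < eps n) -> eps n @[n --> \oo] --> (0 : R) ->
  exists2 v : nat -> R,
   \forall n \near \oo, (\int[mu]_u (if window d u then kern q xi x (eps n ^+ 2) u ^+ 2 * f u else 0)%:E
      = (v n)%:E)%E &
   eps n * v n @[n --> \oo] --> f0 / (2 * Num.sqrt pi * Num.sqrt x).
Proof.
have s2 := @sqrt2pi_gt0 R.
have sx0 : 0 < Num.sqrt x by rewrite sqrtr_gt0.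
have x2 : 0 < x by [].
have x64 : 0 < x / 32 by rewrite divr_gt0.
have jE : jet (fun e t => 2 * kernE q xi x e t) (fun t => x * t ^+ 2)
    (fun t => 2 * (tilt q xi / 2 * t - x * (1 - 2 * q) / (6 * xi) * t ^+ 3)) (fun t => 2 * kernE2 q xi x t).
  by apply: jet_coef (jet_mul (jet_cst 2) (jet_kernE q01 xi0 x0)) => t /=; field; rewrite ?gt_eqF.
have jA := jet_kernA q01 xi0 x0.
have Ege : \forall p \near @jdom R, x / 32 * p.2 ^+ 2 - x / 4 <= 2 * kernE q xi x p.1 p.2.
  by have := kernE_ge q01 xi0 x0; apply: filterS => p; lra.
have [||||| d1 d10 lap] := @laplace R _ _ _ _ _ _ _ _ _ _ x2 x64 jE
  (jet_mul (jet_mul jA jA) (jet_density fp)) Ege.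
- by eta_expand; meas.
- by rewrite /kernE2; eta_expand; meas.
- by eta_expand; meas.
- by eta_expand; meas.
- by eta_expand; meas.
have [d2 /= d20 hk] := kern_rescaled q01 xi0 x0.
exists (Num.min d1 d2); first by rewrite lt_min d10.
move=> d /andP[d0]; rewrite le_min => /andP[dd1 dd2] eps eps0 ceps.
have {lap} := lap d _ eps eps0 ceps; rewrite d0 dd1 => /(_ isT).
set F := (fun n => _) => lap.
pose g n u := if window d u then kern q xi x (eps n ^+ 2) u ^+ 2 * f u else 0.
have mg n : measurable_fun setT (g n).
  apply: measurable_windowed.
  have mk := @measurable_kern q xi x _ q01 xi0 (exprn_gt0 2 (eps0 n)).
  by meas.
have g0 n u : 0 <= g n u.
  by rewrite /g; case: ifPn => // _; rewrite mulr_ge0 ?sqr_ge0.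
have e1 : \forall n \near \oo, eps n < d by exact: near_eps.
pose c n := (x * eps n * (2 * pi))^-1.
have c0 n : 0 < c n by rewrite invr_gt0 !mulr_gt0 ?pi_gt0.
have gF n t : eps n < d -> x * eps n * g n (x + x * eps n * t) = c n * F n t.
  move=> nd; rewrite /g /F windowE; case: ifPn => ht; last by rewrite !mulr0.
  have /= := hk (eps n, t) (conj _ (lt_le_trans ht dd2)).
  rewrite (eps0 n) (lt_le_trans nd dd2) => /(_ isT) E.
  rewrite obs_rescaled.
  have -> : kern q xi x (eps n ^+ 2) (x * (1 + eps n * t)) =
     (Num.sqrt (2 * pi))^-1 * (expR (- kernE q xi x (eps n) t) * kernA q xi x (eps n) t) / (eps n * x).
    by rewrite -E; field; rewrite !gt_eqF ?eps0.
  have -> : expR (- (2 * kernE q xi x (eps n) t)) = expR (- kernE q xi x (eps n) t) ^+ 2.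
    by rewrite expr2 -expRD; congr expR; ring.
  have s2E : Num.sqrt (2 * pi) ^+ 2 = 2 * pi :> R by rewrite sqr_sqrtr ?mulr_ge0 ?pi_ge0.
  rewrite /c -[in RHS]s2E; move: s2; set r := Num.sqrt (2 * pi) => r0.
  by field; rewrite !gt_eqF ?eps0.
have mF : \forall n \near \oo, measurable_fun setT (F n).
  near=> n; have nd : eps n < d by near: n.
  have -> : F n = fun t => (c n)^-1 * (x * eps n * g n (x + x * eps n * t)).
    by apply/funext => t; rewrite gF// mulKf// gt_eqF.
  have mr : measurable_fun setT (fun t => g n (x + x * eps n * t)) by exact: measurable_rescaled.
  by meas.
have [iF lim] := lap mF.
exists (fun n => c n * \int[mu]_t F n t).
  near=> n; have nd : eps n < d by near: n.
  have iFn : mu.-integrable setT (EFin \o F n) by near: n.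
  rewrite (@ge0_integral_rescaled x (x * eps n) (g n) (fun t => c n * F n t)) ?mulr_gt0//.
  - by rewrite RintegralZl.
  - by move=> t; rewrite gF.
  - exact: (integrableZl measurableT _ iFn).
move: lim; rewrite (@integral_poly_gauss _ _ (nth 0 [:: x * f0]))//; last first.
  by move=> t /=; rewrite -expr2 sqr_sqrtr ?ltW//; ring.
rewrite gmom0//=; set I1 := \int[mu]_t _; set I2 := \int[mu]_t _ => lim.
have sx : Num.sqrt (pi / x) = Num.sqrt pi / Num.sqrt x.
  by rewrite sqrtrM ?pi_ge0// sqrtrV// ltW.
(* The normalised remainder of [laplace]; it converges, so [eps ^+ 2 * J] vanishes in the limit and
   the leading term remains. *)
pose J n := (\int[mu]_t F n t -
   Num.sqrt (pi / x) * (x * f0 + 0 / (2 * x) + 0 * 3 / (4 * x ^+ 2) + 0 * 15 / (8 * x ^+ 3)) -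
   eps n * I1) / eps n ^+ 2.
have {}lim : J n @[n --> \oo] --> I2 by exact: lim.
have spi : 0 < Num.sqrt (pi : R) by rewrite sqrtr_gt0 pi_gt0.
have lim2 : (x * (2 * pi))^-1 * (eps n ^+ 2 * J n + Num.sqrt (pi / x) * (x * f0) + eps n * I1) @[n --> \oo] -->
  (x * (2 * pi))^-1 * (0 ^+ 2 * I2 + Num.sqrt (pi / x) * (x * f0) + 0 * I1) by cvg_tac.
rewrite [X in _ --> X](_ : _ = f0 / (2 * Num.sqrt pi * Num.sqrt x)) in lim2; last first.
  rewrite expr0n !mul0r add0r addr0 sx.
  have s2E : Num.sqrt pi ^+ 2 = pi :> R by rewrite sqr_sqrtr ?pi_ge0.
  have sxE : Num.sqrt x ^+ 2 = x by rewrite sqr_sqrtr ?ltW.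
  move: spi s2E sx0 sxE; set r := Num.sqrt pi; set p := Num.sqrt x => r0 <- p0 <-.
  by field; rewrite !gt_eqF.
apply: cvg_trans lim2; apply: near_eq_cvg; near=> n; have en := eps0 n.
by rewrite /c /J; move: (@pi_gt0 R); generalize (pi : R) => p p0; field; rewrite !gt_eqF.
Unshelve. all: by end_near. Qed.

End local_moments.

(** * Bounds on the kernel away from [x] *)

Section tail_bounds.
Context {R : realType}.
Implicit Types (q xi x h u d a y z : R).

Lemma sqrt1D_le_expR y : 0 <= y -> Num.sqrt (1 + y) <= expR (y / 2).
Proof.
move=> y0; have -> : expR (y / 2) = Num.sqrt (expR (y / 2) ^+ 2).
  by rewrite sqrtr_sqr ger0_norm// expR_ge0.
rewrite ler_sqrt ?exprn_ge0 ?expR_ge0// expr2 -expRD (_ : y / 2 + y / 2 = y).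
  exact: expR_ge1Dx.
by field.
Qed.

Lemma shift_le q xi h u : 0 < h -> 0 < u -> shift q xi h u <= 1 + `|tilt q xi| / 2.
Proof.
move=> h0 u0; rewrite /shift lerD2l.
have f1 : h / (h + u) <= 1 by rewrite ler_pdivrMr ?addr_gt0// mul1r lerDl ltW.
have f0 : 0 <= h / (h + u) by rewrite divr_ge0 ?addr_ge0 ?ltW.
have := ler_norm (tilt q xi); have := normr_ge0 (tilt q xi); nra.
Qed.

Lemma shift_sub1_le q xi h u v : 0 < h -> 0 < v -> v <= u ->
  `|shift q xi h u - 1| <= `|tilt q xi| * h / v.
Proof.
move=> h0 v0 vu; have u0 := lt_le_trans v0 vu.
rewrite /shift addrAC subrr add0r (normrM (_ / _)) (normrM (tilt q xi)).
have hv : 0 <= h / v by rewrite divr_ge0 ?ltW.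
have hu : `|h / (h + u)| <= h / v.
  rewrite ger0_norm ?divr_ge0 ?addr_ge0 ?(ltW h0) ?(ltW u0)// ler_pM2l// lef_pV2 ?posrE ?addr_gt0//.
  by rewrite (le_trans vu)// lerDr ltW.
have t2 : `|tilt q xi| * `|2^-1| <= `|tilt q xi|.
  by rewrite ler_piMr// ger0_norm ?invr_ge0// invf_le1 ?ler1n.
by rewrite -[leRHS]mulrA ler_pM ?mulr_ge0.
Qed.

(** Half of the exponent absorbs the square root, the other half yields the power [N ^- 2]. *)
Lemma sqrt_expRN_le (c N : R) : 0 < c -> 0 < N ->
  Num.sqrt N * expR (- (N * c)) <= 8 / (Num.sqrt c * c ^+ 2) / N ^+ 2.
Proof.
move=> c0 N0; have cN : 0 < N * c by rewrite mulr_gt0.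
have sc : 0 < Num.sqrt c by rewrite sqrtr_gt0.
have h1 : Num.sqrt N * Num.sqrt c <= expR (N * c / 2).
  rewrite -sqrtrM ?(ltW N0)//; apply: le_trans (sqrt1D_le_expR (ltW cN)).
  by rewrite ler_sqrt ?lerDr// addr_ge0// ltW.
have cN2 : 0 < N * c / 2 by rewrite divr_gt0.
have h2 := expRN_le_inv2 cN2.
have -> : - (N * c) = - (N * c / 2) + - (N * c / 2) by field.
rewrite expRD mulrA.
have h3 : Num.sqrt N * expR (- (N * c / 2)) <= (Num.sqrt c)^-1.
  by rewrite expRN ler_pdivrMr ?expR_gt0// ler_pdivlMl// mulrC.
have -> : 8 / (Num.sqrt c * c ^+ 2) / N ^+ 2 = (Num.sqrt c)^-1 * (2 / (N * c / 2) ^+ 2).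
  by field; rewrite !gt_eqF.
by rewrite ler_pM ?mulr_ge0 ?sqrtr_ge0 ?expR_ge0.
Qed.

Variables (q xi x d : R).
Hypotheses (q01 : 0 <= q <= 1) (xi0 : 0 < xi) (x0 : 0 < x) (d01 : 0 < d <= 1).

Let conc_gt0 h u : 0 < h -> 0 < u -> 0 < conc xi h u.
Proof. by move=> h0 u0; apply: lt_le_trans (conc_ge xi h0 u0); rewrite exprn_gt0. Qed.

Lemma kern_le_sqrt : exists2 L, 0 < L & forall h u, 0 < h -> 0 < u -> 0 < shift q xi h u ->
  kern q xi x h u <= L * (Num.sqrt (conc xi h u) *
    expR (- (conc xi h u * phase q (logratio q xi x h u)))).
Proof.
have [L L0 hL] := normalizer_bound q01 (exprn_gt0 2 xi0).
exists ((xi * x)^-1 * L); first by rewrite mulr_gt0// invr_gt0 mulr_gt0.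
move=> h u h0 u0 s0; rewrite /kern u0 s0/=.
rewrite [leRHS]mulrA ler_pM2r ?expR_gt0// -[leRHS]mulrA ler_pM2l ?invr_gt0 ?mulr_gt0//.
by apply: hL; exact: conc_ge.
Qed.

(* Away from 0 and from [x], the phase is bounded below. *)
Lemma kern_tail_far u1 : 0 < u1 -> exists h0 C, [/\ 0 < h0, 0 < C & forall h u,
  0 < h <= h0 -> u1 <= u -> ~~ window x d u -> kern q xi x h u <= C * h ^+ 2].
Proof.
move=> u10; have /andP[d0 d1] := d01.
have ld : 0 < ln (1 + d / 2) / xi by rewrite divr_gt0// ln_gt0//; lra.
have [c c0 hc] := phase_ge q01 ld.
have [L L0 hL] := kern_le_sqrt.
pose T := `|tilt q xi| + 1.
have T0 : 0 < T by rewrite ltr_wpDl.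
pose K := 8 / (Num.sqrt c * c ^+ 2).
have K0 : 0 < K by rewrite divr_gt0// mulr_gt0 ?sqrtr_gt0 ?exprn_gt0.
(* This [h0] keeps [shift] within [d / 4] of 1. As [d <= 1], a relative deviation of [u] from [x] by
   at least [d] then still moves [u * shift / x] above [1 + d / 2] or below its inverse. *)
exists (d * u1 / (4 * T)), (L * (K / (xi ^+ 2 * u1) ^+ 2)); split.
- by rewrite divr_gt0 ?mulr_gt0.
- by rewrite mulr_gt0// divr_gt0// exprn_gt0// mulr_gt0 ?exprn_gt0.
move=> h u /andP[h0 hh] u1u; rewrite /window -leNgt => far.
have u0 := lt_le_trans u10 u1u.
have /ler_normlP[sh1 sh2] : `|shift q xi h u - 1| <= d / 4.
  apply: (le_trans (shift_sub1_le q xi h0 u10 u1u)).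
  rewrite ler_pdivrMr//; apply: (@le_trans _ _ (T * h)); first by rewrite ler_wpM2r ?(ltW h0)// /T; lra.
  by move: hh; rewrite ler_pdivlMr ?mulr_gt0//; lra.
have s0 : 0 < shift q xi h u by lra.
have w0 : 0 < u * shift q xi h u by rewrite mulr_gt0.
apply: (le_trans (hL _ _ h0 u0 s0)); rewrite -[leRHS]mulrA ler_pM2l//.
have sfar : ln (1 + d / 2) / xi <= `|logratio q xi x h u|.
  rewrite /logratio normrM (ger0_norm (_ : 0 <= xi^-1)) ?invr_ge0 ?(ltW xi0)// ler_pM2r ?invr_gt0//.
  move: far; rewrite ler_normr => /orP[far|far].
    rewrite ler_normr; apply/orP; right; rewrite -lnV ?posrE ?divr_gt0// invf_div.
    rewrite ler_ln ?posrE ?divr_gt0//; last by lra.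
    rewrite ler_pdivlMr//.
    have a3 : x * (1 + d) * (1 - d / 4) <= u * shift q xi h u.
      by apply: ler_pM; [rewrite mulr_ge0 ?addr_ge0 ?ltW|lra|lra|lra].
    apply: le_trans a3; have : 0 <= x * (d * (1 - d)) by rewrite !mulr_ge0 ?subr_ge0// ltW.
    by lra.
  rewrite ler_normr; apply/orP; left.
  rewrite ler_ln ?posrE ?divr_gt0//; last by lra.
  rewrite ler_pdivlMr//.
  have a3 : u * shift q xi h u <= x * (1 - d) * (1 + d / 4).
    by apply: ler_pM; [exact: ltW|exact: ltW|lra|lra].
  apply: (@le_trans _ _ ((1 + d / 2) * (x * (1 - d) * (1 + d / 4)))).
    by rewrite ler_pM2l//; lra.
  have -> : (1 + d / 2) * (x * (1 - d) * (1 + d / 4)) = x * ((1 + d / 2) * (1 - d) * (1 + d / 4)) by ring.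
  by rewrite ler_piMr ?(ltW x0)//; nra.
have pc := hc _ sfar; have N0 := conc_gt0 h0 u0.
apply: (@le_trans _ _ (Num.sqrt (conc xi h u) * expR (- (conc xi h u * c)))).
  by rewrite ler_wpM2l ?sqrtr_ge0// ler_expR lerN2 ler_pM2l.
apply: (le_trans (sqrt_expRN_le c0 N0)); rewrite -/K -[leRHS]mulrA ler_pM2l//.
have Nge : xi ^+ 2 * u1 / h <= conc xi h u.
  rewrite /conc -mulrA ler_pM2l ?exprn_gt0// ler_pM2r ?invr_gt0//.
  by rewrite (le_trans u1u)// lerDr ltW.
have -> : ((xi ^+ 2 * u1) ^+ 2)^-1 * h ^+ 2 = ((xi ^+ 2 * u1 / h) ^+ 2)^-1.
  by field; rewrite !gt_eqF.
have p0 : 0 < xi ^+ 2 * u1 / h by rewrite divr_gt0// mulr_gt0// exprn_gt0.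
by rewrite lef_pV2 ?posrE ?exprn_gt0// lerXn2r// nnegrE ltW.
Qed.

(* As [u -> 0] the phase is at least [M * s - B] with [M = q^-1] (any [M] when
   [q = 0]), whence a factor [u `^ (xi * M)]; a moment of order [- a] then gains
   a power [h `^ (xi * M + a)]. *)
Lemma kern_tail_near a : 0 < a -> (q != 0 -> 1 - a < xi / q) ->
  exists u1 r C, [/\ 0 < u1, 1 < r, 0 < C & forall h u, 0 < h -> 0 < u -> u <= u1 ->
    kern q xi x h u <= C * (h `^ r * u `^ (- a)) /\ kern q xi x h u <= C].
Proof.
move=> a0 hq.
(* If [q = 0] every slope is available, and [xi^-1] gives the exponent [1 + a > 1]; otherwise the
   slope is forced and the hypothesis on [a] is what makes the exponent exceed 1. *)
have [M M0 [hM rM]] : exists2 M, 0 < M & (q != 0 -> M = q^-1) /\ 1 < xi * M + a.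
  have [qe|qn0] := eqVneq q 0.
    exists (xi^-1); first by rewrite invr_gt0.
    by split=> //; rewrite divff ?gt_eqF// ltrDl.
  exists q^-1; first by rewrite invr_gt0 lt_neqAle eq_sym qn0/=; case/andP: q01.
  by split=> //; have := hq qn0; lra.
have [B hB] := phase_slope q01 M0 hM.
have [L L0 hL] := kern_le_sqrt.
pose rho := xi * M; have rho0 : 0 < rho by rewrite mulr_gt0.
pose C1 := 1 + `|tilt q xi| / 2.
have C10 : 0 < C1 by rewrite ltr_pwDl// divr_ge0.
pose b := B * xi ^+ 2.
(* Chosen so that [rho * t + b <= -1] for [u <= u1], where [t = ln (u / (x / C1))]: multiplied by
   the factor [1 + u / h] of [conc], this yields the decay [- u / h]. *)
pose u1 := x / C1 * expR (- ((1 + `|b|) / rho)).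
have xC : 0 < x / C1 by rewrite divr_gt0.
have u10 : 0 < u1 by rewrite mulr_gt0 ?expR_gt0.
pose r := rho + a; pose K := L * xi * expR b.
have r0 : 0 < r by rewrite addr_gt0.
have K0 : 0 < K by rewrite mulr_gt0 ?expR_gt0// mulr_gt0.
have lu1 : rho * ln (u1 / (x / C1)) = - (1 + `|b|).
  rewrite /u1 [_ * expR _]mulrC mulfK ?gt_eqF// expRK; field.
  by rewrite gt_eqF.
have main h u : 0 < h -> 0 < u -> u <= u1 ->
    kern q xi x h u <= K * expR (rho * ln (u / (x / C1)) - (u / h) / 2).
  move=> h0 u0 uu1.
  have [s0|s0] := ltP 0 (shift q xi h u); last first.
    by rewrite /kern u0 [0 < shift _ _ _ _]ltNge s0/= mulr_ge0 ?expR_ge0// ltW.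
  have y0 : 0 < u / h by rewrite divr_gt0.
  have N0 := conc_gt0 h0 u0.
  have NE : conc xi h u = xi ^+ 2 * (1 + u / h) by rewrite /conc; field; rewrite gt_eqF.
  apply: (le_trans (hL _ _ h0 u0 s0)); rewrite /K -[L * xi * _]mulrA -[leRHS]mulrA ler_pM2l//.
  pose t := ln (u / (x / C1)); rewrite -/t.
  have tb : rho * t + b <= -1.
    have : rho * t <= - (1 + `|b|).
      by rewrite -lu1 ler_pM2l// ler_ln ?posrE ?divr_gt0// ler_pM2r ?invr_gt0.
    by have := ler_norm b; lra.
  have ls : - t / xi <= logratio q xi x h u.
    rewrite /logratio ler_pM2r ?invr_gt0// /t -lnV ?posrE ?divr_gt0//.
    have us0 : 0 < u * shift q xi h u by rewrite mulr_gt0.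
    rewrite ler_ln ?posrE ?invr_gt0 ?divr_gt0// invf_div ler_pdivlMr//.
    have -> : x / C1 / u * (u * shift q xi h u) = x * (shift q xi h u / C1) by field; rewrite !gt_eqF.
    by rewrite ler_piMr ?(ltW x0)// ler_pdivrMr// mul1r shift_le.
  have pl : - (conc xi h u * phase q (logratio q xi x h u)) <= (rho * t + b) - u / h.
    have p1 : - (rho * t + b) / xi ^+ 2 <= phase q (logratio q xi x h u).
      apply: le_trans (hB _).
      have -> : - (rho * t + b) / xi ^+ 2 = M * (- t / xi) - B by rewrite /rho /b; field; rewrite gt_eqF.
      by rewrite lerD2r ler_pM2l.
    have p2 : conc xi h u * (- (rho * t + b) / xi ^+ 2) <= conc xi h u * phase q (logratio q xi x h u).
      by rewrite ler_pM2l.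
    have : conc xi h u * (- (rho * t + b) / xi ^+ 2) = (1 + u / h) * - (rho * t + b).
      by rewrite NE; field; rewrite !gt_eqF.
    nra.
  have sN : Num.sqrt (conc xi h u) <= xi * expR (u / h / 2).
    rewrite NE sqrtrM ?sqr_ge0// sqrtr_sqr gtr0_norm// ler_pM2l// sqrt1D_le_expR//.
    exact: ltW.
  apply: (@le_trans _ _ (xi * expR (u / h / 2) * expR (rho * t + b - u / h))).
    by apply: ler_pM; [exact: sqrtr_ge0|exact: expR_ge0|exact: sN|rewrite ler_expR].
  rewrite -mulrA -[leRHS]mulrA ler_pM2l// -!expRD ler_expR.
  by lra.
(* From [ln z <= z - 1] at [z = u / h / (2 * r)] one gets [r * ln (u / h) - (u / h) / 2 <= r * (ln
   (2 * r) - 1)], which trades the exponential decay for the power [r] of [h / u]. *)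
pose C2 := K * expR (- (rho * ln (x / C1)) + r * (ln (2 * r) - 1)).
have C20 : 0 < C2 by rewrite mulr_gt0 ?expR_gt0.
exists u1, r, (Num.max K C2); split => //; first by rewrite lt_max K0.
move=> h u h0 u0 uu1.
have y0 : 0 < u / h by rewrite divr_gt0.
have km := main _ _ h0 u0 uu1.
have lE : ln (u / (x / C1)) = ln u - ln (x / C1) by rewrite ln_div ?posrE.
have luh : ln (u / h) = ln u - ln h by rewrite ln_div ?posrE.
split.
  apply: (@le_trans _ _ (C2 * (h `^ r * u `^ (- a)))); last first.
    by rewrite ler_wpM2r ?mulr_ge0 ?powR_ge0// le_max lexx orbT.
  rewrite /powR !gt_eqF//; apply: (le_trans km).
  rewrite /C2 -[leRHS]mulrA ler_pM2l// -!expRD ler_expR lE.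
  have := @ln_le_subr1 _ (u / h / (2 * r)); rewrite divr_gt0 ?mulr_gt0 ?invr_gt0// => /(_ isT).
  rewrite ln_div ?posrE ?mulr_gt0 ?invr_gt0// luh => h1.
  have : r * (ln u - ln h - ln (2 * r)) <= r * (u / h / (2 * r) - 1) by rewrite ler_pM2l.
  have -> : r * (u / h / (2 * r) - 1) = u / h / 2 - r by field; rewrite !gt_eqF.
  by rewrite /r; lra.
apply: (@le_trans _ _ K); last by rewrite le_max lexx.
apply: (le_trans km); rewrite ler_piMr ?(ltW K0)// -[leRHS](@expR0 R) ler_expR.
have : rho * ln (u / (x / C1)) <= rho * ln (u1 / (x / C1)).
  by rewrite ler_pM2l// ler_ln ?posrE ?divr_gt0// ler_pM2r ?invr_gt0.
rewrite lu1; have := normr_ge0 b; lra.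
Qed.

(** The second bound, uniform in [h] and [u], serves the second moment: it turns a bound on the
    kernel into one on its square. *)
Lemma kern_tail a : 0 < a -> (q != 0 -> 1 - a < xi / q) ->
  exists h0 r C, [/\ 0 < h0, 1 < r, 0 < C & forall h u,
    0 < h <= h0 -> 0 < u -> ~~ window x d u ->
    kern q xi x h u <= C * (h `^ r * u `^ (- a) + h ^+ 2) /\ kern q xi x h u <= C].
Proof.
move=> a0 hq; have [u1 [r [C [u10 r1 C0 near]]]] := kern_tail_near a0 hq.
have [h0 [D [h00 D0 far]]] := kern_tail_far u10.
exists (Num.min h0 1), r, (C + D); split; [by rewrite lt_min h00 ltr01|by []|exact: addr_gt0|].
move=> h u /andP[h_gt0]; rewrite le_min => /andP[hh0 h1] u0 wd.
have p0 : 0 <= h `^ r * u `^ (- a) by rewrite mulr_ge0 ?powR_ge0.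
have h20 : 0 <= h ^+ 2 by rewrite sqr_ge0.
have [uu1|/ltW u1u] := leP u u1.
  have [k1 k2] := near _ _ h_gt0 u0 uu1; split; last by rewrite (le_trans k2)// lerDl ltW.
  apply: (le_trans k1); rewrite mulrDl mulrDr -[leLHS]addr0 -addrA lerD2l.
  by rewrite addr_ge0// mulr_ge0// ?addr_ge0// ltW.
have k1 : kern q xi x h u <= D * h ^+ 2 by apply: far => //; rewrite h_gt0.
have h2 : h ^+ 2 <= 1 by rewrite expr_le1// ltW.
split; apply: (le_trans k1).
  rewrite mulrDl !mulrDr addrC -[leLHS]addr0 -!addrA.
  have := mulr_ge0 (ltW C0) p0; have := mulr_ge0 (ltW C0) h20; have := mulr_ge0 (ltW D0) p0.
  lra.
by apply: (@le_trans _ _ D); [rewrite ler_piMr// ltW|rewrite lerDr ltW].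
Qed.

End tail_bounds.

(** * The estimator *)

Section change_of_density.
Context {d : measure_display} {T : measurableType d} {R : realType}.
Local Open Scope ereal_scope.
Import HBNNSimple.

(** True for indicators by hypothesis, hence for the simple approximations [h n], and in the limit
    by monotone convergence on both sides. *)
Lemma ge0_integral_density (mu nu : {measure set T -> \bar R}) (f : T -> R) (g : T -> R) :
  measurable_fun setT f -> (forall t, (0 <= f t)%R) ->
  (forall A, measurable A -> nu A = \int[mu]_(t in A) (f t)%:E) ->
  measurable_fun setT g -> (forall t, (0 <= g t)%R) ->
  \int[nu]_t (g t)%:E = \int[mu]_t (g t * f t)%:E.
Proof.
move=> mf f0 fE mg g0.
have mgE : measurable_fun setT (EFin \o g) by exact/measurable_EFinP.
have gE0 t : 0 <= (EFin \o g) t by rewrite lee_fin.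
pose h := nnsfun_approx measurableT mgE.
have hg t : (h n t)%:E @[n --> \oo] --> (g t)%:E by exact: (@cvg_nnsfun_approx _ _ _ _ measurableT _ mgE).
transitivity (lim (\int[nu]_t (h n t)%:E @[n --> \oo])).
  rewrite -monotone_convergence//=.
  - by apply: eq_integral => t _; apply/esym/cvg_lim => //; exact: hg.
  - by move=> n; exact/measurable_EFinP/measurable_funTS.
  - by move=> n t _; rewrite lee_fin.
  - by move=> t _ a b ab; rewrite lee_fin; exact/lefP/nd_nnsfun_approx.
transitivity (lim (\int[mu]_t (h n t * f t)%:E @[n --> \oo])); last first.
  rewrite -monotone_convergence//=.
  - apply: eq_integral => t _; apply/cvg_lim => //.
    have -> : (fun n => (h n t * f t)%:E) = (fun n => (h n t)%:E * (f t)%:E) by apply/funext => n; rewrite EFinM.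
    by rewrite EFinM; apply: cvgeZr => //; exact: hg.
  - by move=> n; apply/measurable_EFinP; exact: measurable_funM.
  - by move=> n t _; rewrite lee_fin mulr_ge0.
  - by move=> t _ a b ab; rewrite lee_fin ler_wpM2r//; exact/lefP/nd_nnsfun_approx.
apply: congr_lim; apply/funext => n.
rewrite integralT_nnsfun sintegralE.
have hE t : (h n t * f t)%:E =
    \sum_(r \in range (h n)) ((r * \1_(h n @^-1` [set r]) t)%:E * (f t)%:E).
  rewrite -ge0_mule_fsuml => [|r]; last exact: nnfun_muleindic_ge0.
  by rewrite fsumEFin// -(fimfunE _ t) EFinM.
under [RHS]eq_integral do rewrite hE.
rewrite ge0_integral_fsum//; last 2 first.
- move=> r; apply: emeasurable_funM; last exact/measurable_EFinP.
  by apply/measurable_EFinP; exact: measurable_funM.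
- by move=> r t _; rewrite mule_ge0 ?lee_fin//; exact: nnfun_muleindic_ge0.
apply: eq_fsbigr => r rhn.
have r0 : (0 <= r)%R by move: rhn; rewrite inE => -[t _ <-].
under eq_integral do rewrite EFinM -muleA.
rewrite ge0_integralZl//.
- rewrite fE//; congr (_ * _).
  rewrite [LHS]integral_mkcond; apply: eq_integral => t _.
  by rewrite muleC epatch_indic.
- by apply: emeasurable_funM; exact/measurable_EFinP.
- by move=> t _; rewrite mule_ge0 ?lee_fin.
Qed.

End change_of_density.

(** * Independence and product measures *)

Section independence.
Context {d : measure_display} {T : measurableType d} {R : realType}.
Variable P : probability T R.
Local Open Scope ereal_scope.

Lemma mutually_independent_pair (X : nat -> {RV P >-> R}) i j (A B : set R) :
  mutually_independent X -> i != j -> measurable A -> measurable B ->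
  P (X i @^-1` A `&` X j @^-1` B) = P (X i @^-1` A) * P (X j @^-1` B).
Proof.
move=> indX ij mA mB.
have := indX (i |` [fset j])%fset (fun k => if k == i then A else B).
rewrite big_fsetU1 ?inE//= big_seq_fset1 eqxx (eq_sym j) (negbTE ij) => <-; last by move=> k; case: ifP.
congr (P _); apply/seteqP; split => w /=.
- move=> [Aw Bw] k /=; rewrite !inE => /orP[/eqP ->|/eqP ->]; first by rewrite eqxx.
  by rewrite eq_sym (negbTE ij).
- move=> h; split.
    by have := h i; rewrite /= !inE !eqxx; apply.
  by have := h j; rewrite /= !inE eqxx orbT (eq_sym j) (negbTE ij); apply.
Qed.

(** The law of the pair agrees with the product of the marginal laws on rectangles, hence
    everywhere; Tonelli's theorem then factors the integral. *)
Lemma integral_independent_mul (Y Z : {RV P >-> R}) (g h : R -> R) :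
  (forall A B, measurable A -> measurable B ->
     P (Y @^-1` A `&` Z @^-1` B) = P (Y @^-1` A) * P (Z @^-1` B)) ->
  measurable_fun setT g -> measurable_fun setT h ->
  (forall u, (0 <= g u)%R) -> (forall u, (0 <= h u)%R) ->
  \int[P]_w (g (Y w) * h (Z w))%:E = \int[P]_w (g (Y w))%:E * \int[P]_w (h (Z w))%:E.
Proof.
move=> indYZ mg mh g0 h0.
have mYZ : measurable_fun setT (fun w => (Y w, Z w)) by exact: measurable_fun_pair.
pose m' := measure_function_pushforward__canonical__measure_function_Measure P mYZ.
pose k (z : R * R) := (g z.1 * h z.2)%:E.
have mk : measurable_fun setT k.
  apply/measurable_EFinP; apply: measurable_funM.
    exact: measurableT_comp.
  exact: measurableT_comp.
have k0 z : 0 <= k z by rewrite lee_fin mulr_ge0.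
transitivity (\int[m']_z k z); first by rewrite ge0_integral_pushforward.
have prodE A : measurable A -> m' A = (distribution P Y \x distribution P Z)%E A.
  by move=> mA; apply/esym/product_measure_unique => // B C mB mC; exact: indYZ.
rewrite (@eq_measure_integral _ _ _ setT (distribution P Y \x distribution P Z)); last by move=> A mA _; exact: prodE.
rewrite fubini_tonelli1//=.
have mhE : measurable_fun setT (EFin \o h) by exact/measurable_EFinP.
have mgE : measurable_fun setT (EFin \o g) by exact/measurable_EFinP.
have inner y : fubini_F (distribution P Z) k y = (g y)%:E * \int[P]_w (h (Z w))%:E.
  rewrite /fubini_F /k /=; under eq_integral do rewrite EFinM.
  rewrite ge0_integralZl// ?lee_fin//; last by move=> u _; rewrite lee_fin.
  by congr (_ * _); rewrite (@ge0_integral_distribution _ _ _ _ _ P Z (EFin \o h)).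
under eq_integral do rewrite inner.
rewrite ge0_integralZr//; last 2 first.
- by move=> u _; rewrite lee_fin.
- by apply: integral_ge0 => w _; rewrite lee_fin.
by congr (_ * _); rewrite (@ge0_integral_distribution _ _ _ _ _ P Y (EFin \o g)).
Qed.

End independence.

Section ge0_real_integrands.
Context {d : measure_display} {T : measurableType d} {R : realType}.
Variable mu : {measure set T -> \bar R}.
Local Open Scope ereal_scope.

Lemma ge0_integral_EFinZl (k : R) (f : T -> R) : (0 <= k)%R ->
  measurable_fun setT f -> (forall w, (0 <= f w)%R) ->
  \int[mu]_w (k * f w)%:E = k%:E * \int[mu]_w (f w)%:E.
Proof.
move=> k0 mf f0; have mfE : measurable_fun setT (EFin \o f) by exact/measurable_EFinP.
have f0E w : setT w -> 0 <= (EFin \o f) w by rewrite lee_fin.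
exact: (@ge0_integralZl_EFin _ _ _ mu _ measurableT (EFin \o f) f0E mfE _ k0).
Qed.

Lemma ge0_integral_EFinD (f g : T -> R) :
  measurable_fun setT f -> measurable_fun setT g ->
  (forall w, (0 <= f w)%R) -> (forall w, (0 <= g w)%R) ->
  \int[mu]_w (f w + g w)%:E = \int[mu]_w (f w)%:E + \int[mu]_w (g w)%:E.
Proof.
move=> mf mg f0 g0; have mfE : measurable_fun setT (EFin \o f) by exact/measurable_EFinP.
have mgE : measurable_fun setT (EFin \o g) by exact/measurable_EFinP.
have f0E w : setT w -> 0 <= (EFin \o f) w by rewrite lee_fin.
have g0E w : setT w -> 0 <= (EFin \o g) w by rewrite lee_fin.
exact: (@ge0_integralD _ _ _ mu _ measurableT (EFin \o f) (EFin \o g) f0E mfE g0E mgE).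
Qed.

Lemma ge0_integral_EFin_sum (n : nat) (f : 'I_n -> T -> R) :
  (forall k, measurable_fun setT (f k)) -> (forall k w, (0 <= f k w)%R) ->
  \int[mu]_w (\sum_(k < n) f k w)%:E = \sum_(k < n) \int[mu]_w (f k w)%:E.
Proof.
move=> mf f0; have mfE k : measurable_fun setT (EFin \o f k) by exact/measurable_EFinP.
under eq_integral do rewrite -sumEFin.
have f0E k w : setT w -> 0 <= (EFin \o f k) w by rewrite lee_fin.
exact: (@ge0_integral_sum _ _ _ mu _ measurableT _ (fun k => EFin \o f k) mfE f0E).
Qed.

End ge0_real_integrands.

(** * Mean and variance of a mean of independent copies *)

Section sample_mean.
Context {d : measure_display} {T : measurableType d} {R : realType}.
Variables (P : probability T R) (X : {RV P >-> R}) (Xs : nat -> {RV P >-> R}).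
Hypothesis iidX : iid_copies X Xs.
Variables (g : R -> R) (m v : R).
Hypotheses (mg : measurable_fun setT g) (g0 : forall u, 0 <= g u).
Hypotheses (gm : (\int[distribution P X]_u (g u)%:E = m%:E)%E)
  (gv : (\int[distribution P X]_u (g u ^+ 2)%:E = v%:E)%E).
Local Open Scope ereal_scope.

Let integral_copy (f : R -> R) k : measurable_fun setT f -> (forall u, (0 <= f u)%R) ->
  \int[P]_w (f (Xs k w))%:E = \int[distribution P X]_u (f u)%:E.
Proof.
move=> mf f0; have mfE : measurable_fun setT (EFin \o f) by exact/measurable_EFinP.
have := @ge0_integral_distribution _ _ _ _ _ P (Xs k) (EFin \o f) mfE f0 => <-.
by apply: eq_measure_integral => A mA _; exact: iidX.2.
Qed.

Let mgk k : measurable_fun setT (fun w => g (Xs k w)).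
Proof. exact: measurableT_comp. Qed.

Let integral_pair i j :
  \int[P]_w (g (Xs i w) * g (Xs j w))%:E = (if i == j then v else m ^+ 2)%:E.
Proof.
case: eqVneq => [->|ij].
  rewrite -gv -(@integral_copy (fun u => g u ^+ 2)%R j).
  - by apply: eq_integral => w _; rewrite expr2.
  - exact: measurable_funX.
  - by move=> u; exact: sqr_ge0.
rewrite (@integral_independent_mul _ _ _ P (Xs i) (Xs j) g g)//.
  by rewrite !integral_copy// gm expr2 EFinM.
by move=> A B mA mB; apply: mutually_independent_pair => //; exact: iidX.1.
Qed.

Definition sample_mean n w : R := (n%:R^-1 * \sum_(k < n) g (Xs k w))%R.

Let mean_ge0 n w : (0 <= sample_mean n w)%R.
Proof. by rewrite mulr_ge0 ?invr_ge0// sumr_ge0. Qed.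

Let measurable_mean n : measurable_fun setT (sample_mean n).
Proof. by apply: measurable_funM => //; apply: measurable_sum => k. Qed.

Lemma expectation_sample_mean n : (0 < n)%N -> 'E_P[sample_mean n] = m%:E.
Proof.
move=> n0; rewrite unlock /sample_mean ge0_integral_EFinZl ?invr_ge0//.
- rewrite ge0_integral_EFin_sum//; under eq_bigr do rewrite integral_copy// gm.
  rewrite sumEFin sumr_const card_ord -EFinM; congr EFin.
  by rewrite -[(m *+ n)%R]mulr_natl mulKf// pnatr_eq0 -lt0n.
- by apply: measurable_sum => k.
- by move=> w; apply: sumr_ge0.
Qed.

(** Each of the [n] rows has [n] terms [m ^+ 2] and an excess [v - m ^+ 2] on the diagonal; after
    division by [n ^+ 2] the excess is the variance. *)
Let sum_pairs n : (\sum_(i < n) \sum_(j < n) (if (i : nat) == j then v else m ^+ 2) =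
   n%:R ^+ 2 * m ^+ 2 + n%:R * (v - m ^+ 2))%R.
Proof.
have inner (i : 'I_n) : (\sum_(j < n) (if (i : nat) == j then v else m ^+ 2) = n%:R * m ^+ 2 + (v - m ^+ 2))%R.
  rewrite (eq_bigr (fun j : 'I_n => m ^+ 2 + (if i == j then v - m ^+ 2 else 0)))%R.
    rewrite big_split/= sumr_const card_ord mulr_natl; congr (_ + _)%R.
    by rewrite -big_mkcond/= (big_pred1 i)// => j; rewrite /= eq_sym.
  by move=> j _; rewrite -val_eqE/=; case: ifP => _; rewrite ?addr0// addrC subrK.
under eq_bigr do rewrite inner.
by rewrite sumr_const card_ord -[LHS]mulr_natl; ring.
Qed.

Lemma variance_sample_mean n : (0 < n)%N -> 'V_P[sample_mean n] = ((v - m ^+ 2) / n%:R)%:E.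
Proof.
move=> n0; have EA := expectation_sample_mean n0.
have n1 : (0 < n%:R :> R)%R by rewrite ltr0n.
have m0 : (0 <= m)%R.
  by rewrite -lee_fin -EA; apply: expectation_ge0.
have IA : \int[P]_w (sample_mean n w)%:E = m%:E by rewrite -EA unlock.
have IA2 : \int[P]_w (sample_mean n w ^+ 2)%:E = (n%:R^-1 ^+ 2 * (n%:R ^+ 2 * m ^+ 2 + n%:R * (v - m ^+ 2)))%:E.
  have E w : (sample_mean n w ^+ 2 =
      n%:R^-1 ^+ 2 * \sum_(i < n) \sum_(j < n) (g (Xs i w) * g (Xs j w)))%R.
    by rewrite /sample_mean exprMn expr2 [in X in (_ * X = _)%R]expr2 big_distrlr/= -expr2.
  have mij i j : measurable_fun setT (fun w => g (Xs i w) * g (Xs j w))%R by exact: measurable_funM.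
  have pij i j w : (0 <= g (Xs i w) * g (Xs j w))%R by rewrite mulr_ge0.
  have mi (i : 'I_n) : measurable_fun setT (fun w => \sum_(j < n) g (Xs i w) * g (Xs j w))%R.
    by apply: measurable_sum => j.
  have pi (i : 'I_n) w : (0 <= \sum_(j < n) g (Xs i w) * g (Xs j w))%R by apply: sumr_ge0.
  under eq_integral do rewrite E.
  rewrite ge0_integral_EFinZl ?sqr_ge0//; last 2 first.
  - by apply: measurable_sum => i.
  - by move=> w; apply: sumr_ge0.
  rewrite [RHS]EFinM; congr (_ * _); rewrite ge0_integral_EFin_sum// -sum_pairs -sumEFin.
  apply: eq_bigr => i _; rewrite ge0_integral_EFin_sum// -sumEFin; apply: eq_bigr => j _.
  exact: integral_pair.
have VE : 'V_P[sample_mean n] = \int[P]_w ((sample_mean n w - m) ^+ 2)%:E.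
  rewrite /variance unlock EA unlock; apply: eq_integral => w _.
  by rewrite expr2.
have mA := measurable_mean n.
have mA2 : measurable_fun setT (fun w => (sample_mean n w ^+ 2)%R) by exact: measurable_funX.
have mAm : measurable_fun setT (fun w => ((sample_mean n w - m) ^+ 2)%R).
  by apply: measurable_funX; apply: measurable_funB.
(* [(A - m) ^+ 2 + 2 * m * A = A ^+ 2 + m ^+ 2] has four nonnegative terms, so additivity for
   nonnegative functions suffices; the finite term is subtracted afterwards. *)
have key : 'V_P[sample_mean n] + (2 * m)%:E * m%:E =
    (n%:R^-1 ^+ 2 * (n%:R ^+ 2 * m ^+ 2 + n%:R * (v - m ^+ 2)))%:E + (m ^+ 2)%:E.
  have m2E : \int[P]_w (m ^+ 2)%:E = (m ^+ 2)%:E by have := @expectation_cst _ _ _ P (m ^+ 2)%R; rewrite unlock.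
  have m20 : (0 <= 2 * m)%R by rewrite mulr_ge0.
  rewrite VE -IA2 -m2E -[in LHS]IA -ge0_integral_EFinZl// -!ge0_integral_EFinD//.
  - by apply: eq_integral => w _; congr EFin; ring.
  - by move=> w; exact: sqr_ge0.
  - by move=> w; exact: sqr_ge0.
  - exact: measurable_funM.
  - by move=> w; exact: sqr_ge0.
  - by move=> w; rewrite mulr_ge0.
have : 'V_P[sample_mean n] = (n%:R^-1 ^+ 2 * (n%:R ^+ 2 * m ^+ 2 + n%:R * (v - m ^+ 2)))%:E + (m ^+ 2)%:E - (2 * m)%:E * m%:E.
  by rewrite -key -EFinM addeK.
move=> ->; rewrite -EFinM -EFinD; congr EFin.
by field; rewrite gt_eqF.
Qed.

End sample_mean.

(** * Moments of the kernel under the law of [X] *)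

Section kernel_moments.
Context {d : measure_display} {T : measurableType d} {R : realType}.
Variables (P : probability T R) (X : {RV P >-> R}) (f : R -> R).
Hypotheses (fX : has_density_on_pos X f) (fC2 : C2_on_pos f).
Notation D := (distribution P X).

(** The values of [f] outside the positive half-line are arbitrary; cutting them off gives a density
    with respect to Lebesgue measure on the whole line. *)
Let fpos (u : R) : R := if 0 < u then f u else 0.

Let measurable_fpos : measurable_fun setT fpos.
Proof.
have [mf _ _] := fX; apply: measurable_fun_if => //.
- exact: measurable_fun_ltr.
- rewrite setTI (_ : _ @^-1` _ = `]0, +oo[%classic)//.
  by apply/seteqP; split => u /=; rewrite in_itv/= andbT.
Qed.

Let fpos_ge0 u : 0 <= fpos u.
Proof. by rewrite /fpos; case: ifPn => // u0; have [_ f0 _] := fX; exact: f0. Qed.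

Let distribution_fpos A : measurable A ->
  (D A = \int[lebesgue_measure]_(u in A) (fpos u)%:E)%E.
Proof.
move=> mA; have [_ _ fE] := fX; rewrite fE// integral_mkcondr.
apply: eq_integral => u _; rewrite patchE /fpos.
by rewrite mem_setE in_itv/= andbT; case: ifP.
Qed.

(* [lebesgue_measure] and [D] live on two measurable types with carrier [R] whose
   displays differ, hence the detour through the measure space of [X]. *)
Let integral_fpos (g : R -> R) : measurable_fun setT g -> (forall u, 0 <= g u) ->
  (\int[D]_u (g u)%:E = \int[lebesgue_measure]_u (g u * fpos u)%:E)%E.
Proof.
move=> mg g0; have mgE : measurable_fun setT (EFin \o g) by exact/measurable_EFinP.
pose X' : T -> measurableTypeR R := X.
have mX : measurable_fun setT X' by exact: (@measurable_funPT _ _ _ _ X).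
pose nu := measure_function_pushforward__canonical__measure_function_Measure P mX.
rewrite -(@ge0_integral_density _ _ R lebesgue_measure nu fpos g measurable_fpos fpos_ge0 distribution_fpos mg g0).
rewrite (@ge0_integral_distribution _ _ _ _ _ P X (EFin \o g) mgE g0).
apply/esym; rewrite (@ge0_integral_pushforward _ _ _ _ _ _ mX P setT (EFin \o g)).
- by rewrite preimage_setT.
- by [].
- exact: mgE.
- by move=> u _; rewrite lee_fin.
Qed.

Variables (q xi x a : R).
Hypotheses (q01 : 0 <= q <= 1) (xi0 : 0 < xi) (x0 : 0 < x).
Hypotheses (a0 : 0 < a) (qa : q != 0 -> 1 - a < xi / q) (Xa : finite_power_moment X (- a)).

Let negative_moment : exists2 M, 0 <= M & (\int[D]_u (u `^ (- a))%:E = M%:E)%E.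
Proof.
pose I := (\int[D]_u (u `^ (- a))%:E)%E.
have IE : I = 'E_P[fun w => (X w `^ (- a))%R]%E.
  rewrite unlock /I (@ge0_integral_distribution _ _ _ _ _ P X (fun u => (u `^ (- a))%:E))//.
    by apply/measurable_EFinP; exact: measurable_powR.
  by move=> u; rewrite lee_fin powR_ge0.
have I0 : (0 <= I)%E by apply: integral_ge0 => u _; rewrite lee_fin powR_ge0.
have Ify : (I < +oo)%E by rewrite IE.
exists (fine I); first by rewrite fine_ge0.
by rewrite fineK// ge0_fin_numE.
Qed.

Section smoothing.
Variable eps : nat -> R.
Hypotheses (eps0 : forall n, 0 < eps n) (ceps : eps n @[n --> \oo] --> (0 : R)).
Notation K n := (kern q xi x (eps n ^+ 2)).

Let mK n : measurable_fun setT (K n).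
Proof. by apply: measurable_kern => //; rewrite exprn_gt0. Qed.

Let K0 n u : 0 <= K n u. Proof. exact: kern_ge0. Qed.

Lemma kernel_moments : exists m v : nat -> R, [/\
  \forall n \near \oo, (\int[D]_u (K n u)%:E = (m n)%:E)%E,
  \forall n \near \oo, (\int[D]_u (K n u ^+ 2)%:E = (v n)%:E)%E,
  (m n - f x) / eps n ^+ 2 @[n --> \oo] --> x * f^`(2)%classic x / 2 &
  eps n * v n @[n --> \oo] --> f x / (2 * Num.sqrt pi * Num.sqrt x)].
Proof.
have pf := peano_C2_on_pos fC2 x0.
have [d1 d10 first_moment] := kernel_first_moment q01 xi0 x0 measurable_fpos fpos_ge0 pf.
have [d2 d20 second_moment] := kernel_second_moment q01 xi0 x0 measurable_fpos fpos_ge0 pf.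
(* One window has to serve both local moments, valid for small windows, and [kern_tail], valid for
   [d <= 1]. *)
pose r := Num.min (Num.min d1 d2) 1.
have r0 : 0 < r by rewrite !lt_min d10 d20 ltr01.
have r1 : 0 < r <= d1 by rewrite r0 !ge_min lexx.
have r2 : 0 < r <= d2 by rewrite r0 !ge_min lexx orbT.
have r3 : 0 < r <= 1 by rewrite r0 !ge_min lexx orbT.
have [m mE cm] := first_moment _ r1 _ eps0 ceps.
have [v vE cv] := second_moment _ r2 _ eps0 ceps.
have [h0 [p [C [h00 p1 C0 tail]]]] := kern_tail q01 xi0 x0 r3 a0 qa.
have [M M0 ME] := negative_moment.
have mw (g h : R -> R) : measurable_fun setT g -> measurable_fun setT h ->
    measurable_fun setT (fun u => if window x r u then g u else h u : R).
  by move=> mg mh; rewrite /window; apply: meas_if; eta_expand; meas.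
have local (g : R -> R) : measurable_fun setT g -> (forall u, 0 <= g u) ->
  (\int[D]_u (if window x r u then g u else 0)%:E =
   \int[lebesgue_measure]_u (if window x r u then g u * fpos u else 0)%:E)%E.
  move=> mg g0.
  rewrite integral_fpos.
  - by apply: eq_integral => u _; case: ifP => _; rewrite ?mul0r.
  - exact: mw.
  - by move=> u; case: ifP.
have split (g : R -> R) : measurable_fun setT g -> (forall u, 0 <= g u) ->
  (\int[D]_u (g u)%:E = \int[lebesgue_measure]_u (if window x r u then g u * fpos u else 0)%:E +
     \int[D]_u (if window x r u then 0 else g u)%:E)%E.
  move=> mg g0; rewrite -local// -ge0_integral_EFinD.
  - by apply: eq_integral => u _; case: (window x r u); rewrite /= ?addr0 ?add0r.
  - exact: mw.
  - exact: mw.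
  - by move=> u; case: ifP.
  - by move=> u; case: ifP.
have small : \forall n \near \oo, eps n ^+ 2 <= h0.
  have lim : eps n ^+ 2 @[n --> \oo] --> (0 : R) ^+ 2 by cvg_tac.
  rewrite expr0n in lim; move/cvgrPdist_le : lim => /(_ _ h00).
  by apply: filterS => n; rewrite sub0r normrN ger0_norm ?sqr_ge0.
(* The tail bound integrated against the law of [X], [M] being the moment of order [- a]; it is
   [o(eps ^+ 2)] because [1 < p]. *)
pose B n := C * ((eps n ^+ 2) `^ p * M + eps n ^+ 4).
pose t1 n := fine (\int[D]_u (if window x r u then 0 else K n u)%:E).
pose t2 n := fine (\int[D]_u (if window x r u then 0 else K n u ^+ 2)%:E).
(* A general [g] covers both the kernel and its square. *)
have tailE (g : R -> R) c n : measurable_fun setT g -> (forall u, 0 <= g u) -> 0 <= c ->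
    (forall u, 0 < u -> ~~ window x r u -> g u <= c * ((eps n ^+ 2) `^ p * u `^ (- a) + eps n ^+ 4)) ->
    (forall u, u <= 0 -> g u = 0) ->
    exists2 t, 0 <= t <= c * ((eps n ^+ 2) `^ p * M + eps n ^+ 4) &
      (\int[D]_u (if window x r u then 0 else g u)%:E = t%:E)%E.
  move=> mg g0 c0 gle gneg.
  pose I := (\int[D]_u (if window x r u then 0 else g u)%:E)%E.
  have e4 : 0 <= eps n ^+ 4 by rewrite exprn_ge0// ltW.
  have mp : measurable_fun setT (fun u : R => u `^ (- a)) by exact: measurable_powR.
  have up : (I <= (c * ((eps n ^+ 2) `^ p * M + eps n ^+ 4))%:E)%E.
    have -> : (c * ((eps n ^+ 2) `^ p * M + eps n ^+ 4))%:E =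
      (\int[D]_u (c * ((eps n ^+ 2) `^ p * u `^ (- a) + eps n ^+ 4))%:E)%E.
      rewrite ge0_integral_EFinZl//.
      - rewrite ge0_integral_EFinD//.
        + have I1 := @ge0_integral_EFinZl _ _ _ D _ _ (powR_ge0 (eps n ^+ 2) p) mp (fun u => powR_ge0 u (- a)).
          have I2 := @expectation_cst _ _ _ D (eps n ^+ 4); rewrite unlock in I2.
          by rewrite I1 ME I2.
        + exact: measurable_funM.
        + by move=> u; rewrite mulr_ge0 ?powR_ge0.
      - by apply: measurable_funD => //; exact: measurable_funM.
      - by move=> u; rewrite addr_ge0// mulr_ge0 ?powR_ge0.
    apply: ge0_le_integral => //=.
    - by move=> u _; rewrite lee_fin; case: ifP.
    - by apply/measurable_EFinP; exact: mw.
    - apply/measurable_EFinP; apply: measurable_funM => //; apply: measurable_funD => //.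
      exact: measurable_funM.
    - move=> u _; rewrite lee_fin.
      have pos : 0 <= c * ((eps n ^+ 2) `^ p * u `^ (- a) + eps n ^+ 4).
        by rewrite mulr_ge0// addr_ge0// mulr_ge0 ?powR_ge0.
      case: ifPn => // wF; have [u0|u0] := ltP 0 u; last by rewrite gneg.
      exact: gle.
  have I0 : (0 <= I)%E by apply: integral_ge0 => u _; rewrite lee_fin; case: ifP.
  have If : I \is a fin_num by rewrite ge0_fin_numE// (le_lt_trans up)// ltry.
  exists (fine I); last by rewrite fineK.
  by rewrite fine_ge0//= -lee_fin fineK.
have hh n : eps n ^+ 2 <= h0 -> 0 < eps n ^+ 2 <= h0 by move=> nh; rewrite exprn_gt0.
have tail1 n : eps n ^+ 2 <= h0 -> exists2 t, 0 <= t <= B n &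
    (\int[D]_u (if window x r u then 0 else K n u)%:E = t%:E)%E.
  move=> nh; apply: tailE => //; first exact: ltW.
  - by move=> u u0 wu; have [+ _] := tail _ _ (hh _ nh) u0 wu; rewrite -exprM.
  - by move=> u u0; rewrite /kern ltNge u0.
have tail2 n : eps n ^+ 2 <= h0 -> exists2 t, 0 <= t <= C * B n &
    (\int[D]_u (if window x r u then 0 else K n u ^+ 2)%:E = t%:E)%E.
  move=> nh; rewrite /B mulrA; apply: tailE => //.
  - exact: measurable_funX.
  - by move=> u; exact: sqr_ge0.
  - by rewrite mulr_ge0// ltW.
  - move=> u u0 wu; have [h1 h2] := tail _ _ (hh _ nh) u0 wu.
    by move: h1; rewrite -exprM -mulrA => h1; rewrite expr2 ler_pM.
  - by move=> u u0; rewrite /kern ltNge u0 expr0n.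
have cB : B n / eps n ^+ 2 @[n --> \oo] --> (0 : R).
  have ce2 : eps n ^+ 2 @[n --> \oo] --> (0 : R)^'+.
    apply: cvg_at_right0; first by move=> n; rewrite exprn_gt0.
    have lim : eps n ^+ 2 @[n --> \oo] --> (0 : R) ^+ 2 by cvg_tac.
    by rewrite expr0n in lim.
  have p10 : 0 < p - 1 by rewrite subr_gt0.
  have c1 : (eps n ^+ 2) `^ (p - 1) @[n --> \oo] --> (0 : R).
    exact: (@cvg_comp _ _ _ (fun n => eps n ^+ 2) (fun h => h `^ (p - 1)) _ _ _ ce2 (powR_cvg0 p10)).
  have lim : C * ((eps n ^+ 2) `^ (p - 1) * M + eps n ^+ 2) @[n --> \oo] --> C * (0 * M + 0 ^+ 2) by cvg_tac.
  rewrite expr0n mul0r addr0 mulr0 in lim; apply: cvg_trans lim; apply: near_eq_cvg; near=> n.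
  have e2 : 0 < eps n ^+ 2 by rewrite exprn_gt0.
  rewrite /B powRB ?(gt_eqF e2) ?implybT// powRr1 ?(ltW e2)//.
  by field; rewrite gt_eqF.
exists (fun n => m n + t1 n), (fun n => v n + t2 n); split.
- near=> n; have nh : eps n ^+ 2 <= h0 by near: n.
  have [t _ tE] := tail1 _ nh; rewrite split// /t1 tE EFinD; congr (_ + _)%E.
  by near: n.
- near=> n; have nh : eps n ^+ 2 <= h0 by near: n.
  have [t _ tE] := tail2 _ nh.
  rewrite split; [|exact: measurable_funX|by move=> u; exact: sqr_ge0].
  by rewrite /t2 tE EFinD; congr (_ + _)%E; near: n.
- have ct : t1 n / eps n ^+ 2 @[n --> \oo] --> (0 : R).
    apply: (squeeze_cvgr _ (cvg_cst (0 : R)) cB); near=> n.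
    have nh : eps n ^+ 2 <= h0 by near: n.
    have [t /andP[t0 tB] tE] := tail1 _ nh; rewrite /t1 tE /=.
    by rewrite divr_ge0 ?sqr_ge0//= ler_pM2r// invr_gt0 exprn_gt0.
  have lim : (m n - f x) / eps n ^+ 2 + t1 n / eps n ^+ 2 @[n --> \oo] -->
    x ^+ 2 * f^`(2)%classic x / 2 / x + 0 by exact: cvg_add.
  rewrite [X in _ --> X](_ : _ = x * f^`(2)%classic x / 2) in lim; last by field; rewrite gt_eqF.
  apply: cvg_trans lim; apply: near_eq_cvg; near=> n.
  by rewrite -mulrDl; congr (_ / _); ring.
- have cCB : C * (eps n ^+ 2 * eps n * (B n / eps n ^+ 2)) @[n --> \oo] --> C * ((0 : R) ^+ 2 * 0 * 0) by cvg_tac.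
  rewrite !mulr0 in cCB.
  have ct : eps n * t2 n @[n --> \oo] --> (0 : R).
    apply: (squeeze_cvgr _ (cvg_cst (0 : R)) cCB); near=> n.
    have nh : eps n ^+ 2 <= h0 by near: n.
    have [t /andP[t0 tB] tE] := tail2 _ nh; rewrite /t2 tE /=.
    have -> : C * (eps n ^+ 2 * eps n * (B n / eps n ^+ 2)) = eps n * (C * B n).
      by field; rewrite gt_eqF.
    by rewrite mulr_ge0 ?(ltW (eps0 n))//= ler_pM2l.
  have lim : eps n * v n + eps n * t2 n @[n --> \oo] --> f x / (2 * Num.sqrt pi * Num.sqrt x) + 0 by exact: cvg_add.
  rewrite addr0 in lim; apply: cvg_trans lim; apply: near_eq_cvg; near=> n.
  by rewrite mulrDr.
Unshelve. all: by end_near. Qed.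

End smoothing.
End kernel_moments.

Section little_o_sequences.
Context {R : realType}.

Lemma littleo_of_cvg (u g : nat -> R) : (\forall n \near \oo, 0 < g n) ->
  u n / g n @[n --> \oo] --> (0 : R) -> u =o_\oo g.
Proof.
move=> gpos ug; apply/eqoP => e e0.
move/cvgrPdist_le : ug => /(_ _ e0) h.
near=> n; have gn : 0 < g n by near: n.
have : `|0 - u n / g n| <= e by near: n.
by rewrite sub0r normrN normrM normfV ler_pdivrMr ?normr_gt0 ?gt_eqF.
Unshelve. all: by end_near. Qed.

End little_o_sequences.

(** When [alpha = +oo] every order is available and [a = 1] makes [1 - a = 0], below any positive
    bound; otherwise [a] is [alpha] itself. *)
Lemma finite_moment_order (R : realType) (d : measure_display) (T : measurableType d)
    (P : probability T R) (X : {RV P >-> R}) (alpha : \bar R) (xi q : R) :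
  0 < xi -> 0 <= q -> (0 < alpha)%E -> finite_neg_moment X alpha ->
  (1%:E - alpha < xi%:E / q%:E)%E ->
  exists2 a, 0 < a & (q != 0 -> 1 - a < xi / q) /\ finite_power_moment X (- a).
Proof.
move=> xi0 q0 + Xa h; case: alpha Xa h => [a| |]//= Xa h a0; last first.
  exists 1 => //; split; last exact: Xa.
  by move=> qn0; rewrite subrr divr_gt0// lt_neqAle eq_sym qn0.
exists a => //; split=> // qn0.
by move: h; rewrite inver (negbTE qn0) -EFinM lte_fin.
Qed.

(* In the extended reals, xi%:E / 0 = +oo. *)
Theorem theorem4p2 (R : realType) (d : measure_display) (T : measurableType d)
    (P : probability T R) (X : {RV P >-> R}) (Xs : nat -> {RV P >-> R})
    (f : R -> R) (alpha beta : \bar R) (xi theta : R) (eta : nat -> R) :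
  {ae P, forall w, 0 < X w} ->
  has_density_on_pos X f ->
  C2_on_pos f ->
  iid_copies X Xs ->
  (0 < alpha)%E -> (0 < beta)%E ->
  ((5 / 2)%:E < 2%:E * alpha + beta)%E ->
  finite_neg_moment X alpha ->
  finite_pos_moment X beta ->
  0 < xi ->
  0 <= theta <= pi / 2 ->
  ((4^-1)%:E - (2^-1)%:E * beta < xi%:E / (cos theta ^+ 2)%:E)%E ->
  (1%:E - alpha < xi%:E / (sin theta ^+ 2)%:E)%E ->
  (forall n, 0 < eta n) ->
  eta @ \oo --> 0 ->
  (fun n => n%:R * eta n) @ \oo --> +oo ->
  forall x : R, 0 < x ->
  let fhat n := mellin_meijer_estimator xi theta (fun k w => Xs k w) (eta n) n x in
  (exists r : nat -> R,
     r =o_\oo (fun n => eta n ^+ 2) /\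
     \forall n \near \oo,
       ('E_P[fhat n] - (f x)%:E
        = (2^-1 * eta n ^+ 2 * x * f^`(2)%classic x + r n)%:E)%E) /\
  (exists r : nat -> R,
     r =o_\oo (fun n => (n%:R * eta n)^-1) /\
     \forall n \near \oo,
       ('V_P[fhat n]
        = (f x / (2 * Num.sqrt pi * n%:R * eta n * Num.sqrt x) + r n)%:E)%E).

Proof.
move=> _ fX fC2 iidX alpha0 _ _ Xalpha _ xi0 theta01 _ xi_alpha eta0 ceta _ x x0 fhat.
pose q := sin theta ^+ 2.
have q01 : 0 <= q <= 1 by rewrite sqr_ge0 /q sin2cos2 lerBlDr lerDl sqr_ge0.
have [q0 _] := andP q01.
have [a a0 [qa Xa]] := finite_moment_order xi0 q0 alpha0 Xalpha xi_alpha.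
have [m [v [mE vE cm cv]]] := kernel_moments fX fC2 q01 xi0 x0 a0 qa Xa eta0 ceta.
have mk n : measurable_fun setT (kern q xi x (eta n ^+ 2)) by apply: measurable_kern; rewrite ?exprn_gt0.
have fhatE n : fhat n = sample_mean Xs (kern q xi x (eta n ^+ 2)) n.
  apply/funext => w; rewrite /fhat /mellin_meijer_estimator /sample_mean; congr (_ * _).
  by apply: eq_bigr => k _; exact: kernel_formula.
have EE : \forall n \near \oo, ('E_P[fhat n] = (m n)%:E)%E.
  near=> n; have n0 : (0 < n)%N by near: n; exact: nbhs_infty_gt.
  rewrite fhatE; apply: (expectation_sample_mean iidX) => //.
  - by move=> u; exact: kern_ge0.
  - by near: n.
have VE : \forall n \near \oo, ('V_P[fhat n] = ((v n - m n ^+ 2) / n%:R)%:E)%E.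
  near=> n; have n0 : (0 < n)%N by near: n; exact: nbhs_infty_gt.
  rewrite fhatE; apply: (variance_sample_mean iidX) => //.
  - by move=> u; exact: kern_ge0.
  - by near: n.
  - by near: n.
have cm0 : m n @[n --> \oo] --> f x.
  have lim : (m n - f x) / eta n ^+ 2 * eta n ^+ 2 + f x @[n --> \oo] -->
    x * f^`(2)%classic x / 2 * 0 ^+ 2 + f x by cvg_tac.
  rewrite expr0n mulr0 add0r in lim; apply: cvg_trans lim; apply: near_eq_cvg; near=> n.
  by field; rewrite gt_eqF.
split.
- exists (fun n => m n - f x - 2^-1 * eta n ^+ 2 * x * f^`(2)%classic x); split; last first.
    near=> n; rewrite (_ : 'E_P[_]%E = (m n)%:E); last by near: n.
    by rewrite -EFinB; congr EFin; ring.
  apply: littleo_of_cvg; first by near=> n; rewrite exprn_gt0.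
  have lim : (m n - f x) / eta n ^+ 2 - x * f^`(2)%classic x / 2 @[n --> \oo] -->
    x * f^`(2)%classic x / 2 - x * f^`(2)%classic x / 2 by cvg_tac.
  rewrite subrr in lim; apply: cvg_trans lim; apply: near_eq_cvg; near=> n.
  by field; rewrite gt_eqF.
- pose V n := f x / (2 * Num.sqrt pi * n%:R * eta n * Num.sqrt x).
  exists (fun n => (v n - m n ^+ 2) / n%:R - V n); split; last first.
    near=> n; rewrite (_ : 'V_P[_]%E = ((v n - m n ^+ 2) / n%:R)%:E); last by near: n.
    by congr EFin; rewrite /V; ring.
  have sx0 : 0 < Num.sqrt x by rewrite sqrtr_gt0.
  have sp0 : 0 < Num.sqrt (pi : R) by rewrite sqrtr_gt0 pi_gt0.
  apply: littleo_of_cvg.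
    near=> n; rewrite invr_gt0 mulr_gt0// ltr0n.
    by near: n; exact: nbhs_infty_gt.
  (* Multiplied by [n * eta], the subtracted square [m ^+ 2 / n] becomes [eta * m ^+ 2], which
     vanishes because [m] converges: only the second moment is felt in the variance. *)
  have lim : eta n * v n - eta n * m n ^+ 2 - f x / (2 * Num.sqrt pi * Num.sqrt x) @[n --> \oo] -->
    f x / (2 * Num.sqrt pi * Num.sqrt x) - 0 * f x ^+ 2 - f x / (2 * Num.sqrt pi * Num.sqrt x) by cvg_tac.
  rewrite mul0r subr0 subrr in lim; apply: cvg_trans lim; apply: near_eq_cvg; near=> n.
  have n0 : 0 < n%:R :> R by rewrite ltr0n; near: n; exact: nbhs_infty_gt.
  by rewrite /V; move: sp0; set p := Num.sqrt (pi : R) => p0; field; rewrite !gt_eqF.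
Unshelve. all: by end_near. Qed.
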